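(* Let $n \geq 1$, $k \geq 2$ and $B \in \mathrm{GL}_n(\mathbb{R})$. There exists a $C^2_{loc}$-neighborhood $\mathcal{U}$ of $P_B$ in $\mathrm{Hom}(\Gamma_{n,k},\mathcal{D}(\mathbb{R}^n,0))$ such that every local action $P \in \mathcal{U}$ is smoothly conjugate to $P_{B'}$ for some $B' = B'(P) \in \mathrm{GL}_n(\mathbb{R})$.
   Context: $\Gamma_{n,k} = \langle a, b_1,\dots,b_n \mid a b_i a^{-1} = b_i^k,\ b_i b_j = b_j b_i\rangle$. Elements of $\mathrm{GL}_n(\mathbb{R})$ are identified with bases $B=(v_1,\dots,v_n)$ of $\mathbb{R}^n$ (columns). Identify $S^n=\mathbb{R}^n\cup\{\infty\}$; the action $\rho_B$ on $S^n$ is $\rho_B^a(x)=kx$, $\rho_B^{b_i}(x)=x+v_i$, fixing $\infty$. $\mathcal{D}(\mathbb{R}^n,0)$ is the group of germs at $0$ of local diffeomorphisms of $\mathbb{R}^n$ fixing $0$; $D^{(r)}_0F$ denotes the $r$-th derivative at $0$, a symmetric $r$-linear map $(\mathbb{R}^n)^r\to\mathbb{R}^n$, normed by $\|F\|^{(r)}=\sup\{\|F(\xi_1,\dots,\xi_r)\| : \|\xi_i\|\le 1\}$ (Euclidean norm). The $C^r_{loc}$-topology on $\mathcal{D}(\mathbb{R}^n,0)$ is given by the pseudo-distance $d(F,G)=\sum_{i=1}^r \|D^{(i)}_0F - D^{(i)}_0G\|^{(i)}$, and $\mathrm{Hom}(\Gamma_{n,k},\mathcal{D}(\mathbb{R}^n,0))$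 (local actions) carries the induced product topology. Let $\bar\phi: S^n\setminus\{0\}\to\mathbb{R}^n$, $\bar\phi(x)=x/\|x\|^2$ ($\bar\phi(\infty)=0$), and $P_B^\gamma=\bar\phi\circ\rho_B^\gamma\circ\bar\phi^{-1}$ as germs at $0$. Local actions $P_1,P_2$ are smoothly conjugate if there is $H\in\mathcal{D}(\mathbb{R}^n,0)$ with $P_2^\gamma\circ H = H\circ P_1^\gamma$ for all $\gamma$. *)

(* Defs.v *)
From HB Require Import structures.
From mathcomp Require Import all_boot all_order all_algebra.
From mathcomp Require Import all_classical all_reals all_analysis.
Set Implicit Arguments. Unset Strict Implicit. Unset Printing Implicit Defensive.
Import Order.TTheory GRing.Theory Num.Theory.
Import numFieldNormedType.Exports.
Local Open Scope classical_set_scope.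
Local Open Scope ring_scope.

Section Defs.
Variables (R : realType) (n : nat).
Local Notation V := 'cV[R]_n.

Definition sqnorm (x : V) : R := \sum_(i < n) (x i 0) ^+ 2.
Definition enorm (x : V) : R := Num.sqrt (sqnorm x).

Fixpoint iterD (vs : seq V) (f : V -> V) : V -> V :=
  match vs with
  | [::] => f
  | v :: vs' => 'D_v (iterD vs' f)
  end.

Definition smooth_on (U : set V) (f : V -> V) : Prop :=
  forall (vs : seq V) (x : V), U x -> differentiable (iterD vs f) x.

Definition is_local_diffeo_germ (f : V -> V) : Prop :=
  f 0 = 0 /\
  exists (U W : set V) (g : V -> V),
    [/\ open U /\ open W, U 0 /\ W 0,
        (forall x, U x -> W (f x)) /\ (forall y, W y -> U (g y)),
        (forall x, U x -> g (f x) = x) /\ (forall y, W y -> f (g y) = y)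
      & smooth_on U f /\ smooth_on W g].

Definition germ_eq (f g : V -> V) : Prop := \forall x \near (0 : V), f x = g x.

(* a local action of Gamma_{n,k}, given by the images A of a and Bs i of b_i;
   the relation a b_i a^{-1} = b_i^k is written as a b_i = b_i^k a *)
Definition local_action (k : nat) (A : V -> V) (Bs : 'I_n -> V -> V) : Prop :=
  [/\ is_local_diffeo_germ A,
      (forall i, is_local_diffeo_germ (Bs i)),
      (forall i, germ_eq (A \o Bs i) (iter k (Bs i) \o A))
    & (forall i j, germ_eq (Bs i \o Bs j) (Bs j \o Bs i))].

Definition dist1 (f g : V -> V) : R :=
  sup [set enorm ('D_xi f 0 - 'D_xi g 0) | xi in [set xi | enorm xi <= 1]].
Definition dist2 (f g : V -> V) : R :=
  sup [set enorm ('D_(xi.1) ('D_(xi.2) f) 0 - 'D_(xi.1) ('D_(xi.2) g) 0)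
      | xi in [set xi : V * V | enorm xi.1 <= 1 /\ enorm xi.2 <= 1]].
Definition dC2 (f g : V -> V) : R := dist1 f g + dist2 f g.

Definition phibar (x : V) : V := (sqnorm x)^-1 *: x.

(* germ at 0 of phibar o g o phibar^{-1}, for g a map of S^n fixing infinity:
   phibar^{-1}(0) = infinity is sent to infinity, then to 0 *)
Definition conj_inv (g : V -> V) (x : V) : V :=
  if x == 0 then 0 else phibar (g (phibar x)).

Definition PB_a (k : nat) : V -> V := conj_inv (fun x => k%:R *: x).
Definition PB_b (B : 'M[R]_n) (i : 'I_n) : V -> V :=
  conj_inv (fun x => x + col i B).

End Defs.

(* Main.v *)
(* By the relation a b_i = b_i^k a, closeness in C^1 alone forces the linear parts of the b_i to be
   trivial: for N = D b_i - 1 the relation reads (k - 1) N = small * N. The second-order parts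
   of the b_i span a linear family of quadratic vector fields Q_v which commute, because the b_i
   commute to third order, and which is close to the family of the conformal fields induced by
   translations seen from infinity. Evaluating at a base point e turns (Q_v) into a commutative
   unital product with unit e; the polarized commutation relations and closeness show that this
   product is a spin factor, i.e. it is determined by a linear form and a positive definite
   quadratic form, so (Q_v) is the conformal family up to linear maps. The linear part of k a
   preserves the Q_v and is close to 1, hence is 1. The germ a is then linearized by the limit H of
   k^m a^m, which is smooth because the same limit exists for the tangent map of a. Finally
   H b_i H^-1 and the corresponding inverted translation satisfy the same relation with x / k and
   agree to second order, and a scaling argument shows that they are equal. *)
Require Import Defs.
From HB Require Import structures.
From mathcomp Require Import all_boot all_order all_algebra.
From mathcomp Require Import all_classical all_reals all_analysis.
From mathcomp Require Import ring lra.
Set Implicit Arguments. Unset Strict Implicit. Unset Printing Implicit Defensive.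
Import Order.TTheory GRing.Theory Num.Theory.
Import numFieldNormedType.Exports.
Local Open Scope classical_set_scope.
Local Open Scope ring_scope.

(** * Differentiability of finite order in several variables *)

Section SmoothCalculus.
Context {R : realType}.

(** Order three is the threshold of the argument. The relation expresses a defect at [x] through [k]
    points of size about [|x| / k], with a prefactor [k], so a defect of order [|x| ^ p] reproduces
    itself with a factor of about [k ^ (2 - p)]. This contracts from [p = 3] on; hence the germs
    must first be made to agree to order two. Commutation, in turn, yields an identity of order
    three between germs of which only the quadratic parts are under control. Taylor remainders are
    therefore kept in a Lipschitz form, [isLip], in which the unknown cubic parts of the two
    compositions cancel. Two difficulties shape the linearization: the derivatives of [k ^ m a ^ m]
    must be bounded uniformly in [m], which is done by reading them off orbits of iterated tangent
    maps; and all orders of differentiability are needed on one common ball, although each is first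
    obtained on a ball of its own. Estimates use the sup norm of column vectors; Euclidean data
    enter through [dot] and through the comparison with [dC2]. *)

Lemma near_all n (x : 'cV[R]_n) (P : set 'cV[R]_n) : (forall y, P y) -> \forall y \near x, P y.
Proof. by move=> H; apply: (filterS (P := setT)) => //; exact: filterT. Qed.

Lemma near_forall n (I : finType) (x : 'cV[R]_n) (P : I -> set 'cV[R]_n) :
  (forall i, \forall y \near x, P i y) -> \forall y \near x, forall i, P i y.
Proof. by move=> H; apply: (@filter_forall _ _ P _ (nbhs_filter x)). Qed.

Lemma open_near n (x : 'cV[R]_n) (P : set 'cV[R]_n) : (\forall y \near x, P y) ->
  exists2 e, 0 < e & forall y, `|y - x| < e -> P y.
Proof.
by move=> /nbhs_ballP [e /= e0 H]; exists e => // y yx; apply: H; rewrite -ball_normE /= distrC.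
Qed.

Lemma near0_ex n (P : set 'cV[R]_n) : (\forall y \near (0 : 'cV[R]_n), P y) ->
  exists2 e, 0 < e & forall y, `|y| < e -> P y.
Proof. by move/open_near => [e e0 H]; exists e => // y ye; apply: H; rewrite subr0. Qed.

Lemma near0_lt n e : 0 < e -> \forall y \near (0 : 'cV[R]_n), `|y| < e.
Proof.
move=> e0; apply/nbhs_ballP; exists e => // y; by rewrite -ball_normE /= sub0r normrN.
Qed.

Lemma cV_delta n (x : 'cV[R]_n) : x = \sum_i x i 0 *: delta_mx i 0.
Proof.
apply/colP => j; rewrite summxE (bigD1 j) //= !mxE !eqxx mulr1 big1 ?addr0 //.
by move=> i ij; rewrite !mxE eq_sym (negPf ij) mulr0.
Qed.

Lemma norm_coord n (x : 'cV[R]_n) i : `|x i 0| <= `|x|.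
Proof.
rewrite [leRHS]/Num.Def.normr/= mx_normrE.
exact: (le_bigmax _ (fun ij : 'I_n * 'I_1 => `|x ij.1 ij.2|) (i, 0)).
Qed.

Lemma norm_le_coord n (x : 'cV[R]_n) c :
  0 <= c -> (forall i, `|x i 0| <= c) -> `|x| <= c.
Proof.
move=> c0 xc; rewrite [leLHS]/Num.Def.normr/= mx_normrE.
by apply: bigmax_le => // -[i j] _ /=; rewrite (ord1 j).
Qed.

Lemma norm_delta_le n (i : 'I_n) : `|delta_mx i 0 : 'cV[R]_n| <= 1.
Proof.
apply: norm_le_coord => // j; rewrite mxE eqxx andbT.
by case: (_ == _); rewrite ?normr1 ?normr0.
Qed.

Lemma linear_continuous_cV n (W : normedModType R) (L : {linear 'cV[R]_n -> W}) :
  continuous L.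
Proof.
have -> : (L : _ -> _) = (fun x => \sum_i x i 0 *: L (delta_mx i 0)).
  by apply/funext => x; rewrite [in LHS](cV_delta x) linear_sum; apply: eq_bigr => i _; rewrite linearZ.
apply: continuous_big => [|i _ x]; first exact: add_continuous.
apply: cvgZr_tmp.
  exact: (nbhs_filter x).
exact: coord_continuous.
Qed.

Lemma diff_delta n (W : normedModType R) (f : 'cV[R]_n -> W) x v :
  differentiable f x ->
  'D_v f x = \sum_i v i 0 *: 'D_(delta_mx i 0) f x.
Proof.
move=> df; rewrite deriveE // [in LHS](cV_delta v) linear_sum.
by apply: eq_bigr => i _; rewrite linearZ /= deriveE.
Qed.

Lemma differentiable_eps_gen (V W : normedModType R) (f : V -> W) (L : {linear V -> W}) x :
  continuous L ->
  (forall e, 0 < e -> \forall h \near (0 : V), `|f (h + x) - f x - L h| <= e * `|h|) ->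
  differentiable f x /\ forall v, 'D_v f x = L v.
Proof.
move=> cL H.
have E : f \o shift x = cst (f x) + L +o_ 0 id.
  apply/eqaddoP => e e0; apply: filterS (H e e0) => h.
  by rewrite /= !fctE /= opprD addrA.
have d : differentiable f x.
  by apply/diff_locallyP; rewrite (diff_unique cL E).
by split=> // v; rewrite deriveE // (diff_unique cL E).
Qed.

Lemma differentiable_epsP (V W : normedModType R) (f : V -> W) x e : 0 < e -> differentiable f x ->
  \forall h \near (0 : V), `|f (h + x) - f x - 'D_h f x| <= e * `|h|.
Proof.
move=> e0 df; move/diff_locallyP: (df) => [_ /eqaddoP /(_ e e0)].
apply: filterS => h /=; rewrite !fctE /= opprD addrA.
by rewrite deriveE.
Qed.

Lemma differentiable_eps n (W : normedModType R) (f : 'cV[R]_n -> W) (L : {linear 'cV[R]_n -> W}) x :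
  (forall e, 0 < e -> \forall h \near (0 : 'cV[R]_n), `|f (h + x) - f x - L h| <= e * `|h|) ->
  differentiable f x /\ forall v, 'D_v f x = L v.
Proof. by move=> H; apply: differentiable_eps_gen => //; exact: linear_continuous_cV. Qed.

Lemma derive_coord n m (f : 'cV[R]_n -> 'cV[R]_m) x v i : differentiable f x ->
  ('D_v f x) i 0 = 'D_v (fun y => f y i 0) x.
Proof. by move=> df; rewrite derive_mx ?mxE //; exact: diff_derivable. Qed.

Lemma differentiable_vec n m (f : 'cV[R]_n -> 'cV[R]_m) x :
  differentiable f x <-> forall i, differentiable (fun y => f y i 0) x.
Proof.
split=> [df i|df].
  exact: (differentiable_comp df (differentiable_coord _ i 0)).
have -> : f = \sum_i (fun y => f y i 0 *: delta_mx i 0).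
  apply/funext => y; rewrite fct_sumE; exact: cV_delta.
by apply: differentiable_sum => i; apply: differentiableZl.
Qed.

(* [Cr r f x]: [r]-fold differentiability of a scalar function in a neighbourhood of [x]. *)
Fixpoint Cr (r : nat) n (f : 'cV[R]_n -> R) (x : 'cV[R]_n) : Prop :=
  match r with
  | 0 => True
  | r'.+1 => (\forall y \near x, differentiable f y) /\ forall v, Cr r' ('D_v f) x
  end.

Definition vCr r n m (f : 'cV[R]_n -> 'cV[R]_m) x := forall i, Cr r (fun y => f y i 0) x.

Lemma near_near n (x : 'cV[R]_n) (P : set 'cV[R]_n) :
  (\forall y \near x, P y) -> \forall y \near x, \forall z \near y, P z.
Proof. exact: nbhs_interior. Qed.

Lemma near_derive n (W : normedModType R) (f g : 'cV[R]_n -> W) (x v : 'cV[R]_n) :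
  (\forall y \near x, f y = g y) -> \forall y \near x, 'D_v f y = 'D_v g y.
Proof. by move/near_near; apply: filterS => y /near_eq_derive. Qed.

Lemma near_eq_differentiable n (W : normedModType R) (f g : 'cV[R]_n -> W)
    (x : 'cV[R]_n) :
  (\forall y \near x, f y = g y) -> differentiable f x -> differentiable g x.
Proof.
move=> fg df.
have fgx := nbhs_singleton fg.
suff [] : differentiable g x /\ forall v, 'D_v g x = 'd f x v by [].
apply: differentiable_eps => e e0; have := differentiable_epsP e0 df.
have : \forall h \near (0 : 'cV[R]_n), f (h + x) = g (h + x).
  have [d d0 H] := open_near fg.
  by apply: filterS (near0_lt _ d0) => h hd; apply: H; rewrite addrK.
by apply: filterS2 => h fgh; rewrite -fgx -fgh deriveE.
Qed.

Lemma Cr_near_eq r n (f g : 'cV[R]_n -> R) x :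
  (\forall y \near x, f y = g y) -> Cr r f x -> Cr r g x.
Proof.
elim: r f g => //= r IH f g fg [df Df]; split; last first.
  by move=> v; apply: IH (Df v); exact: near_derive.
by have := near_near fg; apply: filterS2 df => y dfy /near_eq_differentiable; exact.
Qed.

Lemma CrS r n (f : 'cV[R]_n -> R) x : Cr r.+1 f x -> Cr r f x.
Proof. by elim: r f => //= r IH f [df Df]; split=> // v; apply: IH; exact: Df. Qed.

Lemma Cr_le r s n (f : 'cV[R]_n -> R) x : (r <= s)%N -> Cr s f x -> Cr r f x.
Proof. by move/subnK <-; elim: (_ - _)%N => //= k IH /CrS. Qed.

Lemma Cr_diff r n (f : 'cV[R]_n -> R) x : Cr r.+1 f x -> differentiable f x.
Proof. by case=> /nbhs_singleton. Qed.

Lemma Cr_cst r n c x : Cr r (fun _ : 'cV[R]_n => c) x.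
Proof.
elim: r c => //= r IH c; split; first by apply: near_all => y; exact: differentiable_cst.
by move=> v; have -> : 'D_v (fun=> c) = (fun=> 0 : R) by apply/funext => y; rewrite derive_cst.
Qed.

Lemma Cr_coord r n i x : Cr r (fun y : 'cV[R]_n => y i 0) x.
Proof.
case: r => //= r; split.
  by apply: near_all => y; exact: differentiable_coord.
move=> v; have -> : 'D_v (fun y : 'cV[R]_n => y i 0) = (fun=> v i 0).
  by apply/funext => y; rewrite -(@derive_coord _ _ id) // derive_id.
exact: Cr_cst.
Qed.

Lemma CrD r n (f g : 'cV[R]_n -> R) x : Cr r f x -> Cr r g x -> Cr r (fun y => f y + g y) x.
Proof.
elim: r f g => //= r IH f g [df Df] [dg Dg]; split.
  by apply: filterS2 df dg => y dfy dgy; exact: differentiableD.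
move=> v; apply: (Cr_near_eq _ (IH _ _ (Df v) (Dg v))).
apply: filterS2 df dg => y dfy dgy; rewrite deriveD //; exact: diff_derivable.
Qed.

Lemma CrM r n (f g : 'cV[R]_n -> R) x : Cr r f x -> Cr r g x -> Cr r (fun y => f y * g y) x.
Proof.
elim: r f g => //= r IH f g Hf Hg; have [df Df] := Hf; have [dg Dg] := Hg; split.
  by apply: filterS2 df dg => y dfy dgy; exact: differentiableM.
move=> v.
have := CrD (IH _ _ (CrS Hf) (Dg v)) (IH _ _ (CrS Hg) (Df v)).
apply: Cr_near_eq; apply: filterS2 df dg => y dfy dgy.
by rewrite deriveM //; exact: diff_derivable.
Qed.

Lemma Cr_sum r n (I : Type) (s : seq I) (P : pred I) (f : I -> 'cV[R]_n -> R) x :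
  (forall i, P i -> Cr r (f i) x) -> Cr r (fun y => \sum_(i <- s | P i) f i y) x.
Proof.
move=> H; elim: s => [|i s IH].
  by apply: Cr_near_eq (Cr_cst r 0 x); apply: near_all => y; rewrite big_nil.
case E : (P i); last first.
  by apply: Cr_near_eq IH; apply: near_all => y; rewrite big_cons E.
by apply: Cr_near_eq (CrD (H _ E) IH); apply: near_all => y; rewrite big_cons E.
Qed.

Lemma Cr_prod r n (I : Type) (s : seq I) (P : pred I) (f : I -> 'cV[R]_n -> R) x :
  (forall i, P i -> Cr r (f i) x) -> Cr r (fun y => \prod_(i <- s | P i) f i y) x.
Proof.
move=> H; elim: s => [|i s IH].
  by apply: Cr_near_eq (Cr_cst r 1 x); apply: near_all => y; rewrite big_nil.
case E : (P i); last first.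
  by apply: Cr_near_eq IH; apply: near_all => y; rewrite big_cons E.
by apply: Cr_near_eq (CrM (H _ E) IH); apply: near_all => y; rewrite big_cons E.
Qed.

Lemma CrV r n (f : 'cV[R]_n -> R) x : f x != 0 -> Cr r f x -> Cr r (fun y => (f y)^-1) x.
Proof.
move=> fx0; elim: r => //= r IH Hf; have [df Df] := Hf.
have f0 : \forall y \near x, f y != 0.
  have /differentiable_continuous cf := Cr_diff Hf.
  exact: (@cvgr_neq0 _ _ _ _ (nbhs_filter x) f (f x) cf fx0).
split.
  by apply: filterS2 df f0 => y dfy fy; exact: differentiableV.
move=> v; have C := IH (CrS Hf).
have := CrM (Cr_cst r (-1) x) (CrM (CrM C C) (Df v)).
apply: Cr_near_eq; apply: filterS2 df f0 => y dfy fy.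
rewrite deriveV //; last exact: diff_derivable.
by rewrite [in RHS]/GRing.scale /= expr2 invfM mulN1r mulNr.
Qed.

Lemma derive_comp n m (f : 'cV[R]_n -> 'cV[R]_m) (W : normedModType R) (g : 'cV[R]_m -> W) x v :
  differentiable f x -> differentiable g (f x) ->
  'D_v (g \o f) x = 'D_('D_v f x) g (f x).
Proof.
move=> df dg; rewrite !deriveE //; last exact: differentiable_comp.
by rewrite diff_comp.
Qed.

Lemma vCr_diff_near r n m (f : 'cV[R]_n -> 'cV[R]_m) x :
  vCr r.+1 f x -> \forall y \near x, differentiable f y.
Proof.
move=> Hf; have : \forall y \near x, forall i, differentiable (fun y => f y i 0) y.
  by apply: near_forall => i; case: (Hf i).
by apply: filterS => y /differentiable_vec.
Qed.

Lemma vCr_diff r n m (f : 'cV[R]_n -> 'cV[R]_m) x :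
  vCr r.+1 f x -> differentiable f x.
Proof. by move/vCr_diff_near/nbhs_singleton. Qed.

Lemma vCr_le r s n m (f : 'cV[R]_n -> 'cV[R]_m) x : (r <= s)%N -> vCr s f x -> vCr r f x.
Proof. by move=> rs Hf i; exact: Cr_le (Hf i). Qed.

Lemma vCr_near_eq r n m (f g : 'cV[R]_n -> 'cV[R]_m) x :
  (\forall y \near x, f y = g y) -> vCr r f x -> vCr r g x.
Proof. by move=> fg Hf i; apply: Cr_near_eq (Hf i); apply: filterS fg => y ->. Qed.

Lemma vCr_derive r n m (f : 'cV[R]_n -> 'cV[R]_m) x v : vCr r.+1 f x -> vCr r ('D_v f) x.
Proof.
move=> Hf i; have [_ /(_ v)] := Hf i; apply: Cr_near_eq.
by apply: filterS (vCr_diff_near Hf) => y dy; rewrite derive_coord.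
Qed.

Lemma Cr_comp r n m (f : 'cV[R]_n -> 'cV[R]_m) (g : 'cV[R]_m -> R) x :
  vCr r f x -> Cr r g (f x) -> Cr r (g \o f) x.
Proof.
elim: r f g => // r IH f g Hf Hg; have [dg Dg] := Hg.
have df := vCr_diff_near Hf.
have dgf : \forall y \near x, differentiable g (f y).
  by have /differentiable_continuous cf := vCr_diff Hf; exact: (cf _ dg).
split.
  by apply: filterS2 df dgf => y dfy dgy; exact: differentiable_comp.
move=> v.
(* The direction ['D_v f y] in the chain rule varies with [y]; expanding it over the basis leaves
   derivatives of [g] in constant directions, to which the induction hypothesis applies. *)
have : Cr r (fun y => \sum_i (('D_v f) y) i 0 * ('D_(delta_mx i 0) g \o f) y) x.
  apply: Cr_sum => i _; apply: CrM; first exact: vCr_derive.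
  by apply: IH (Dg _); exact: (vCr_le (leqnSn _) Hf).
apply: Cr_near_eq; apply: filterS2 df dgf => y dfy dgy.
by rewrite (derive_comp v dfy dgy) (diff_delta _ dgy).
Qed.

Lemma vCr_comp r n m l (f : 'cV[R]_n -> 'cV[R]_m) (g : 'cV[R]_m -> 'cV[R]_l) x :
  vCr r f x -> vCr r g (f x) -> vCr r (g \o f) x.
Proof. by move=> Hf Hg i; exact: (Cr_comp Hf (Hg i)). Qed.

Lemma vCr_id r n (x : 'cV[R]_n) : vCr r (@idfun 'cV[R]_n) x.
Proof. by move=> i; exact: Cr_coord. Qed.

Lemma vCr_mulmx r n m (M : 'M[R]_(m, n)) x : vCr r (fun y : 'cV[R]_n => M *m y) x.
Proof.
move=> i; have : Cr r (fun y : 'cV[R]_n => \sum_j M i j * y j 0) x.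
  by apply: Cr_sum => j _; apply: CrM; [exact: Cr_cst|exact: Cr_coord].
by apply: Cr_near_eq; apply: near_all => y; rewrite mxE.
Qed.

Lemma vCrD r n m (f g : 'cV[R]_n -> 'cV[R]_m) x : vCr r f x -> vCr r g x ->
  vCr r (fun y => f y + g y) x.
Proof.
by move=> Hf Hg i; apply: Cr_near_eq (CrD (Hf i) (Hg i)); apply: near_all => y; rewrite mxE.
Qed.

Lemma vCrZ r n m (s : 'cV[R]_n -> R) (g : 'cV[R]_n -> 'cV[R]_m) x : Cr r s x -> vCr r g x ->
  vCr r (fun y => s y *: g y) x.
Proof.
by move=> Hf Hg i; apply: Cr_near_eq (CrM Hf (Hg i)); apply: near_all => y; rewrite mxE.
Qed.

Lemma vCr_cst r n m (c : 'cV[R]_m) (x : 'cV[R]_n) : vCr r (fun=> c) x.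
Proof. by move=> i; exact: Cr_cst. Qed.

Lemma vCr_sum r n m (I : Type) (s : seq I) (P : pred I) (f : I -> 'cV[R]_n -> 'cV[R]_m) x :
  (forall i, P i -> vCr r (f i) x) -> vCr r (fun y => \sum_(i <- s | P i) f i y) x.
Proof.
move=> H i; have := Cr_sum s (fun j Pj => H j Pj i).
by apply: Cr_near_eq; apply: near_all => y; rewrite summxE.
Qed.

Lemma vCr_iter r n (f : 'cV[R]_n -> 'cV[R]_n) k x :
  (forall j, (j < k)%N -> vCr r f (iter j f x)) -> vCr r (iter k f) x.
Proof.
elim: k => [|k IH] H; first exact: vCr_id.
have -> : iter k.+1 f = f \o iter k f by [].
by apply: vCr_comp; [apply: IH => j jk; apply: H; exact: ltnW|exact: H].
Qed.

Lemma smooth_on_vCr r n (U : set 'cV[R]_n) (f : 'cV[R]_n -> 'cV[R]_n) x :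
  open U -> smooth_on U f -> U x -> vCr r f x.
Proof.
move=> oU sf Ux.
have nU : \forall y \near x, U y by exact: open_nbhs_nbhs.
(* Stated for all iterated derivatives, since each differentiation lengthens [vs] while [r]
   decreases. *)
have H vs : vCr r (Defs.iterD vs f) x.
  elim: r vs => [|r IH] vs i //; split.
    by apply: filterS nU => y Uy; apply/differentiable_vec: i; exact: sf.
  move=> v; have := IH (v :: vs) i; apply: Cr_near_eq.
  by apply: filterS nU => y Uy; rewrite /= derive_coord //; exact: sf.
exact: (H [::]).
Qed.

Lemma vCr_smooth_on n (U : set 'cV[R]_n) (f : 'cV[R]_n -> 'cV[R]_n) :
  (forall r x, U x -> vCr r f x) -> smooth_on U f.
Proof.
move=> H vs x Ux.
have {}H r : vCr r (Defs.iterD vs f) x.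
  elim: vs r => [|v vs IH] r /=; first exact: H.
  exact: vCr_derive.
exact: vCr_diff (H 1%N).
Qed.

End SmoothCalculus.

(** * Norm inequalities for sums and multiples *)

Section NormBounds.
Context {R : realType}.
Variable n : nat.
Implicit Types (a b : 'cV[R]_n) (x y c : R).

Lemma normD_le a b x y : `|a| <= x -> `|b| <= y -> `|a + b| <= x + y.
Proof. by move=> ax yb; apply: le_trans (ler_normD _ _) _; exact: lerD. Qed.

Lemma normB_le a b x y : `|a| <= x -> `|b| <= y -> `|a - b| <= x + y.
Proof. by move=> ax yb; apply: normD_le => //; rewrite normrN. Qed.

Lemma normZ_le c a x y : `|c| <= x -> `|a| <= y -> `|c *: a| <= x * y.
Proof. by move=> cx ay; rewrite normrZ; exact: ler_pM. Qed.
End NormBounds.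

(** * Orders of vanishing and Taylor expansions *)

Section Taylor.
Context {R : realType}.

Definition isO p n (W : normedModType R) (f : 'cV[R]_n -> W) :=
  exists2 C, 0 <= C & \forall y \near (0 : 'cV[R]_n), `|f y| <= C * `|y| ^+ p.

Lemma isO_near_eq p n (W : normedModType R) (f g : 'cV[R]_n -> W) :
  (\forall y \near (0 : 'cV[R]_n), f y = g y) -> isO p f -> isO p g.
Proof.
by move=> fg [C C0 H]; exists C => //; apply: filterS2 fg H => y ->.
Qed.

Lemma isO_ext p n (W : normedModType R) (f g : 'cV[R]_n -> W) : f =1 g -> isO p f -> isO p g.
Proof. by move=> /funext ->. Qed.

Lemma isO_le p q n (W : normedModType R) (f : 'cV[R]_n -> W) : (p <= q)%N -> isO q f -> isO p f.
Proof.
move=> pq [C C0 H]; exists C => //; apply: filterS2 H (near0_lt _ ltr01) => y Hy y1.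
apply: le_trans Hy _; apply: ler_wpM2l => //.
by apply: ler_wiXn2l => //; exact: ltW.
Qed.

Lemma isOD p n (W : normedModType R) (f g : 'cV[R]_n -> W) : isO p f -> isO p g ->
  isO p (fun y => f y + g y).
Proof.
move=> [C C0 Hf] [D D0 Hg]; exists (C + D); first exact: addr_ge0.
apply: filterS2 Hf Hg => y Hf Hg; rewrite mulrDl.
by apply: le_trans (ler_normD _ _) _; exact: lerD.
Qed.

Lemma isO0 p n (W : normedModType R) : isO p (fun _ : 'cV[R]_n => 0 : W).
Proof. by exists 0 => //; apply: near_all => y; rewrite normr0 mul0r. Qed.

Lemma isO_sum p n (W : normedModType R) (I : Type) (s : seq I) (P : pred I)
    (f : I -> 'cV[R]_n -> W) : (forall i, isO p (f i)) ->
  isO p (fun y => \sum_(i <- s | P i) f i y).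
Proof.
move=> H; elim: s => [|i s IH].
  by apply: isO_ext (isO0 p _ _) => y; rewrite big_nil.
case E : (P i); last by apply: isO_ext IH => y; rewrite big_cons E.
by apply: isO_ext (isOD (H i) IH) => y; rewrite big_cons E.
Qed.

Lemma isOZ p q n (W : normedModType R) (s : 'cV[R]_n -> R) (f : 'cV[R]_n -> W) :
  isO p s -> isO q f -> isO (p + q) (fun y => s y *: f y).
Proof.
move=> [C C0 Hf] [D D0 Hg]; exists (C * D); first exact: mulr_ge0.
apply: filterS2 Hf Hg => y Hf Hg; rewrite normrZ exprD mulrACA.
by apply: ler_pM.
Qed.

Lemma isO_cst n (W : normedModType R) (w : W) : isO 0 (fun _ : 'cV[R]_n => w).
Proof. by exists `|w| => //; apply: near_all => y; rewrite expr0 mulr1. Qed.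

Lemma isON p n (W : normedModType R) (f : 'cV[R]_n -> W) : isO p f -> isO p (fun y => - f y).
Proof. by move=> [C C0 H]; exists C => //; apply: filterS H => y; rewrite normrN. Qed.

Lemma isO_scale p n (W : normedModType R) (f : 'cV[R]_n -> W) (c : R) :
  isO p f -> isO p (fun y => c *: f y).
Proof. exact: (isOZ (isO_cst n c)). Qed.

Lemma isOB p n (W : normedModType R) (f g : 'cV[R]_n -> W) : isO p f -> isO p g ->
  isO p (fun y => f y - g y).
Proof. by move=> Hf Hg; exact: (isOD Hf (isON Hg)). Qed.

Lemma isO_id n : isO 1 (fun y : 'cV[R]_n => y).
Proof. by exists 1 => //; apply: near_all => y; rewrite mul1r expr1. Qed.

Lemma isO_vec p n m (f : 'cV[R]_n -> 'cV[R]_m) :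
  (forall i, isO p (fun y => f y i 0)) -> isO p f.
Proof.
move=> H; apply: (@isO_ext _ _ _ (fun y => \sum_i f y i 0 *: (delta_mx i 0 : 'cV[R]_m))).
  by move=> y; rewrite [RHS]cV_delta.
apply: isO_sum => i; have := isOZ (H i) (isO_cst n (delta_mx i 0 : 'cV[R]_m)).
by rewrite addn0.
Qed.

Lemma isO_mulmx p n m l (M : 'M[R]_(l, m)) (f : 'cV[R]_n -> 'cV[R]_m) :
  isO p f -> isO p (fun y => M *m f y).
Proof.
move=> [C C0 H]; apply: isO_vec => i.
exists (\sum_j `|M i j| * C); first by apply: sumr_ge0 => j _; exact: mulr_ge0.
apply: filterS H => y Hy; rewrite mxE mulr_suml.
apply: le_trans (ler_norm_sum _ _ _) _; apply: ler_sum => j _.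
rewrite normrM -mulrA; apply: ler_wpM2l => //; apply: le_trans Hy; exact: norm_coord.
Qed.

Lemma isO_cvg0 n m (g : 'cV[R]_n -> 'cV[R]_m) (P : set 'cV[R]_m) : isO 1 g ->
  (\forall z \near (0 : 'cV[R]_m), P z) -> \forall y \near (0 : 'cV[R]_n), P (g y).
Proof.
move=> [C C0 H] /near0_ex [d d0 HP].
have d' : 0 < d / (C + 1) by rewrite divr_gt0 // ltr_wpDl.
apply: filterS2 H (near0_lt _ d') => y Hy yd; apply: HP.
apply: le_lt_trans Hy _; rewrite expr1.
apply: (@le_lt_trans _ _ ((C + 1) * `|y|)).
  by apply: ler_wpM2r => //; rewrite lerDl.
by rewrite -ltr_pdivlMl ?ltr_wpDl // mulrC.
Qed.

Lemma isO_comp p n m (W : normedModType R) (f : 'cV[R]_m -> W) (g : 'cV[R]_n -> 'cV[R]_m) :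
  isO p f -> isO 1 g -> isO p (f \o g).
Proof.
move=> [C C0 Hf] Hg; have [D D0 Hg'] := Hg.
exists (C * D ^+ p); first by rewrite mulr_ge0 // exprn_ge0.
apply: filterS2 (isO_cvg0 Hg Hf) Hg' => y /= Hfy Hgy.
apply: le_trans Hfy _; rewrite -mulrA -exprMn; apply: ler_wpM2l => //.
by apply: lerXn2r; rewrite ?nnegrE ?normr_ge0 ?mulr_ge0 // -[`|y|]expr1.
Qed.

(** Divide [|f (t x)| <= C t ^ (p + 1) |x| ^ (p + 1)] by [t ^ p] and let [t] tend to 0. This turns
    asymptotic relations between germs into exact identities between their homogeneous parts. *)
Lemma isO_homog p n (W : normedModType R) (f : 'cV[R]_n -> W) :
  (forall t x, f (t *: x) = t ^+ p *: f x) -> isO p.+1 f -> forall x, f x = 0.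
Proof.
move=> hom [C C0 /near0_ex [d d0 H]] x.
apply/eqP; rewrite -normr_le0; apply/ler_addgt0Pr => e e0; rewrite add0r.
pose X := `|x| + 1; have X0 : 0 < X by rewrite ltr_wpDl.
pose K := C * X ^+ p.+1 + 1; have K0 : 0 < K.
  by rewrite ltr_wpDl // mulr_ge0 // exprn_ge0 // ltW.
(* The first bound keeps [t x] in the ball of radius [d], the second makes [t C |x| ^ (p + 1)] at
   most [e]; the ones added in [X] and [K] exclude zero denominators. *)
pose t := Num.min (d / (2 * X)) (e / K).
have t0 : 0 < t by rewrite lt_min !divr_gt0 // mulr_gt0.
have tx : `|t *: x| < d.
  rewrite normrZ gtr0_norm //.
  apply: (@le_lt_trans _ _ (d / (2 * X) * X)).
    by apply: ler_pM; rewrite ?(ltW t0) // ?ge_min ?lexx ?lerDl.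
  rewrite invfM mulrA mulfVK ?gt_eqF //; lra.
have := H _ tx; rewrite hom !normrZ exprMn [`|t ^+ p|]normrX (gtr0_norm t0) => Hx.
have {}Hx : `|f x| <= t * (C * `|x| ^+ p.+1).
  have tp : 0 < t ^+ p by rewrite exprn_gt0.
  by rewrite -(ler_pM2l tp) (le_trans Hx) // exprS mulrCA !mulrA [t * _]mulrC.
apply: le_trans Hx _; apply: (@le_trans _ _ (e / K * K)); last by rewrite divfK ?gt_eqF.
apply: ler_pM; rewrite ?(ltW t0) ?mulr_ge0 ?exprn_ge0 // ?ge_min ?lexx ?orbT //.
rewrite /K -[leLHS]addr0 lerD // ler_wpM2l // lerXn2r ?nnegrE ?(ltW X0) //.
by rewrite /X lerDl.
Qed.

Lemma MVT_cV n (f : 'cV[R]_n -> R) (x h : 'cV[R]_n) :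
  (forall t, 0 <= t <= 1 -> differentiable f (x + t *: h)) ->
  exists2 t, 0 <= t <= 1 & f (x + h) - f x = 'D_h f (x + t *: h).
Proof.
move=> df; pose g : R -> 'cV[R]_n := fun t : R => x + t *: h.
have dg t : is_diff t g (fun s => s *: h).
  have := is_diffD (is_diff_cst x t) (is_diff_scalel t h).
  by move=> dg; apply: is_diff_eq; apply/funext => s; rewrite fctE /= add0r.
have dg1 (t : R) : differentiable g t by case: (dg t).
have dgv (t : R) : 'd g t = ( *:%R ^~ h) :> (R -> 'cV[R]_n) by case: (dg t).
have D (t : R) : 0 <= t <= 1 -> is_derive t (1 : R) (f \o g) ('D_h f (g t)).
  move=> t01; have dft := df _ t01.
  have dfg : differentiable (f \o g) t.
    exact: (differentiable_comp (dg1 t) dft).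
  apply: DeriveDef; first exact: diff_derivable.
  rewrite deriveE // diff_comp //=.
  by rewrite dgv scale1r deriveE.
have := @MVT_segment R (f \o g) (fun t => 'D_h f (g t)) 0 1 ler01.
case.
- by move=> t /itvP t01; apply: D; rewrite !t01.
- apply: derivable_within_continuous => t /itvP t01.
  by have [] := D t; rewrite ?t01.
move=> t; rewrite in_itv /= => t01; rewrite subr0 mulr1 /= /g scale1r scale0r addr0 => ->.
by exists t.
Qed.

Lemma norm_segment n (x z : 'cV[R]_n) (rho t : R) : `|x| <= rho -> `|z| <= rho -> 0 <= t <= 1 ->
  `|z + t *: (x - z)| <= rho.
Proof.
move=> xr zr /andP[t0 t1].
have -> : z + t *: (x - z) = (1 - t) *: z + t *: x.
  by rewrite scalerBr scalerBl scale1r addrA addrAC.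
apply: le_trans (ler_normD _ _) _; rewrite !normrZ !ger0_norm ?subr_ge0 //.
have -> : rho = (1 - t) * rho + t * rho by ring.
by apply: lerD; apply: ler_wpM2l; rewrite ?subr_ge0.
Qed.

(** Mean value theorem on each coordinate; the factor [n] comes from summing [n] partial derivatives
    against the sup norm of [x - z]. *)
Lemma lipschitz_ball n m (f : 'cV[R]_n -> 'cV[R]_m) (rho K : R) : 0 <= K ->
  (forall y, `|y| <= rho -> differentiable f y) ->
  (forall y i, `|y| <= rho -> `|'D_(delta_mx i 0) f y| <= K) ->
  forall x z, `|x| <= rho -> `|z| <= rho -> `|f x - f z| <= n%:R * K * `|x - z|.
Proof.
move=> K0 df Df x z xr zr; apply: norm_le_coord => [|i].
  by rewrite !mulr_ge0.
have [t t01] : exists2 t, 0 <= t <= 1 & (f (z + (x - z))) i 0 - (f z) i 0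
     = 'D_(x - z) (fun y => f y i 0) (z + t *: (x - z)).
  apply: (@MVT_cV _ (fun y => f y i 0)) => t t01.
  by apply/differentiable_vec: i; apply: df; exact: norm_segment.
rewrite subrKC !mxE => ->.
have yr := norm_segment xr zr t01.
rewrite -derive_coord ?(diff_delta _ (df _ yr)) ?summxE; last exact: df.
apply: le_trans (ler_norm_sum _ _ _) _.
have -> : n%:R * K * `|x - z| = \sum_(j < n) (K * `|x - z|).
  by rewrite sumr_const card_ord -[RHS]mulr_natl mulrA.
apply: ler_sum => j _; rewrite mxE normrM mulrC; apply: ler_pM => //.
  by apply: le_trans (Df _ j yr); exact: norm_coord.
exact: norm_coord.
Qed.

(* Uniform form of [f x - f z = O(rho ^ p) (x - z)] on the balls of radius [rho]. *)
Definition isLip p n m (f : 'cV[R]_n -> 'cV[R]_m) :=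
  exists2 C, 0 <= C & exists2 d, 0 < d & forall rho, rho <= d ->
    forall x z, `|x| <= rho -> `|z| <= rho -> `|f x - f z| <= C * rho ^+ p * `|x - z|.

Lemma isO_family p n (W : normedModType R) (I : finType) (f : I -> 'cV[R]_n -> W) :
  (forall i, isO p (f i)) ->
  exists2 C, 0 <= C & \forall y \near (0 : 'cV[R]_n), forall i, `|f i y| <= C * `|y| ^+ p.
Proof.
move=> Df.
have [g Hg] := choice (fun i => let: ex_intro2 C C0 H := Df i in ex_intro (fun C => 0 <= C /\ _) C (conj C0 H)).
exists (\sum_i g i); first by apply: sumr_ge0 => i _; have [] := Hg i.
apply: near_forall => i; have [g0] := Hg i; apply: filterS => y /le_trans; apply.
apply: ler_wpM2r; first by rewrite exprn_ge0.
by rewrite (bigD1 i) //= lerDl; apply: sumr_ge0 => j _; have [] := Hg j.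
Qed.

Lemma isLip_derive p n m (f : 'cV[R]_n -> 'cV[R]_m) :
  (\forall y \near (0 : 'cV[R]_n), differentiable f y) ->
  (forall i, isO p ('D_(delta_mx i 0) f)) -> isLip p f.
Proof.
move=> df Df.
have [C C0 HC] := isO_family Df.
have [d d0 H] := near0_ex (filterI df HC).
exists (n%:R * C); first exact: mulr_ge0.
exists (d / 2); first by rewrite divr_gt0.
move=> rho rd x z xr zr.
have r0 : 0 <= rho by apply: le_trans xr.
have yd (y : 'cV[R]_n) : `|y| <= rho -> `|y| < d.
  move=> yr; apply: le_lt_trans yr _; apply: le_lt_trans rd _; lra.
rewrite -[n%:R * C * _]mulrA; apply: lipschitz_ball (xr) (zr).
- by rewrite mulr_ge0 // exprn_ge0.
- by move=> y /yd /H[].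
- move=> y i yr; have [_ /(_ i)] := H _ (yd _ yr).
  move/le_trans; apply; apply: ler_wpM2l => //.
  by apply: lerXn2r; rewrite ?nnegrE.
Qed.

Lemma isLip_isO p n m (f : 'cV[R]_n -> 'cV[R]_m) : f 0 = 0 -> isLip p f -> isO p.+1 f.
Proof.
move=> f0 [C C0 [d d0 H]]; exists C => //.
apply: filterS (near0_lt _ d0) => y yd.
by have := H _ (ltW yd) y 0 (lexx _); rewrite normr0 f0 !subr0 exprSr mulrA; exact.
Qed.

Lemma differentiable_isO n m (f : 'cV[R]_n -> 'cV[R]_m) : differentiable f 0 -> f 0 = 0 -> isO 1 f.
Proof.
move=> df f0.
exists (1 + \sum_i `|'D_(delta_mx i 0) f 0|); first by rewrite addr_ge0 // sumr_ge0.
apply: filterS (differentiable_epsP ltr01 df) => h; rewrite addr0 f0 subr0 mul1r => H.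
rewrite -[f h](subrK ('D_h f 0)) expr1 mulrDl mul1r.
apply: le_trans (ler_normD _ _) _; apply: lerD => //.
rewrite diff_delta // mulr_suml; apply: le_trans (ler_norm_sum _ _ _) _.
by apply: ler_sum => i _; rewrite normrZ mulrC; apply: ler_wpM2l => //; exact: norm_coord.
Qed.

Lemma derive_mulmx n m (J : 'M[R]_(m, n)) (x : 'cV[R]_n) :
  differentiable (mulmx J : 'cV[R]_n -> 'cV[R]_m) x /\
  forall v, 'D_v (mulmx J : 'cV[R]_n -> 'cV[R]_m) x = J *m v.
Proof.
pose L : {linear 'cV[R]_n -> 'cV[R]_m} := mulmx J.
have cL : continuous L by exact: linear_continuous_cV.
have dJ : differentiable L x by exact: linear_differentiable.
by split=> // w; rewrite deriveE // (diff_lin x cL).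
Qed.

(** The partial derivatives of the remainder are those of [f] minus their values at 0: they vanish
    at 0 and are differentiable there, hence are of order one, and [isLip_derive] integrates this
    bound. *)
Lemma taylor1 n m (f : 'cV[R]_n -> 'cV[R]_m) : vCr 2 f 0 ->
  isLip 1 (fun x => f x - f 0 - 'D_x f 0).
Proof.
move=> Hf; have df := vCr_diff_near Hf; have df0 := nbhs_singleton df.
pose J : 'M[R]_(m, n) := \matrix_(i, j) ('D_(delta_mx j 0) f 0) i 0.
have E x : 'D_x f 0 = J *m x.
  rewrite diff_delta //; apply/colP => i; rewrite summxE mxE.
  by apply: eq_bigr => j _; rewrite !mxE mulrC.
have dJ x := derive_mulmx J x.
have dh : \forall y \near (0 : 'cV[R]_n), differentiable (fun x => f x - f 0 - J *m x) y.
  apply: filterS df => y dfy; apply: differentiableB; last by have [] := dJ y.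
  by apply: differentiableB => //; exact: differentiable_cst.
have -> : (fun x => f x - f 0 - 'D_x f 0) = (fun x => f x - f 0 - J *m x).
  by apply/funext => x; rewrite E.
apply: isLip_derive => // i.
have Di : isO 1 (fun y => 'D_(delta_mx i 0) f y - 'D_(delta_mx i 0) f 0).
  apply: differentiable_isO; last by rewrite subrr.
  apply: differentiableB; last exact: differentiable_cst.
  apply: vCr_diff; exact: vCr_derive.
apply: isO_near_eq Di; apply: filterS df => y dfy.
have [dJy DJy] := dJ y.
rewrite deriveB ?DJy; last 2 first.
- by apply: diff_derivable; apply: differentiableB => //; exact: differentiable_cst.
- exact: diff_derivable.
rewrite deriveB ?derive_cst ?subr0 -?E //; last exact: diff_derivable.
Qed.



Lemma mulmx_norm n m (M : 'M[R]_(m, n)) :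
  exists2 K, 0 <= K & forall x : 'cV[R]_n, `|M *m x| <= K * `|x|.
Proof.
exists (\sum_i \sum_j `|M i j|); first by do 2!apply: sumr_ge0 => ? _.
move=> x; apply: norm_le_coord => [|i].
  by rewrite mulr_ge0 //; do 2!apply: sumr_ge0 => ? _.
rewrite mxE; apply: le_trans (ler_norm_sum _ _ _) _.
apply: (@le_trans _ _ ((\sum_j `|M i j|) * `|x|)).
  rewrite mulr_suml; apply: ler_sum => j _; rewrite normrM; apply: ler_wpM2l => //.
  exact: norm_coord.
apply: ler_wpM2r => //; rewrite [leRHS](bigD1 i) //= lerDl.
by do 2!apply: sumr_ge0 => ? _.
Qed.

Lemma antisym_quad n (W : normedModType R) (a : 'I_n -> 'I_n -> W) (v : 'cV[R]_n) :
  (forall i j, a i j = - a j i) -> \sum_k \sum_l (v k 0 * v l 0) *: a l k = 0.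
Proof.
move=> aa; set X := LHS; have : X = - X.
  rewrite {1}/X exchange_big -sumrN; apply: eq_bigr => k _.
  by rewrite -sumrN; apply: eq_bigr => l _; rewrite mulrC aa scalerN.
move/eqP; rewrite -subr_eq0 opprK -mulr2n -scaler_nat scaler_eq0 pnatr_eq0 /=.
by move/eqP.
Qed.

Lemma scaleB_coord m (c : R) (u w : 'cV[R]_m) i :
  c * (u - w) i 0 = (c *: u) i 0 - (c *: w) i 0.
Proof. by rewrite !mxE mulrBr. Qed.

(** Core of the symmetry of second derivatives. Up to second order the gradient of [r] is an
    antisymmetric linear field, and the mean value theorem from [x] to [x + M x] gives
    [r (x + M x) - r x = F M x + O(x ^ 3)]. For [M = -1] the term [F] vanishes by antisymmetry, so
    [r] is of order three. Then [F M] is of order three for every [M], but homogeneous of degree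
    two, hence zero, and an elementary matrix [M] isolates [a i j]. *)
Lemma antisym_derivative n m (r : 'cV[R]_n -> 'cV[R]_m) (a : 'I_n -> 'I_n -> 'cV[R]_m) :
  r 0 = 0 -> (forall i j, a i j = - a j i) ->
  (\forall y \near (0 : 'cV[R]_n), differentiable r y) ->
  (forall k, isO 2 (fun y => 'D_(delta_mx k 0) r y - \sum_l y l 0 *: a l k)) ->
  forall i j, a i j = 0.
Proof.
move=> r0 aa dr Hr.
have [C C0 HC] := isO_family Hr.
have [d d0 Hd] := near0_ex (filterI dr HC).
pose F (M : 'M[R]_n) (x : 'cV[R]_n) := \sum_k \sum_l ((M *m x) k 0 * x l 0) *: a l k.
have key M : isO 3 (fun x => r (x + M *m x) - r x - F M x).
  have [K K0 HK] := mulmx_norm M.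
  exists (n%:R * K * (C * (1 + K) ^+ 2)).
    by rewrite !mulr_ge0 ?exprn_ge0 ?addr_ge0.
  have d'0 : 0 < d / (1 + K) by rewrite divr_gt0 // ltr_wpDr.
  apply: filterS (near0_lt _ d'0) => x xd.
  have yb t : 0 <= t <= 1 -> `|x + t *: (M *m x)| <= (1 + K) * `|x|.
    move=> /andP[t0 t1]; apply: le_trans (ler_normD _ _) _; rewrite mulrDl mul1r lerD2l.
    rewrite normrZ ger0_norm //; apply: le_trans (HK x).
    by rewrite -[leRHS]mul1r; apply: ler_wpM2r.
  have yd t : 0 <= t <= 1 -> `|x + t *: (M *m x)| < d.
    by move/yb/le_lt_trans; apply; rewrite mulrC -ltr_pdivlMr // ltr_wpDr.
  apply: norm_le_coord => [|i].
    by rewrite !mulr_ge0 ?exprn_ge0 ?addr_ge0.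
  have [t t01] : exists2 t, 0 <= t <= 1 & (r (x + M *m x)) i 0 - (r x) i 0
       = 'D_(M *m x) (fun y => r y i 0) (x + t *: (M *m x)).
    apply: (@MVT_cV _ (fun y => r y i 0)) => t t01.
    by apply/differentiable_vec: i; have [] := Hd _ (yd _ t01).
  set y := x + t *: _; rewrite !mxE => ->.
  have [dy Hy] := Hd _ (yd _ t01); rewrite -derive_coord // diff_delta //.
  (* Passing from [x] to the intermediate point [y = x + t M x] adds [t] times an antisymmetric form
     on the diagonal, that is, zero. *)
  have -> : F M x = \sum_k (M *m x) k 0 *: \sum_l y l 0 *: a l k.
    rewrite -[LHS]addr0 -[X in _ + X = _](scaler0 _ t).
    rewrite -[X in _ + _ *: X = _](antisym_quad (M *m x) aa) scaler_sumr -big_split /=.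
    apply: eq_bigr => k _; rewrite !scaler_sumr -big_split /=.
    apply: eq_bigr => l _; rewrite !scalerA -scalerDl; congr (_ *: _).
    have -> : y l 0 = x l 0 + t * (M *m x) l 0 by rewrite /y !mxE.
    by ring.
  rewrite summxE [X in _ - X]summxE -sumrB; apply: le_trans (ler_norm_sum _ _ _) _.
  have -> : n%:R * K * (C * (1 + K) ^+ 2) * `|x| ^+ 3
     = \sum_(k < n) (K * `|x|) * (C * ((1 + K) * `|x|) ^+ 2).
    rewrite sumr_const card_ord -[RHS]mulr_natl; ring.
  apply: ler_sum => k _; rewrite -[X in `|X|]scaleB_coord normrM.
  apply: ler_pM => //; first by apply: le_trans (HK x); exact: norm_coord.
  apply: le_trans (norm_coord _ _) _.
  apply: le_trans (Hy k) _; apply: ler_wpM2l => //.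
  by apply: lerXn2r; rewrite ?nnegrE ?mulr_ge0 ?addr_ge0 ?yb.
have r3 : isO 3 r.
  have := key (- 1%:M); move/isON; apply: isO_ext => x.
  rewrite mulNmx mul1mx subrr r0 sub0r.
  suff -> : F (- 1%:M) x = 0 by rewrite subr0 opprK.
  rewrite /F mulNmx mul1mx -[RHS]oppr0 -[X in _ = - X](antisym_quad x aa) -sumrN; apply: eq_bigr => k _.
  by rewrite -sumrN; apply: eq_bigr => l _; rewrite mxE mulNr scaleNr.
have F3 M : isO 3 (F M).
  have L1 : isO 1 (fun x : 'cV[R]_n => x + M *m x).
    by apply: isOD; [exact: isO_id|apply: isO_mulmx; exact: isO_id].
  have := isOB (isOB (isO_comp r3 L1) r3) (key M); apply: isO_ext => x /=.
  by rewrite opprB addrC subrK.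
move=> i j.
have hom t x : F (delta_mx j i) (t *: x) = t ^+ 2 *: F (delta_mx j i) x.
  rewrite /F scaler_sumr; apply: eq_bigr => k _; rewrite scaler_sumr; apply: eq_bigr => l _.
  by rewrite -scalemxAr scalerA !mxE; congr (_ *: _); ring.
have := isO_homog hom (F3 _) (delta_mx i 0).
rewrite /F mul_delta_mx (bigD1 j) //= (bigD1 i) //=.
rewrite big1 ?addr0 => [|l /negPf li]; last by rewrite !mxE li mulr0 scale0r.
rewrite big1 ?addr0 => [|k /negPf kj]; last first.
  by rewrite big1 // => l _; rewrite !mxE kj mul0r scale0r.
by rewrite !mxE !eqxx mulr1 scale1r.
Qed.

Definition bil n m (c : 'I_n -> 'I_n -> 'cV[R]_m) (x y : 'cV[R]_n) : 'cV[R]_m :=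
  \sum_i \sum_j (x i 0 * y j 0) *: c i j.

Lemma sum_delta n (A : 'I_n -> R) k : \sum_j A j * (j == k)%:R = A k.
Proof.
rewrite (bigD1 k) //= eqxx mulr1 big1 ?addr0 // => j /negPf ->.
by rewrite mulr0.
Qed.

Lemma derive_bil n m (c : 'I_n -> 'I_n -> 'cV[R]_m) (y : 'cV[R]_n) :
  differentiable (fun x => bil c x x) y /\
  forall k, 'D_(delta_mx k 0) (fun x => bil c x x) y = \sum_l y l 0 *: (c k l + c l k).
Proof.
have V : vCr 1 (fun x => bil c x x) y.
  do 2!apply: vCr_sum => ? _; apply: vCrZ; last exact: vCr_cst.
  by apply: CrM; exact: Cr_coord.
split; first exact: vCr_diff V.
move=> k.
have dc i : is_derive y (delta_mx k 0) (fun x : 'cV[R]_n => x i 0 : R) ((i == k)%:R).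
  apply: DeriveDef; first by apply: diff_derivable; exact: differentiable_coord.
  by rewrite -(@derive_coord _ _ _ id) // derive_id mxE eqxx andbT.
apply/colP => q; rewrite derive_coord; last exact: vCr_diff V.
have -> : (fun x => bil c x x q 0) = \sum_i \sum_j (fun x : 'cV[R]_n => x i 0 * x j 0 * c i j q 0).
  apply/funext => x; rewrite summxE fct_sumE; apply: eq_bigr => i _.
  by rewrite summxE fct_sumE; apply: eq_bigr => j _; rewrite mxE.
rewrite derive_val.
transitivity (\sum_i \sum_j (y i 0 * c i j q 0) * (j == k)%:R
              + \sum_i \sum_j (y j 0 * c i j q 0) * (i == k)%:R).
  rewrite -big_split; apply: eq_bigr => i _; rewrite -big_split; apply: eq_bigr => j _.
  by rewrite scaler0 add0r /GRing.scale /=; ring.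
rewrite [X in _ + X]exchange_big -big_split summxE; apply: eq_bigr => l _ /=.
by rewrite !sum_delta !mxE; ring.
Qed.

(** The gradient of the remainder, taken with symmetrized coefficients, differs by the antisymmetric
    part of [c] from a term that [taylor1], applied to the partial derivatives of [f], shows to be
    of order two. [antisym_derivative] makes that part vanish, which is the symmetry, and the same
    estimate then yields the Lipschitz bound. *)
Theorem taylor2 n m (f : 'cV[R]_n -> 'cV[R]_m) (c := fun i j => 'D_(delta_mx i 0) ('D_(delta_mx j 0) f) 0) :
  vCr 3 f 0 ->
  (forall i j, c i j = c j i) /\
  isLip 2 (fun x => f x - f 0 - 'D_x f 0 - bil (fun i j => 2^-1 *: c i j) x x).
Proof.
move=> Hf; have df := vCr_diff_near Hf; have df0 := nbhs_singleton df.
set r := fun x => _.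
pose J : 'M[R]_(m, n) := \matrix_(i, j) ('D_(delta_mx j 0) f 0) i 0.
have E x : 'D_x f 0 = J *m x.
  rewrite diff_delta //; apply/colP => i; rewrite summxE mxE.
  by apply: eq_bigr => j _; rewrite !mxE mulrC.
have rE : r = fun x => f x - f 0 - J *m x - bil (fun i j => 2^-1 *: c i j) x x.
  by apply/funext => x; rewrite /r E.
have dr1 y : differentiable f y -> differentiable (fun x => f x - f 0 - J *m x) y /\
    forall v, 'D_v (fun x => f x - f 0 - J *m x) y = 'D_v f y - J *m v.
  move=> dfy; have [dJ DJ] := derive_mulmx J y.
  have d0 : differentiable (fun x => f x - f 0) y.
    by apply: differentiableB => //; exact: differentiable_cst.
  split; first exact: differentiableB.
  move=> v; rewrite deriveB ?DJ; try exact: diff_derivable.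
  by rewrite deriveB ?derive_cst ?subr0 //; exact: diff_derivable.
have dr y : differentiable f y -> differentiable r y /\
    forall k, 'D_(delta_mx k 0) r y = 'D_(delta_mx k 0) f y - 'D_(delta_mx k 0) f 0
                - \sum_l y l 0 *: (2^-1 *: c k l + 2^-1 *: c l k).
  move=> dfy; have [d1 D1] := dr1 y dfy.
  have [d2 D2] := derive_bil (fun i j => 2^-1 *: c i j) y.
  rewrite rE; split; first exact: differentiableB.
  move=> k; rewrite deriveB; try exact: diff_derivable.
  by rewrite D1 D2 E.
have drn : \forall y \near (0 : 'cV[R]_n), differentiable r y.
  by apply: filterS df => y /dr[].
have T1 k : isO 2 (fun x => 'D_(delta_mx k 0) f x - 'D_(delta_mx k 0) f 0 - \sum_l x l 0 *: c l k).
  have Hk : vCr 2 ('D_(delta_mx k 0) f) 0 by exact: vCr_derive.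
  have := isLip_isO _ (taylor1 Hk); rewrite subrr sub0r derive0 oppr0 => /(_ erefl).
  by apply: isO_ext => x; rewrite (diff_delta x (vCr_diff Hk)).
have sym i j : c i j = c j i.
  apply/subr0_eq; apply: (@scalerI _ _ 2^-1); rewrite ?invr_eq0 ?pnatr_eq0 // scaler0.
  apply: (@antisym_derivative _ _ r (fun i j => 2^-1 *: (c i j - c j i))) => //.
  - by rewrite /r subrr derive0 !sub0r oppr0 add0r /bil big1 ?oppr0 // => a _; rewrite big1 // => b _; rewrite !mxE mul0r scale0r.
  - by move=> a b; rewrite -scalerN opprB.
  - move=> k; apply: isO_near_eq (T1 k); apply: filterS df => y /dr[_ ->].
    rewrite -[in RHS]addrA -opprD -big_split /=; congr (_ - _); apply: eq_bigr => l _.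
    rewrite -scalerDr; congr (_ *: _).
    by move: (c k l) (c l k) => u v; apply/colP => q; rewrite !mxE; field.
split=> //; apply: isLip_derive => // k.
apply: isO_near_eq (T1 k); apply: filterS df => y /dr[_ ->].
congr (_ - _); apply: eq_bigr => l _; congr (_ *: _).
by rewrite (sym k l); move: (c l k) => u; apply/colP => q; rewrite !mxE; field.
Qed.

End Taylor.

(** * Convergence of renormalized iterates *)

Section Linearization.
Context {R : realType}.

(* A rate dominating [k * (5 / 4 / k) ^ 2] for all [k >= 2]: near [0], a germ with linear part
   [1 / k] contracts by [5 / 4 / k]. *)
Definition theta : R := 25 / 32.

Lemma theta_gt0 : 0 < theta. Proof. by rewrite /theta; lra. Qed.
Lemma theta_lt1 : theta < 1. Proof. by rewrite /theta; lra. Qed.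

Lemma theta_small (K e : R) : 0 < e -> exists m, K * theta ^+ m <= e.
Proof.
move=> e0; have [K0|K0] := leP K 0.
  by exists 0%N; rewrite expr0 mulr1; apply: le_trans K0 (ltW e0).
have : geometric K theta @ \oo --> (0 : R).
  by apply: cvg_geometric; rewrite gtr0_norm ?theta_gt0 ?theta_lt1.
move=> /cvgrPdist_le /(_ _ e0) [N _ /(_ N (leqnn N))] /=.
rewrite sub0r normrN => H; exists N; exact: le_trans (ler_norm _) H.
Qed.

Lemma theta_limit (a b K : R) : (forall m, a <= b + K * theta ^+ m) -> a <= b.
Proof.
move=> H; apply/ler_addgt0Pr => e e0; have [m Hm] := theta_small K e0.
by apply: le_trans (H m) _; rewrite lerD2l.
Qed.

Lemma geometric_limit (u : nat -> R) (K : R) :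
  (forall m, `|u m.+1 - u m| <= K * theta ^+ m) ->
  exists l, forall m, `|u m - l| <= K / (1 - theta) * theta ^+ m.
Proof.
move=> H.
have t1 := theta_lt1; have t0 := theta_gt0.
have K0 : 0 <= K by have := H 0%N; rewrite expr0 mulr1; exact: le_trans.
(* [1 - theta ^+ p] is the partial geometric sum up to a factor; keeping it makes the induction on
   [p] close exactly. *)
have tail m p : `|u (m + p)%N - u m| <= K / (1 - theta) * theta ^+ m * (1 - theta ^+ p).
  elim: p => [|p IH]; first by rewrite addn0 subrr normr0 expr0 subrr mulr0.
  rewrite addnS -(subrKA (u (m + p)%N)) addrC.
  apply: le_trans (ler_normD _ _) _; rewrite addrC.
  apply: le_trans (lerD (H _) IH) _; rewrite exprD exprS le_eqVlt; apply/orP; left.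
  apply/eqP; field; lra.
have tail' m p : `|u (m + p)%N - u m| <= K / (1 - theta) * theta ^+ m.
  apply: le_trans (tail m p) _; rewrite -[leRHS]mulr1; apply: ler_wpM2l.
    by rewrite mulr_ge0 ?exprn_ge0 ?divr_ge0 //; lra.
  by rewrite gerBl exprn_ge0 // ltW.
have cu : cvgn u.
  apply/cauchy_cvgP/cauchy_ballP => e e0.
  have e2 : 0 < e / 2 by rewrite divr_gt0.
  have [m Hm] := theta_small (2 * (K / (1 - theta))) e2.
  exists ([set u i | i in [set i | (m <= i)%N]], [set u i | i in [set i | (m <= i)%N]]).
    by split => /=; exists m => // i mi; exists i.
  move=> [_ _] /= [[i /= mi <-] [j /= mj <-]]; rewrite -ball_normE /=.
  rewrite -(subrKA (u m)); apply: le_lt_trans (ler_normD _ _) _.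
  rewrite -(subnKC mi) -(subnKC mj) [X in _ + X]distrC.
  apply: le_lt_trans (lerD (tail' _ _) (tail' _ _)) _; move: Hm; lra.
exists (limn u) => m; apply/ler_addgt0Pr => e e0.
have [N _ /(_ (m + N)%N (leq_addl _ _)) /= HN] := (cvgrPdist_le _ _).1 cu _ e0.
rewrite -(subrKA (u (m + N)%N)); apply: le_trans (ler_normD _ _) _.
by apply: lerD; rewrite distrC.
Qed.

Variable k : nat.
Hypothesis k2 : (2 <= k)%N.
Local Notation K := (k%:R : R).

Let K2 : 2 <= K. Proof. by rewrite ler_nat. Qed.

(** The rate is part of the definition: uniqueness of [h] and every estimate passed to the limit
    then follow from [theta_limit]. *)
Definition renorm_lim n (A : 'cV[R]_n -> 'cV[R]_n) (x h : 'cV[R]_n) :=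
  exists C, forall m, `|K ^+ m *: iter m A x - h| <= C * theta ^+ m.

Lemma renorm_lim_uniq n (A : 'cV[R]_n -> 'cV[R]_n) x h h' :
  renorm_lim A x h -> renorm_lim A x h' -> h = h'.
Proof.
move=> [C HC] [D HD]; apply/subr0_eq/eqP; rewrite -normr_le0.
apply: (@theta_limit _ _ (C + D)) => m; rewrite add0r mulrDl.
rewrite -(subrKA (K ^+ m *: iter m A x)); apply: le_trans (ler_normD _ _) _.
by apply: lerD; rewrite // distrC.
Qed.

Lemma vec_geometric_limit n (u : nat -> 'cV[R]_n) (C : R) :
  (forall m, `|u m.+1 - u m| <= C * theta ^+ m) ->
  exists l, forall m, `|u m - l| <= C / (1 - theta) * theta ^+ m.
Proof.
move=> H.
have C0 : 0 <= C by have := H 0%N; rewrite expr0 mulr1; exact: le_trans.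
have /choice [l Hl] : forall i : 'I_n, exists l, forall m, `|u m i 0 - l| <= C / (1 - theta) * theta ^+ m.
  move=> i; apply: geometric_limit => m; apply: le_trans (H m).
  by have := norm_coord (u m.+1 - u m) i; rewrite !mxE.
exists (\col_i l i) => m; apply: norm_le_coord => [|i]; last by rewrite !mxE.
have := theta_lt1; have := theta_gt0 => t0 t1.
by rewrite mulr_ge0 ?exprn_ge0 ?divr_ge0 //; lra.
Qed.

Definition smooth_near n (A : 'cV[R]_n -> 'cV[R]_n) :=
  \forall y \near (0 : 'cV[R]_n), forall r, vCr r A y.

Definition contracting_germ n (A : 'cV[R]_n -> 'cV[R]_n) :=
  [/\ smooth_near A, A 0 = 0 & isO 2 (fun x => A x - K^-1 *: x)].

Lemma basin n (A : 'cV[R]_n -> 'cV[R]_n) : contracting_germ A ->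
  exists2 rho, 0 < rho & exists2 C, 0 <= C & forall x, `|x| < rho ->
    [/\ forall r, vCr r A x, `|A x| <= (5 / 4 / K) * `|x|,
        `|A x| < rho & `|A x - K^-1 *: x| <= C * `|x| ^+ 2].
Proof.
move=> [sA A0 [C C0 HC]].
have [d d0 Hd] := near0_ex (filterI sA HC).
have Kp : 0 < K by apply: lt_le_trans K2.
(* The second radius gives [C |x| <= 1 / (4 K)], so the quadratic error worsens the rate [1 / K] to
   at most [5 / 4 / K]. *)
pose rho := Num.min d (1 / (4 * K * (C + 1))).
have C1 : 0 < C + 1 by rewrite ltr_wpDl.
have KC : 0 < 4 * K * (C + 1) by rewrite !mulr_gt0.
have rho0 : 0 < rho by rewrite lt_min d0 divr_gt0.
exists rho => //; exists C => // x xr.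
have [sx Hx] : (forall r, vCr r A x) /\ `|A x - K^-1 *: x| <= C * `|x| ^+ 2.
  by apply: Hd; apply: lt_le_trans xr _; rewrite ge_min lexx.
have Ax : `|A x| <= (5 / 4 / K) * `|x|.
  rewrite -[A x](subrK (K^-1 *: x)); apply: le_trans (ler_normD _ _) _.
  rewrite normrZ gtr0_norm ?invr_gt0 //.
  have : C * `|x| ^+ 2 <= (1 / 4 / K) * `|x|.
    rewrite expr2 mulrA; apply: ler_wpM2r => //.
    apply: (@le_trans _ _ ((C + 1) * (1 / (4 * K * (C + 1))))).
      apply: ler_pM => //; first by rewrite lerDl.
      by apply: ltW; apply: lt_le_trans xr _; rewrite ge_min lexx orbT.
    by rewrite le_eqVlt; apply/orP; left; apply/eqP; field; rewrite !gt_eqF.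
  have -> : 5 / 4 / K * `|x| = (1 / 4 / K) * `|x| + K^-1 * `|x| by field; rewrite gt_eqF.
  by move=> H; apply: lerD => //; apply: le_trans Hx H.
split=> //; apply: le_lt_trans Ax _.
apply: le_lt_trans xr; rewrite -[leRHS]mul1r; apply: ler_wpM2r => //.
rewrite ler_pdivrMr // mul1r; have := K2; lra.
Qed.

Lemma basin_iter n (A : 'cV[R]_n -> 'cV[R]_n) rho : 
  (forall x, `|x| < rho -> `|A x| <= (5 / 4 / K) * `|x| /\ `|A x| < rho) ->
  forall x m, `|x| < rho -> `|iter m A x| <= (5 / 4 / K) ^+ m * `|x| /\ `|iter m A x| < rho.
Proof.
move=> H x m xr; elim: m => [|m [IH IHr]]; first by rewrite expr0 mul1r.
have [H1 H2] := H _ IHr; split => //=; apply: le_trans H1 _.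
rewrite exprS -[X in _ <= X]mulrA; exact: ler_wpM2l.
Qed.

Lemma rate_le : K * (5 / 4 / K) ^+ 2 <= theta.
Proof.
have Kp : 0 < K by apply: lt_le_trans K2.
have -> : K * (5 / 4 / K) ^+ 2 = 25 / 16 / K by field; rewrite gt_eqF.
rewrite ler_pdivrMr // /theta; have := K2; lra.
Qed.

(** With [y = A ^ m x], consecutive terms differ by [K ^ (m + 1) (A y - y / K)], bounded by
    [K ^ (m + 1) C |y| ^ 2]: the square of the contraction rate beats the expansion [K]. The bound
    [2 |x|], uniform in [m], controls second derivatives when it is applied to an iterated tangent
    map. *)
Lemma renorm_lim_ex n (A : 'cV[R]_n -> 'cV[R]_n) : contracting_germ A ->
  exists2 rho, 0 < rho & exists2 C, 0 <= C & forall x, `|x| < rho ->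
    [/\ exists2 h, renorm_lim A x h & `|h - x| <= C * `|x| ^+ 2
      & forall m, `|K ^+ m *: iter m A x| <= 2 * `|x|].
Proof.
move=> gA; have [rho r0 [C C0 H]] := basin gA.
have t1 := theta_lt1; have t0 := theta_gt0.
have Kp : 0 < K by apply: lt_le_trans K2.
pose D := K * C / (1 - theta).
have D0 : 0 <= D by rewrite divr_ge0 ?mulr_ge0 // ?ltW // subr_gt0.
have D1 : 0 < D + 1 by rewrite ltr_wpDl.
(* The second radius makes the total displacement [D |x| ^ 2] at most [|x| / 2], whence the bound by
   [2 |x|]. *)
exists (Num.min rho (1 / (2 * (D + 1)))); first by rewrite lt_min r0 divr_gt0 // mulr_gt0.
exists D => // x; rewrite lt_min => /andP[xr xD].
have it m := @basin_iter _ A rho (fun x xr => let: And4 _ h1 h2 _ := H x xr in conj h1 h2) x m xr.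
have step m : `|K ^+ m.+1 *: iter m.+1 A x - K ^+ m *: iter m A x| <= (K * C * `|x| ^+ 2) * theta ^+ m.
  have [b1 b2] := it m; have [_ _ _ Hm] := H _ b2.
  have -> : K ^+ m.+1 *: iter m.+1 A x - K ^+ m *: iter m A x
     = K ^+ m.+1 *: (A (iter m A x) - K^-1 *: iter m A x).
    by rewrite scalerBr scalerA exprSr mulfK ?gt_eqF.
  rewrite normrZ gtr0_norm ?exprn_gt0 //.
  apply: (@le_trans _ _ (K ^+ m.+1 * (C * ((5 / 4 / K) ^+ m * `|x|) ^+ 2))).
    apply: ler_wpM2l; first by rewrite exprn_ge0 // ltW.
    apply: le_trans Hm _; apply: ler_wpM2l => //.
    by apply: lerXn2r; rewrite ?nnegrE // mulr_ge0 // exprn_ge0 // !divr_ge0 // ltW.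
  have -> : K ^+ m.+1 * (C * ((5 / 4 / K) ^+ m * `|x|) ^+ 2)
     = (K * C * `|x| ^+ 2) * (K * (5 / 4 / K) ^+ 2) ^+ m.
    by rewrite exprS [in RHS]exprMn exprMn -!exprM [(2 * m)%N]mulnC; ring.
  apply: ler_wpM2l; first by rewrite !mulr_ge0 // ltW.
  by apply: lerXn2r; rewrite ?nnegrE ?rate_le // ?mulr_ge0 ?exprn_ge0 ?divr_ge0 // ltW.
have [h Hh] := vec_geometric_limit step.
have E : K * C * `|x| ^+ 2 / (1 - theta) = D * `|x| ^+ 2 by rewrite /D; ring.
rewrite E in Hh.
have h1 : `|h - x| <= D * `|x| ^+ 2.
  by have := Hh 0%N; rewrite !expr0 mulr1 scale1r distrC.
split; first by exists h => //; exists (D * `|x| ^+ 2).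
move=> m.
have {step} part p : `|K ^+ p *: iter p A x - x| <= D * `|x| ^+ 2 * (1 - theta ^+ p).
  elim: p => [|p IH]; first by rewrite !expr0 scale1r subrr normr0 subrr mulr0.
  rewrite -(subrKA (K ^+ p *: iter p A x)); apply: le_trans (ler_normD _ _) _.
  apply: le_trans (lerD (step p) IH) _; rewrite /D [theta ^+ p.+1]exprS le_eqVlt; apply/orP; left.
  by apply/eqP; field; rewrite subr_eq0 gt_eqF.
rewrite -[_ *: _](subrK x); apply: le_trans (ler_normD _ _) _.
have : `|K ^+ m *: iter m A x - x| <= `|x|.
  apply: le_trans (part m) _; apply: (@le_trans _ _ (D * `|x| ^+ 2)).
    rewrite -[leRHS]mulr1; apply: ler_wpM2l; first by rewrite mulr_ge0 // exprn_ge0.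
    by rewrite gerBl exprn_ge0 // ltW.
  rewrite expr2 mulrA -[leRHS]mul1r; apply: ler_wpM2r => //.
  apply: (@le_trans _ _ ((D + 1) * (1 / (2 * (D + 1))))).
    by apply: ler_pM => //; [rewrite lerDl|exact: ltW].
  have -> : (D + 1) * (1 / (2 * (D + 1))) = 1 / 2 by field; rewrite gt_eqF.
  lra.
lra.
Qed.

End Linearization.

(** * Tangent maps of contracting germs *)

Section TangentMap.
Context {R : realType}.

Lemma norm_usubmx n (z : 'cV[R]_(n + n)) : `|usubmx z| <= `|z|.
Proof. by apply: norm_le_coord => // i; rewrite mxE norm_coord. Qed.

Lemma norm_dsubmx n (z : 'cV[R]_(n + n)) : `|dsubmx z| <= `|z|.
Proof. by apply: norm_le_coord => // i; rewrite mxE norm_coord. Qed.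

Lemma norm_col_mx n (x v : 'cV[R]_n) c : `|x| <= c -> `|v| <= c -> `|col_mx x v| <= c.
Proof.
move=> xc vc; apply: norm_le_coord => [|i]; first exact: le_trans xc.
have [j ij|j ij] := fintype.splitP i.
  have -> : i = lshift n j by exact: val_inj.
  by rewrite col_mxEu; apply: le_trans xc; exact: norm_coord.
have -> : i = rshift n j by exact: val_inj.
by rewrite col_mxEd; apply: le_trans vc; exact: norm_coord.
Qed.

Lemma near_norm_lt n (x : 'cV[R]_n) r : `|x| < r -> \forall y \near x, `|y| < r.
Proof.
move=> xr; apply/nbhs_ballP; exists (r - `|x|); first by rewrite /= subr_gt0.
move=> y; rewrite -ball_normE /= => xy.
rewrite -(subrK x y); apply: le_lt_trans (ler_normD _ _) _.
by rewrite -ltrBrDr distrC.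
Qed.

Lemma vCr_usubmx r n (z : 'cV[R]_(n + n)) : vCr r usubmx z.
Proof.
by move=> i; apply: Cr_near_eq (Cr_coord r (lshift n i) z); apply: near_all => y; rewrite mxE.
Qed.

Lemma vCr_dsubmx r n (z : 'cV[R]_(n + n)) : vCr r dsubmx z.
Proof.
by move=> i; apply: Cr_near_eq (Cr_coord r (rshift n i) z); apply: near_all => y; rewrite mxE.
Qed.

Lemma vCr_col_mx r n m (f g : 'cV[R]_m -> 'cV[R]_n) x : vCr r f x -> vCr r g x ->
  vCr r (fun y => col_mx (f y) (g y)) x.
Proof.
move=> Hf Hg i.
have [j ij|j ij] := fintype.splitP i.
  have -> : i = lshift n j by exact: val_inj.
  by apply: Cr_near_eq (Hf j); apply: near_all => y; rewrite col_mxEu.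
have -> : i = rshift n j by exact: val_inj.
by apply: Cr_near_eq (Hg j); apply: near_all => y; rewrite col_mxEd.
Qed.

Lemma vCr_differentiable_derive n m (f : 'cV[R]_n -> 'cV[R]_m) x v : vCr 2 f x ->
  differentiable ('D_v f) x.
Proof. by move=> H; apply: (@vCr_diff _ 0); exact: vCr_derive. Qed.

Lemma derive_scale n m (f : 'cV[R]_n -> 'cV[R]_m) x v c : differentiable f x ->
  'D_(c *: v) f x = c *: 'D_v f x.
Proof. by move=> df; rewrite !deriveE // linearZ. Qed.

(** Point and tangent vector are stacked in one column, so that the tangent map is again a self-map
    of a column space, of dimension [n + n], and results proved in all dimensions apply to it. *)
Definition Tmap n (A : 'cV[R]_n -> 'cV[R]_n) (z : 'cV[R]_(n + n)) : 'cV[R]_(n + n) :=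
  col_mx (A (usubmx z)) ('D_(dsubmx z) A (usubmx z)).

Lemma near_usubmx n (P : set 'cV[R]_n) (z : 'cV[R]_(n + n)) :
  (\forall x \near usubmx z, P x) -> \forall y \near z, P (usubmx y).
Proof.
move=> H; have /vCr_diff /differentiable_continuous cu := @vCr_usubmx 1 n z.
exact: cu.
Qed.

Lemma vCr_Tmap r n (A : 'cV[R]_n -> 'cV[R]_n) z : vCr r.+1 A (usubmx z) -> vCr r (Tmap A) z.
Proof.
move=> HA; apply: vCr_col_mx.
  by apply: vCr_comp; [exact: vCr_usubmx|exact: (vCr_le (leqnSn _) HA)].
have : vCr r (fun z => \sum_i (dsubmx z) i 0 *: ('D_(delta_mx i 0) A \o usubmx) z) z.
  apply: vCr_sum => i _; apply: vCrZ; first exact: vCr_dsubmx.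
  by apply: vCr_comp; [exact: vCr_usubmx|exact: vCr_derive].
apply: vCr_near_eq; have := near_usubmx (vCr_diff_near HA).
by apply: filterS => y dy; rewrite [RHS]diff_delta.
Qed.

Lemma isO2_derive n (A : 'cV[R]_n -> 'cV[R]_n) c : A 0 = 0 ->
  isO 2 (fun x => A x - c *: x) -> forall v, 'D_v A 0 = c *: v.
Proof.
move=> A0 [C C0 HC].
suff [_ H] : differentiable A 0 /\ forall v, 'D_v A 0 = (c *: v).
  by [].
apply: (@differentiable_eps _ _ _ _ ( *:%R c : {linear _ -> _})) => e e0.
have d0 : 0 < e / (C + 1) by rewrite divr_gt0 // ltr_wpDl.
apply: filterS2 HC (near0_lt _ d0) => h Hh hd.
rewrite addr0 A0 subr0; apply: le_trans Hh _; rewrite expr2 mulrA.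
apply: ler_wpM2r => //; apply: (@le_trans _ _ ((C + 1) * `|h|)).
  by apply: ler_wpM2r => //; rewrite lerDl.
by rewrite -ler_pdivlMl ?ltr_wpDl // mulrC ltW.
Qed.

Variable k : nat.
Hypothesis k2 : (2 <= k)%N.
Local Notation K := (k%:R : R).

(** The second block minus its linear part is the sum of the [v i] times ['D_i A x - e_i / k]:
    products of two factors of order one, so the linear part is again [1 / k]. *)
Lemma contracting_Tmap n (A : 'cV[R]_n -> 'cV[R]_n) :
  contracting_germ k A -> contracting_germ k (Tmap A).
Proof.
move=> [sA A0 A2]; have sA0 := nbhs_singleton sA.
have u0 : usubmx (0 : 'cV[R]_(n + n)) = 0 by apply/colP => i; rewrite !mxE.
have d0 : dsubmx (0 : 'cV[R]_(n + n)) = 0 by apply/colP => i; rewrite !mxE.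
have Lu : isO 1 (@usubmx R n n 1).
  by exists 1 => //; apply: near_all => y; rewrite mul1r expr1 norm_usubmx.
split.
- have : \forall y \near (0 : 'cV[R]_(n + n)), forall r, vCr r A (usubmx y).
    by apply: (@near_usubmx _ (fun x => forall r, vCr r A x)); rewrite u0.
  by apply: filterS => y Hy r; apply: vCr_Tmap.
- rewrite /Tmap u0 d0 A0 derive0; by rewrite col_mx0.
have O1 i : isO 1 (fun x => 'D_(delta_mx i 0) A x - K^-1 *: delta_mx i 0).
  apply: differentiable_isO; last by rewrite (isO2_derive A0 A2) subrr.
  apply: differentiableB; last exact: differentiable_cst.
  exact: vCr_differentiable_derive (sA0 2%N).
have O2 : isO 2 (fun z : 'cV[R]_(n + n) => \sum_i (dsubmx z) i 0 *:
      ('D_(delta_mx i 0) A (usubmx z) - K^-1 *: delta_mx i 0)).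
  apply: isO_sum => i; apply: (@isOZ _ 1 1).
    exists 1 => //; apply: near_all => y; rewrite mul1r expr1.
    exact: le_trans (norm_coord _ _) (norm_dsubmx _).
  exact: (isO_comp (O1 i) Lu).
have := isO_comp A2 Lu => -[C C0 HC]; have [D D0 HD] := O2.
exists (C + D); first exact: addr_ge0.
have dA : \forall y \near (0 : 'cV[R]_(n + n)), differentiable A (usubmx y).
  apply: (@near_usubmx _ (fun x => differentiable A x)); rewrite u0; by apply: filterS sA => y /(_ 1%N) /vCr_diff.
apply: filterS2 (filterI HC HD) dA => z [/= Hz1 Hz2] dz.
have -> : Tmap A z - K^-1 *: z = col_mx (A (usubmx z) - K^-1 *: usubmx z)
   (\sum_i (dsubmx z) i 0 *: ('D_(delta_mx i 0) A (usubmx z) - K^-1 *: delta_mx i 0)).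
  rewrite -[in LHS](vsubmxK z) /Tmap col_mxKu col_mxKd scale_col_mx opp_col_mx add_col_mx.
  congr (col_mx _ _); rewrite diff_delta // [in X in _ - X](cV_delta (dsubmx z)).
  rewrite scaler_sumr -sumrB; apply: eq_bigr => i _.
  by rewrite scalerBr !scalerA mulrC.
apply: norm_col_mx; rewrite mulrDl.
  by apply: le_trans Hz1 _; rewrite lerDl mulr_ge0 // exprn_ge0.
by apply: le_trans Hz2 _; rewrite lerDr mulr_ge0 // exprn_ge0.
Qed.

Lemma iter_Tmap n (A : 'cV[R]_n -> 'cV[R]_n) m z :
  (forall j, (j <= m)%N -> forall r, vCr r A (iter j A (usubmx z))) ->
  iter m (Tmap A) z = Tmap (iter m A) z.
Proof.
elim: m => [|m IH] H /=.
  by rewrite /Tmap /= derive_id vsubmxK.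
rewrite IH => [|j jm]; last by apply: H; exact: leqW.
rewrite /Tmap col_mxKu col_mxKd; congr (col_mx _ _).
rewrite -derive_comp //; apply: (@vCr_diff _ 0).
  by apply: vCr_iter => j jm; apply: H; exact: leqW (ltnW jm).
exact: H.
Qed.

(** A tangent vector [(u, 0)] moves the base point and keeps [v] fixed, so the difference quotients
    on both sides coincide. *)
Lemma derive_Tmap n (g : 'cV[R]_n -> 'cV[R]_n) x u v : vCr 2 g x ->
  dsubmx ('D_(col_mx u 0) (Tmap g) (col_mx x v)) = 'D_u ('D_v g) x.
Proof.
move=> Hg; have HT : vCr 1 (Tmap g) (col_mx x v) by apply: vCr_Tmap; rewrite col_mxKu.
apply/colP => i; rewrite mxE derive_coord; last exact: vCr_diff HT.
rewrite derive_coord; last exact: vCr_differentiable_derive.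
apply: (congr1 (fun F : R -> R => lim (F @ 0^'))); apply/funext => h /=.
by rewrite /Tmap scale_col_mx add_col_mx scaler0 add0r !col_mxKu !col_mxKd !col_mxEd.
Qed.

(** Mean value theorem used twice, for the function and then for its derivative along the segment;
    the factor [1 / 2] of Taylor's formula is given away. *)
Lemma taylor_second_bound n (g : 'cV[R]_n -> 'cV[R]_n) x h M : 0 <= M ->
  (forall t, 0 <= t <= 1 -> vCr 2 g (x + t *: h) /\ `|'D_h ('D_h g) (x + t *: h)| <= M) ->
  `|g (x + h) - g x - 'D_h g x| <= M.
Proof.
move=> M0 H; apply: norm_le_coord => // i.
have Hx : vCr 2 g x by have [] := H 0; rewrite ?lexx ?ler01 // scale0r addr0.
have [t /andP[t0 t1] E] : exists2 t, 0 <= t <= 1 & (g (x + h)) i 0 - (g x) i 0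
     = 'D_h (fun y => g y i 0) (x + t *: h).
  apply: (@MVT_cV _ _ (fun y => g y i 0)) => t t01.
  by apply/differentiable_vec: i; have [/vCr_diff] := H _ t01.
have [s /andP[s0 s1] E2] : exists2 s, 0 <= s <= 1 & ('D_h g (x + t *: h)) i 0 - ('D_h g x) i 0
     = 'D_(t *: h) (fun y => ('D_h g y) i 0) (x + s *: (t *: h)).
  apply: (@MVT_cV _ _ (fun y => ('D_h g y) i 0)) => s /andP[s0 s1].
  apply: ((differentiable_vec _ _).1 _ i).
  have [|Hs _] := H (s * t); first by rewrite mulr_ge0 // mulr_ile1.
  by rewrite scalerA; exact: vCr_differentiable_derive.
have [Ht _] := H t (introT andP (conj t0 t1)).
rewrite !mxE E -derive_coord; last exact: vCr_diff Ht.
rewrite E2 scalerA.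
have [|Hs HM] := H (s * t); first by rewrite mulr_ge0 // mulr_ile1.
have dD : differentiable ('D_h g) (x + (s * t) *: h).
  exact: vCr_differentiable_derive.
rewrite -derive_coord // derive_scale // mxE normrM ger0_norm //.
apply: (@le_trans _ _ (1 * M)); last by rewrite mul1r.
apply: ler_pM => //; apply: le_trans HM; exact: norm_coord.
Qed.

(** The second derivative in the directions [u] and [v] is the last block of the renormalized
    iterate of the double tangent map at [((x, v), (u, 0))], which [renorm_lim_ex] bounds uniformly
    in [m]. *)
Lemma renorm_second_bound n (A : 'cV[R]_n -> 'cV[R]_n) : contracting_germ k A ->
  exists2 rho, 0 < rho & forall x u v m, `|x| < rho -> `|u| < rho -> `|v| < rho ->
    (forall r, vCr r (iter m A) x) /\
    `|'D_u ('D_v (fun y => k%:R ^+ m *: iter m A y)) x| <= 2 * rho.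
Proof.
move=> gA; have gT := contracting_Tmap gA; have gTT := contracting_Tmap gT.
have [r1 r10 [C1 C10 H1]] := basin k2 gA.
have [r2 r20 [C2 C20 H2]] := basin k2 gT.
have [r3 r30 [C3 C30 H3]] := renorm_lim_ex k2 gTT.
pose rho := Num.min r1 (Num.min r2 r3).
exists rho; first by rewrite !lt_min r10 r20 r30.
move=> x u v m xr ur vr.
have it1 y j : `|y| < r1 -> `|iter j A y| < r1.
  by move=> yr; have [] := @basin_iter _ _ _ A r1 (fun x xr => let: And4 _ h1 h2 _ := H1 x xr in conj h1 h2) y j yr.
have it2 y j : `|y| < r2 -> `|iter j (Tmap A) y| < r2.
  by move=> yr; have [] := @basin_iter _ _ _ (Tmap A) r2 (fun x xr => let: And4 _ h1 h2 _ := H2 x xr in conj h1 h2) y j yr.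
have s1 y j r : `|y| < r1 -> vCr r (iter j A) y.
  by move=> yr; apply: vCr_iter => i _; have [] := H1 _ (it1 y i yr).
have xr1 : `|x| < r1 by apply: lt_le_trans xr _; rewrite ge_min lexx.
split; first by move=> r; exact: s1.
pose z := col_mx x v; pose w := col_mx u (0 : 'cV[R]_n).
have rho0 : 0 < rho by apply: le_lt_trans xr.
have nz : `|col_mx z w| < rho.
  pose c := Num.max `|x| (Num.max `|u| `|v|).
  apply: (@le_lt_trans _ _ c); last by rewrite !gt_max xr ur vr.
  by apply: norm_col_mx; apply: norm_col_mx; rewrite ?normr0 // !le_max ?lexx ?orbT // normr_ge0.
have nzr2 : `|z| < r2.
  have := norm_usubmx (col_mx z w); rewrite col_mxKu => /le_lt_trans; apply.
  by apply: lt_le_trans nz _; rewrite !ge_min lexx orbT.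
have E : 'D_u ('D_v (fun y => k%:R ^+ m *: iter m A y)) x
   = dsubmx (dsubmx (k%:R ^+ m *: iter m (Tmap (Tmap A)) (col_mx z w))).
  rewrite iter_Tmap; last first.
    by move=> j _ r; rewrite col_mxKu; have [] := H2 _ (it2 z j nzr2).
  rewrite /Tmap -/(Tmap A) col_mxKu col_mxKd scale_col_mx col_mxKd.
  have -> : 'D_w (iter m (Tmap A)) z = 'D_w (Tmap (iter m A)) z.
    have N : \forall y \near z, `|usubmx y| < r1.
      apply: (@near_usubmx _ (fun y => `|y| < r1)); rewrite col_mxKu.
      exact: near_norm_lt.
    apply: near_eq_derive; apply: filterS N.
    by move=> y yr; apply: iter_Tmap => j _ r; have [] := H1 _ (it1 _ j yr).
  have -> : dsubmx (k%:R ^+ m *: 'D_w (Tmap (iter m A)) z) = k%:R ^+ m *: dsubmx ('D_w (Tmap (iter m A)) z).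
    by apply/colP => i; rewrite !mxE.
  rewrite derive_Tmap; last exact: s1.
  have -> : 'D_u ('D_v (fun y => k%:R ^+ m *: iter m A y)) x
     = 'D_u (fun y => k%:R ^+ m *: 'D_v (iter m A) y) x.
    apply: near_eq_derive; apply: filterS (vCr_diff_near (s1 x m 1%N xr1)) => y dy.
    by rewrite deriveZ //; exact: diff_derivable.
  rewrite deriveZ //; apply: diff_derivable; exact: vCr_differentiable_derive (s1 _ _ _ _).
rewrite E; apply: le_trans (norm_dsubmx _) _; apply: le_trans (norm_dsubmx _) _.
have [|_ H] := H3 (col_mx z w); first by apply: lt_le_trans nz _; rewrite !ge_min lexx !orbT.
apply: le_trans (H m) _; apply: ler_wpM2l => //; exact: ltW.
Qed.

End TangentMap.

(** * Smooth linearization of contracting germs *)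

Section Sternberg.
Context {R : realType}.
Variable k : nat.
Hypothesis k2 : (2 <= k)%N.
Local Notation K := (k%:R : R).

Let K2 : 2 <= K. Proof. by rewrite ler_nat. Qed.
Let K0 : 0 < K. Proof. by apply: lt_le_trans K2. Qed.

(** Defaults to 0 where the renormalized iterates do not converge; [renorm_limitP] gives a ball on
    which they do. *)
Definition renorm_limit n (A : 'cV[R]_n -> 'cV[R]_n) x : 'cV[R]_n :=
  xget 0 [set h | renorm_lim k A x h].

Lemma renorm_limitP n (A : 'cV[R]_n -> 'cV[R]_n) : contracting_germ k A ->
  exists2 rho, 0 < rho & forall x, `|x| < rho -> renorm_lim k A x (renorm_limit A x).
Proof.
move=> gA; have [rho r0 [C C0 H]] := renorm_lim_ex k2 gA.
exists rho => // x /H[[h Hh _] _].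
by rewrite /renorm_limit; apply: (@xgetPex _ 0 [set h | renorm_lim k A x h]); exists h.
Qed.

(* [Tmap A] is again a contracting germ and its limit is the tangent map of that of [A], so the
   differentiability of the limit for all contracting germs gives all the derivatives. *)
Lemma renorm_limit_derive n (A : 'cV[R]_n -> 'cV[R]_n) : contracting_germ k A ->
  exists2 c1, 0 < c1 & forall c, 0 < c -> c <= c1 -> \forall x \near (0 : 'cV[R]_n),
    differentiable (renorm_limit A) x /\
    forall i, 'D_(delta_mx i 0) (renorm_limit A) x
       = c^-1 *: dsubmx (renorm_limit (Tmap A) (col_mx x (c *: delta_mx i 0))).
Proof.
move=> gA; have gT := contracting_Tmap gA.
have [r1 r10 [C1 C10 H1]] := basin k2 gA.
have [r2 r20 H2] := renorm_limitP gA.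
have [r3 r30 H3] := renorm_limitP gT.
have [r4 r40 H4] := renorm_second_bound k2 gA.
pose rho := Num.min (Num.min r1 r2) (Num.min r3 r4).
have rho0 : 0 < rho by rewrite !lt_min r10 r20 r30.
have [rr1 rr2 rr3 rr4] : [/\ rho <= r1, rho <= r2, rho <= r3 & rho <= r4].
  by rewrite /rho; split; rewrite !ge_min lexx ?orbT.
exists (rho / 2); first by rewrite divr_gt0.
move=> c c0 cle; have cr : c < rho by apply: le_lt_trans cle _; lra.
apply: filterS (near0_lt _ c0) => x xc.
have xr : `|x| < rho by apply: lt_trans cr.
pose H := renorm_limit A.
(* The limit for the tangent map is known only near the origin, so the basis vector is scaled by the
   small [c] and the result is scaled back. *)
pose kap i := c^-1 *: dsubmx (renorm_limit (Tmap A) (col_mx x (c *: delta_mx i 0))).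
pose J : 'M[R]_n := \matrix_(a, b) kap b a 0.
have Jh h : J *m h = \sum_i h i 0 *: kap i.
  by apply/colP => a; rewrite summxE !mxE; apply: eq_bigr => b _; rewrite [in RHS]mxE !mxE mulrC.
suff [d D] : differentiable H x /\ forall v, 'D_v H x = J *m v.
  split=> // i; rewrite D Jh (bigD1 i) //= big1 ?addr0.
    by rewrite mxE !eqxx scale1r.
  by move=> j /negPf ji; rewrite mxE ji scale0r.
have it1 y j : `|y| < r1 -> `|iter j A y| < r1.
  by move=> yr; have [] := @basin_iter _ _ _ A r1 (fun x xr => let: And4 _ h1 h2 _ := H1 x xr in conj h1 h2) y j yr.
have s1 y j r : `|y| < r1 -> vCr r (iter j A) y.
  by move=> yr; apply: vCr_iter => i _; have [] := H1 _ (it1 y i yr).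
have kapP i : exists C, forall m, `|K ^+ m *: 'D_(delta_mx i 0) (iter m A) x - kap i| <= C * theta ^+ m.
  have nz : `|col_mx x (c *: delta_mx i 0)| < r3.
    apply: lt_le_trans rr3; apply: le_lt_trans cr; apply: norm_col_mx; first exact: ltW.
    rewrite normrZ gtr0_norm // -[leRHS]mulr1; apply: ler_wpM2l; first exact: ltW.
    exact: norm_delta_le.
  have [C HC] := H3 _ nz; exists (c^-1 * C) => m.
  have := HC m; rewrite iter_Tmap; last first.
    move=> j _ r; rewrite col_mxKu; have [] // := H1 (iter j A x) _.
    by apply: it1; apply: lt_le_trans rr1.
  move=> {}HC; rewrite -mulrA.
  have -> : K ^+ m *: 'D_(delta_mx i 0) (iter m A) x - kap i =
     c^-1 *: dsubmx (K ^+ m *: Tmap (iter m A) (col_mx x (c *: delta_mx i 0))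
              - renorm_limit (Tmap A) (col_mx x (c *: delta_mx i 0))).
    rewrite /Tmap -/(Tmap A) col_mxKu col_mxKd derive_scale; last first.
      by apply: vCr_diff; apply: (s1 x m 1%N); apply: lt_le_trans rr1.
    rewrite /kap; move: ('D_(delta_mx i 0) (iter m A) x) (renorm_limit _ _) => d r.
    rewrite linearB scale_col_mx /= col_mxKd scalerBr !scalerA; congr (_ *: _ - _).
    by field; rewrite gt_eqF.
  rewrite normrZ gtr0_norm ?invr_gt0 //; apply: ler_wpM2l; first by rewrite invr_ge0 ltW.
  exact: le_trans (norm_dsubmx _) _.
have [kc Hk] := choice kapP.
(* The Taylor estimate holds for [f = K ^ m A ^ m] with a constant independent of [m]; replacing [f]
   and its derivative by their limits costs [O(theta ^ m)], which [theta_limit] removes. *)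
have main h : `|h| < c -> `|H (h + x) - H x - J *m h| <= (2 * r4 / c ^+ 2) * `|h| ^+ 2.
  move=> hc.
  have hx : `|h + x| < rho.
    by apply: le_lt_trans (ler_normD _ _) _; lra.
  have [C HC] := H2 _ (lt_le_trans hx rr2).
  have [D HD] := H2 _ (lt_le_trans xr rr2).
  apply: (@theta_limit _ _ _ (C + D + \sum_i `|h i 0| * kc i)) => m.
  pose f y := K ^+ m *: iter m A y.
  have df y : `|y| < rho -> differentiable f y.
    move=> yr; apply: differentiableZ; apply: vCr_diff; apply: (s1 y m 1%N).
    exact: lt_le_trans rr1.
  have Cf y r : `|y| < rho -> vCr r f y.
    move=> yr; apply: vCrZ; first exact: Cr_cst.
    by apply: (s1 y m r); exact: lt_le_trans rr1.
  have E1 : `|f (x + h) - f x - 'D_h f x| <= (2 * r4 / c ^+ 2) * `|h| ^+ 2.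
    apply: taylor_second_bound => [|t /andP[t0 t1]].
      by rewrite mulr_ge0 ?exprn_ge0 ?divr_ge0 // ?mulr_ge0 ?exprn_ge0 ?ltW.
    have yr : `|x + t *: h| < rho.
      apply: le_lt_trans (ler_normD _ _) _; rewrite normrZ ger0_norm //.
      have : t * `|h| <= 1 * `|h| by apply: ler_wpM2r.
      by lra.
    split; first exact: Cf.
    have [->|h0] := eqVneq h 0.
      by rewrite derive0 normr0 mulr_ge0 ?exprn_ge0 ?divr_ge0 // ?mulr_ge0 ?exprn_ge0 ?ltW.
    have nh : 0 < `|h| by rewrite normr_gt0.
    (* The uniform bound on second derivatives is for directions of norm below a fixed radius. Here
       [h = s u] with [u] of norm [c], and [s ^ 2] supplies the factor [|h| ^ 2]. *)
    pose s := `|h| / c; have s0 : 0 < s by rewrite divr_gt0.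
    pose u := s^-1 *: h.
    have hE : h = s *: u by rewrite scalerA mulfV ?scale1r // gt_eqF.
    have uc : `|u| = c.
      by rewrite normrZ gtr0_norm ?invr_gt0 // invfM invrK mulrAC mulVf ?mul1r // gt_eqF.
    clearbody u; set y := x + t *: h in yr *.
    have -> : 'D_h ('D_h f) y = s ^+ 2 *: 'D_u ('D_u f) y.
      have dD : differentiable ('D_u f) y.
        by apply: vCr_differentiable_derive; exact: Cf.
      rewrite hE derive_scale; last first.
        by apply: vCr_differentiable_derive; exact: Cf.
      rewrite expr2 -scalerA; congr (_ *: _); rewrite -deriveZ; last exact: diff_derivable.
      apply: near_eq_derive.
      apply: filterS (vCr_diff_near (Cf _ 1%N yr)) => z dz.
      by rewrite derive_scale.
    have [_ B] := H4 y u u m (lt_le_trans yr rr4)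
         ltac:(rewrite uc; exact: lt_le_trans rr4) ltac:(rewrite uc; exact: lt_le_trans rr4).
    rewrite normrZ ger0_norm ?exprn_ge0 ?(ltW s0) //.
    apply: le_trans (ler_wpM2l _ B) _; first by rewrite exprn_ge0 // ltW.
    by rewrite /s expr_div_n le_eqVlt; apply/orP; left; apply/eqP; field; rewrite gt_eqF.
  have E2 : `|'D_h f x - J *m h| <= (\sum_i `|h i 0| * kc i) * theta ^+ m.
    rewrite (diff_delta h (df _ xr)) Jh -sumrB mulr_suml.
    apply: le_trans (ler_norm_sum _ _ _) _; apply: ler_sum => i _.
    rewrite -scalerBr normrZ -mulrA; apply: ler_wpM2l => //.
    rewrite /f deriveZ; first exact: Hk.
    by apply: diff_derivable; apply: vCr_diff; apply: (s1 x m 1%N); apply: lt_le_trans rr1.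
  have E3 := HC m; have E4 := HD m.
  have -> : H (h + x) - H x - J *m h =
     (f (x + h) - f x - 'D_h f x) + (('D_h f x - J *m h)
       + ((f x - H x) - (f (x + h) - H (x + h)))).
    rewrite [h + x]addrC; move: (H (x + h)) (H x) (f (x + h)) (f x) ('D_h f x) (J *m h) => a b a' b' d e.
    by apply/colP => i; rewrite !mxE; ring.
  apply: le_trans (ler_normD _ _) _; apply: lerD => //.
  apply: le_trans (ler_normD _ _) _; rewrite mulrDl addrC; apply: lerD => //.
  rewrite mulrDl addrC; apply: normD_le; last exact: E4.
  by rewrite normrN [x + h]addrC; exact: E3.
apply: (@differentiable_eps _ _ _ _ (mulmx J : {linear _ -> _})) => e e0.
pose B := 2 * r4 / c ^+ 2.
have B0 : 0 < B by rewrite !divr_gt0 ?mulr_gt0 ?exprn_gt0.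
have d0 : 0 < e / B by rewrite divr_gt0.
apply: filterS2 (near0_lt _ c0) (near0_lt _ d0) => h /main Hh hd.
apply: le_trans Hh _; rewrite expr2 mulrA; apply: ler_wpM2r => //.
by rewrite mulrC -ler_pdivlMr // ltW.
Qed.

(** Induction on [r] with the dimension generalized, as the derivatives of the limit in dimension
    [n] are limits in dimension [n + n]. The ball obtained depends on [r]. *)
Lemma renorm_limit_Cr r n (A : 'cV[R]_n -> 'cV[R]_n) : contracting_germ k A ->
  \forall x \near (0 : 'cV[R]_n), vCr r (renorm_limit A) x.
Proof.
elim: r n A => [|r IH] n A gA; first by apply: near_all.
have gT := contracting_Tmap gA.
have [c1 c10 Hc] := renorm_limit_derive gA.
have [d d0 Hd] := near0_ex (IH _ _ gT).
pose c := Num.min c1 (d / 2).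
have c0 : 0 < c by rewrite lt_min c10 divr_gt0.
have cd : c < d by apply: (@le_lt_trans _ _ (d / 2)); [rewrite ge_min lexx orbT|lra].
have cc1 : c <= c1 by rewrite ge_min lexx.
have {}Hc := near_near (Hc c c0 cc1).
apply: filterS2 Hc (near0_lt _ c0) => x Hx xc i.
have Hx1 := nbhs_singleton Hx.
have nz (j : 'I_n) : `|col_mx x (c *: delta_mx j 0)| < d.
  apply: le_lt_trans cd; apply: norm_col_mx; first exact: ltW.
  rewrite normrZ gtr0_norm // -[leRHS]mulr1; apply: ler_wpM2l; first exact: ltW.
  exact: norm_delta_le.
have dn : \forall y \near x, differentiable (renorm_limit A) y.
  by apply: filterS Hx => y [].
split; first by apply: filterS dn => y /differentiable_vec.
move=> v.
have : vCr r (fun y => \sum_j v j 0 *: (c^-1 *: dsubmx (renorm_limit (Tmap A) (col_mx y (c *: delta_mx j 0))))) x.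
  apply: vCr_sum => j _; apply: vCrZ; first exact: Cr_cst.
  apply: vCrZ; first exact: Cr_cst.
  apply: (@vCr_comp _ _ _ _ _ (fun y => renorm_limit (Tmap A) (col_mx y (c *: delta_mx j 0))) dsubmx).
    apply: (@vCr_comp _ _ _ _ _ (fun y => col_mx y (c *: delta_mx j 0)) (renorm_limit (Tmap A))).
      by apply: vCr_col_mx; [exact: vCr_id|exact: vCr_cst].
    exact: Hd.
  exact: vCr_dsubmx.
move/(_ i); apply: Cr_near_eq; apply: filterS Hx => y [dy Dy].
rewrite -derive_coord // (diff_delta v dy) !summxE; apply: eq_bigr => j _.
by rewrite Dy.
Qed.

Theorem sternberg n (A : 'cV[R]_n -> 'cV[R]_n) : contracting_germ k A ->
  exists H : 'cV[R]_n -> 'cV[R]_n, 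
   [/\ smooth_near H, H 0 = 0, isO 2 (fun x => H x - x) &
      \forall x \near (0 : 'cV[R]_n), H (A x) = K^-1 *: H x].
Proof.
move=> gA; exists (renorm_limit A).
have [r1 r10 [C1 C10 H1]] := basin k2 gA.
have [r2 r20 H2] := renorm_limitP gA.
have [r3 r30 [C3 C30 H3]] := renorm_lim_ex k2 gA.
have eqv x : `|x| < r1 -> `|x| < r2 -> `|A x| < r2 ->
   renorm_limit A (A x) = K^-1 *: renorm_limit A x.
  move=> x1 x2 Ax2; apply: renorm_lim_uniq (H2 _ Ax2) _.
  (* Starting at [A x] shifts the index by one, which accounts for the factor [K^-1] in the limit
     and [theta] in the error. *)
  have [C HC] := H2 _ x2; exists (K^-1 * C * theta) => m.
  have := HC m.+1; rewrite iterSr => {}HC.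
  have -> : K ^+ m *: iter m A (A x) - K^-1 *: renorm_limit A x =
     K^-1 *: (K ^+ m.+1 *: iter m A (A x) - renorm_limit A x).
    by rewrite scalerBr scalerA exprS mulKf // gt_eqF.
  rewrite normrZ gtr0_norm ?invr_gt0 //.
  have -> : K^-1 * C * theta * theta ^+ m = K^-1 * (C * (theta * theta ^+ m)) by ring.
  apply: ler_wpM2l.
    by rewrite invr_ge0 ltW.
  by rewrite -exprS.
have O2 : isO 2 (fun x => renorm_limit A x - x).
  exists C3 => //.
  apply: filterS2 (near0_lt _ r20) (near0_lt _ r30) => x x2 x3.
  have [[h Hh hx] _] := H3 _ x3.
  by rewrite (renorm_lim_uniq (H2 _ x2) Hh).
pose rho := Num.min r1 r2.
have rho0 : 0 < rho by rewrite lt_min r10 r20.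
have rho1 : rho <= r1 by rewrite ge_min lexx.
have rho2 : rho <= r2 by rewrite ge_min lexx orbT.
have Arho x : `|x| < rho -> `|A x| <= (5 / 4 / K) * `|x| /\ `|A x| < rho.
  move=> xr; have [_ HA _ _] := H1 _ (lt_le_trans xr rho1).
  split=> //; apply: le_lt_trans HA _; apply: le_lt_trans xr.
  rewrite -[leRHS]mul1r; apply: ler_wpM2r => //.
  rewrite ler_pdivrMr // mul1r; have := K2; lra.
split.
- apply: filterS (near0_lt _ rho0) => x xr r.
  have [d d0 Hd] := near0_ex (renorm_limit_Cr r gA).
  have [m Hm] := theta_small `|x| (divr_gt0 d0 (ltr0n _ 2)).
  (* One ball for all orders: the functional equation, iterated, carries differentiability of order
     [r] from the ball of radius [d], which depends on [r], to the fixed ball of radius [rho], since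
     [A ^ m] maps [x] into the former for a suitable [m]. *)
  have iterE y j : `|y| < rho -> renorm_limit A y = K ^+ j *: renorm_limit A (iter j A y).
    move=> yr; elim: j => [|j IH]; first by rewrite expr0 scale1r.
    have [_ yj] := @basin_iter _ _ _ A rho Arho y j yr.
    have [_ Ayj] := Arho _ yj.
    rewrite /= eqv ?(lt_le_trans yj) ?(lt_le_trans Ayj) // scalerA exprSr mulfK ?gt_eqF //.
  have : vCr r (fun y => K ^+ m *: renorm_limit A (iter m A y)) x.
    apply: vCrZ; first exact: Cr_cst.
    apply: (@vCr_comp _ _ _ _ _ (iter m A) (renorm_limit A)).
      apply: vCr_iter => j _; have [_ yj] := @basin_iter _ _ _ A rho Arho x j xr.
      by have [] := H1 _ (lt_le_trans yj rho1).
    apply: Hd; have [yj _] := @basin_iter _ _ _ A rho Arho x m xr.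
    apply: le_lt_trans yj _; apply: (@le_lt_trans _ _ (d / 2)); last by lra.
    apply: le_trans Hm; rewrite mulrC; apply: ler_wpM2l => //.
    apply: lerXn2r; rewrite ?nnegrE ?(ltW theta_gt0) //.
    rewrite ler_pdivrMr // /theta; have := K2; lra.
  apply: vCr_near_eq; apply: filterS (near_norm_lt xr) => y yr.
  by rewrite -iterE.
- have [C _ /nbhs_singleton] := O2.
  by rewrite normr0 expr0n mulr0 subr0 normr_le0 => /eqP.
- exact: O2.
- apply: filterS (near0_lt _ rho0) => x xr; have [_ Axr] := Arho _ xr.
  by apply: eqv; [exact: lt_le_trans rho1|exact: lt_le_trans rho2|exact: lt_le_trans rho2].
Qed.

End Sternberg.

(** * Local inverses of maps close to the identity *)

Section LocalInverse.
Context {R : realType}.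

Lemma unitmx_inj n (J : 'M[R]_n) : (forall v : 'cV[R]_n, J *m v = 0 -> v = 0) -> J \in unitmx.
Proof.
move=> H; rewrite -unitmx_tr -row_free_unit; apply: inj_row_free => u.
rewrite -[u in LHS]trmxK -trmx_mul => /(congr1 trmx); rewrite trmxK trmx0 => /H /(congr1 trmx).
by rewrite trmxK trmx0.
Qed.

Lemma Cr_det r n p (M : 'cV[R]_n -> 'M[R]_p) x :
  (forall i j, Cr r (fun y => M y i j) x) -> Cr r (fun y => \det (M y)) x.
Proof.
move=> H; apply: Cr_sum => s _; apply: CrM; first exact: Cr_cst.
by apply: Cr_prod => i _; exact: H.
Qed.

(** Cramer's rule: the entries of the inverse are polynomials in those of [M y] divided by the
    determinant. *)
Lemma vCr_invmx r n p (M : 'cV[R]_n -> 'M[R]_p) (v : 'cV[R]_p) x :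
  (\forall y \near x, M y \in unitmx) ->
  (forall i j, Cr r (fun y => M y i j) x) -> vCr r (fun y => invmx (M y) *m v) x.
Proof.
move=> uM HM i.
have : Cr r (fun y => \sum_(j < p) ((\det (M y))^-1 * ((-1) ^+ (j + i) * \det (row' j (col' i (M y)))) * v j 0)) x.
  apply: Cr_sum => j _; apply: CrM; last exact: Cr_cst.
  apply: CrM.
    apply: CrV; last exact: Cr_det.
    by have := nbhs_singleton uM; rewrite unitmxE unitfE.
  apply: CrM; first exact: Cr_cst.
  apply: Cr_det => a b; apply: Cr_near_eq (HM (lift j a) (lift i b)).
  by apply: near_all => y; rewrite !mxE.
apply: Cr_near_eq; apply: filterS uM => y uy.
by rewrite /invmx uy -scalemxAl !mxE mulr_sumr; apply: eq_bigr => j _; rewrite !mxE mulrA.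
Qed.

Lemma open_ball_preimage n (H : 'cV[R]_n -> 'cV[R]_n) rho s :
  (forall x, `|x| < rho -> differentiable H x) ->
  open [set x : 'cV[R]_n | `|x| < rho /\ `|H x| < s].
Proof.
move=> dH; rewrite openE => x [xr Hx].
have /differentiable_continuous cH := dH _ xr.
have N := cH _ (near_norm_lt Hx).
by apply: filterS2 (near_norm_lt xr) N => y.
Qed.

Definition jac n (H : 'cV[R]_n -> 'cV[R]_n) x : 'M[R]_n := \matrix_(a, b) ('D_(delta_mx b 0) H x) a 0.

Lemma jacE n (H : 'cV[R]_n -> 'cV[R]_n) x v : differentiable H x -> jac H x *m v = 'D_v H x.
Proof.
move=> dH; rewrite diff_delta //; apply/colP => i; rewrite summxE mxE.
by apply: eq_bigr => j _; rewrite !mxE mulrC.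
Qed.

Section Inverse.
Variables (n : nat) (H : 'cV[R]_n -> 'cV[R]_n) (rho : R).
Hypothesis rho0 : 0 < rho.
Hypothesis H0 : H 0 = 0.
Hypothesis sH : forall x, `|x| < rho -> forall r, vCr r H x.
Hypothesis lipH : forall x z, `|x| < rho -> `|z| < rho ->
  `|(H x - x) - (H z - z)| <= 2^-1 * `|x - z|.
Hypothesis jacH : forall x, `|x| < rho -> jac H x \in unitmx.

(** Half the radius, because the inverse may expand distances by the factor 2 of [expand]. *)
Let W : set 'cV[R]_n := [set y | `|y| < rho / 2].
Let U : set 'cV[R]_n := [set x | `|x| < rho /\ `|H x| < rho / 2].

Lemma expand x z : `|x| < rho -> `|z| < rho -> `|x - z| <= 2 * `|H x - H z|.
Proof.
move=> xr zr; have := lipH xr zr.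
have := ler_normB (H x - H z) ((H x - x) - (H z - z)).
have -> : H x - H z - (H x - x - (H z - z)) = x - z.
  by apply/colP => i; rewrite !mxE; ring.
lra.
Qed.

(** Picard iteration of [x |-> y - (H x - x)] from 0 contracts by [1 / 2], which is below [theta],
    so [vec_geometric_limit] provides the fixed point; the iterates stay within [2 |y| < rho]. *)
Lemma local_surj y : W y -> exists x, `|x| < rho /\ H x = y.
Proof.
rewrite /W /= => yr.
pose f x := H x - x.
have f0 : f 0 = 0 by rewrite /f H0 subrr.
pose u m := iter m (fun x => y - f x) 0.
have us m : u m.+1 = y - f (u m) by [].
have um m : `|u m| <= 2 * `|y|.
  elim: m => [|m IH]; first by rewrite normr0 mulr_ge0.
  rewrite /u iterS -/(u m); apply: le_trans (ler_normB _ _) _.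
  have umr : `|u m| < rho by apply: le_lt_trans IH _; lra.
  have := @lipH (u m) 0 umr; rewrite normr0 => /(_ rho0).
  rewrite H0 !subr0 -/(f _); lra.
have umr m : `|u m| < rho by apply: le_lt_trans (um m) _; lra.
have step m : `|u m.+1 - u m| <= `|y| * theta ^+ m.
  elim: m => [|m IH].
    by rewrite /u /= f0 !subr0 expr0 mulr1.
  have -> : u m.+2 - u m.+1 = - (f (u m.+1) - f (u m)).
    rewrite (us m.+1) {2}(us m); move: (f (u m.+1)) (f (u m)) => a b.
    by apply/colP => i; rewrite !mxE; ring.
  rewrite normrN; apply: le_trans (lipH (umr _) (umr _)) _.
  rewrite exprS mulrCA; apply: ler_pM => //; rewrite /theta; lra.
have [l Hl] := vec_geometric_limit step.
set D := `|y| / (1 - theta) in Hl.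
have lr : `|l| < rho.
  apply: (@le_lt_trans _ _ (2 * `|y|)); last by lra.
  apply: (@theta_limit _ _ _ D) => m.
  rewrite -[l](subKr (u m)); apply: le_trans (ler_normB _ _) _.
  by apply: lerD.
exists l; split=> //; apply/subr0_eq/eqP; rewrite -normr_le0.
apply: (@theta_limit _ _ _ (2^-1 * D + D * theta)) => m.
have E : H l - y = (f l - f (u m)) - (u m.+1 - l).
  rewrite us /f; move: (H l) (H (u m)) => a b; apply/colP => i; rewrite !mxE; ring.
rewrite add0r E; apply: le_trans (ler_normB _ _) _.
rewrite mulrDl; apply: lerD.
  apply: le_trans (lipH lr (umr m)) _; rewrite distrC -mulrA; exact: ler_wpM2l.
have := Hl m.+1; rewrite exprS mulrA; exact.
Qed.

Definition local_inv y : 'cV[R]_n := xget 0 [set x | `|x| < rho /\ H x = y].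

Lemma local_invP y : W y -> `|local_inv y| < rho /\ H (local_inv y) = y.
Proof. by move=> /local_surj ex; apply: (@xgetPex _ 0 [set x | `|x| < rho /\ H x = y]). Qed.

Lemma local_invK x : U x -> local_inv (H x) = x.
Proof.
move=> [xr Hx]; have [lr HE] := local_invP Hx.
have := expand lr xr; rewrite HE subrr normr0 mulr0 normr_le0 => /eqP.
exact: subr0_eq.
Qed.

Lemma local_inv_derive y : W y -> differentiable local_inv y /\
   forall v, 'D_v local_inv y = invmx (jac H (local_inv y)) *m v.
Proof.
move=> Wy; have [xr Hx] := local_invP Wy; set x := local_inv y in xr Hx *.
set J := invmx _.
apply: (@differentiable_eps _ _ _ _ (mulmx J : {linear _ -> _})) => e e0.
have [K K0 HK] := mulmx_norm J.
have dH : differentiable H x by apply: vCr_diff (sH xr 1%N).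
have e1 : 0 < e / (2 * (K + 1)) by rewrite divr_gt0 // mulr_gt0 // ltr_wpDl.
have [d d0 Hd] := near0_ex (differentiable_epsP e1 dH).
have d2 : 0 < d / 2 by rewrite divr_gt0.
have d3 : 0 < rho / 2 - `|y| by rewrite subr_gt0.
apply: filterS2 (near0_lt _ d2) (near0_lt _ d3) => k kd kr.
have Wk : W (k + y) by rewrite /W /=; apply: le_lt_trans (ler_normD _ _) _; lra.
have [lr HE] := local_invP Wk.
pose h := local_inv (k + y) - x.
have hk : `|h| <= 2 * `|k|.
  by apply: le_trans (expand lr xr) _; rewrite HE Hx addrK.
have hd : `|h| < d by apply: le_lt_trans hk _; lra.
have := Hd _ hd; rewrite /h subrK HE Hx addrK -/h -jacE // => Hh.
have -> : local_inv (k + y) - x - J *m k = - (J *m (k - jac H x *m h)).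
  by rewrite mulmxBr mulKmx ?jacH // opprB.
rewrite normrN; apply: le_trans (HK _) _.
apply: (@le_trans _ _ ((K + 1) * (e / (2 * (K + 1)) * (2 * `|k|)))).
  apply: ler_pM => //; first by rewrite lerDl.
  by apply: le_trans Hh _; apply: ler_wpM2l => //; exact: ltW.
by rewrite le_eqVlt; apply/orP; left; apply/eqP; field; rewrite gt_eqF // ltr_wpDl.
Qed.

(** Bootstrap: the derivative of the inverse is the inverse Jacobian of [H] composed with
    [local_inv], hence has the order of differentiability already known for [local_inv]. *)
Lemma local_inv_vCr r y : W y -> vCr r local_inv y.
Proof.
elim: r y => [|r IH] y Wy //.
have nW : \forall z \near y, W z by exact: near_norm_lt.
have [xr Hx] := local_invP Wy.
move=> i; split.
  by apply: filterS nW => z /local_inv_derive[] /differentiable_vec.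
move=> v.
have Hinv : vCr r (fun x => invmx (jac H x) *m v) (local_inv y).
  apply: vCr_invmx; first by apply: filterS (near_norm_lt xr) => z; exact: jacH.
  move=> a b; apply: Cr_near_eq (vCr_derive (delta_mx b 0) (sH xr r.+1) a).
  by apply: near_all => z; rewrite mxE.
have := vCr_comp (IH _ Wy) Hinv; move/(_ i); apply: Cr_near_eq.
apply: filterS nW => z Wz; have [dz Dz] := local_inv_derive Wz.
by rewrite -derive_coord // Dz.
Qed.

Lemma local_diffeo_of_inverse (N : 'M[R]_n) : N \in unitmx ->
  is_local_diffeo_germ (fun x => N *m H x).
Proof.
move=> uN; split; first by rewrite H0 mulmx0.
have oW' : open [set y : 'cV[R]_n | W (invmx N *m y)].
  rewrite openE => y Wy.
  have /differentiable_continuous c := (derive_mulmx (invmx N) y).1.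
  exact: (c _ (near_norm_lt Wy)).
have oU : open U by apply: open_ball_preimage => x xr; apply: vCr_diff (sH xr 1%N).
exists U, [set y | W (invmx N *m y)], (fun y => local_inv (invmx N *m y)).
split.
- by [].
- by split; rewrite /U /W /= ?mulmx0 ?H0 normr0 ?divr_gt0.
- split=> [x [xr Hx]|y /= Wy]; first by rewrite /= mulKmx.
  by have [l1 l2] := local_invP Wy; split; rewrite ?l2.
- split=> [x Ux|y /= Wy]; first by rewrite mulKmx // local_invK.
  by have [_ ->] := local_invP Wy; rewrite mulKVmx.
- split; apply: vCr_smooth_on => r x.
    move=> [xr _]; apply: (@vCr_comp _ _ _ _ _ H (mulmx N)); first exact: sH.
    exact: vCr_mulmx.
  move=> Wx; apply: (@vCr_comp _ _ _ _ _ (mulmx (invmx N)) local_inv); first exact: vCr_mulmx.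
  exact: local_inv_vCr.
Qed.
End Inverse.

Theorem local_diffeo_near_id n (H : 'cV[R]_n -> 'cV[R]_n) (N : 'M[R]_n) :
  smooth_near H -> H 0 = 0 -> isO 2 (fun x => H x - x) -> N \in unitmx ->
  is_local_diffeo_germ (fun x => N *m H x).
Proof.
move=> sH H0 H2 uN; have sH0 := nbhs_singleton sH.
have DH0 v : 'D_v H 0 = v.
  have := @isO2_derive _ _ H 1 H0 _ v; rewrite scale1r; apply.
  by apply: isO_ext H2 => x; rewrite scale1r.
have dH : \forall y \near (0 : 'cV[R]_n), differentiable H y.
  by apply: filterS sH => y /(_ 1%N) /vCr_diff.
have O1 (i : 'I_n) : isO 1 (fun x => 'D_(delta_mx i 0) H x - delta_mx i 0).
  apply: differentiable_isO; last by rewrite DH0 subrr.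
  apply: differentiableB; last exact: differentiable_cst.
  exact: vCr_differentiable_derive.
have [C C0 HC] := isO_family O1.
have [d d0 Hd] := near0_ex (filterI sH HC).
(* Chosen so that [n K <= 1 / 2]: by [lipschitz_ball] the map [H x - x] then has Lipschitz constant
   at most [1 / 2]. *)
pose K := 2^-1 / (n%:R + 1) : R.
have n1 : 0 < n%:R + 1 :> R by rewrite ltr_wpDl.
have K0 : 0 < K by rewrite divr_gt0.
have nK : n%:R * K <= 2^-1.
  by rewrite /K mulrCA ger_pMr // ler_pdivrMr // mul1r lerDl.
pose rho := Num.min (d / 2) (K / (C + 1)).
have rho0 : 0 < rho by rewrite lt_min !divr_gt0 // ltr_wpDl.
have rd (x : 'cV[R]_n) : `|x| <= rho -> `|x| < d.
  by rewrite le_min => /andP[xd _]; apply: le_lt_trans xd _; lra.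
have DK (x : 'cV[R]_n) (i : 'I_n) : `|x| <= rho -> `|'D_(delta_mx i 0) H x - delta_mx i 0| <= K.
  move=> xr; have [_ /(_ i) H1] := Hd _ (rd _ xr); apply: le_trans H1 _.
  apply: (@le_trans _ _ ((C + 1) * (K / (C + 1)))).
    rewrite expr1; apply: ler_pM => //; first by rewrite lerDl.
    by move: xr; rewrite le_min => /andP[].
  by rewrite mulrCA mulfV ?mulr1 // gt_eqF // ltr_wpDl.
have dHx (x : 'cV[R]_n) : `|x| <= rho -> differentiable H x.
  by move=> /rd /Hd[/(_ 1%N) /vCr_diff].
have dfx (x : 'cV[R]_n) : `|x| <= rho -> differentiable (fun x => H x - x) x /\
    forall v, 'D_v (fun x => H x - x) x = 'D_v H x - v.
  move=> /dHx dx; split; first by apply: differentiableB.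
  by move=> v; rewrite deriveB ?derive_id //; exact: diff_derivable.
apply: (@local_diffeo_of_inverse _ H rho) => //.
- by move=> x /ltW /rd /Hd[].
- move=> x z /ltW xr /ltW zr.
  apply: le_trans (@lipschitz_ball _ _ _ (fun x => H x - x) rho K (ltW K0) _ _ x z xr zr) _.
  + by move=> y /dfx[].
  + by move=> y i yr; have [_ ->] := dfx _ yr; exact: DK.
  + exact: ler_wpM2r.
- move=> x /ltW xr; apply: unitmx_inj => v; rewrite (jacE _ (dHx _ xr)) => Dv.
  (* For a kernel vector of the Jacobian, [v = v - 'D_v H x], which is bounded by [n K |v|]. *)
  have : `|v| <= 2^-1 * `|v|.
    rewrite -[v in leLHS]subr0 -Dv distrC.
    have [dfxx E] := dfx _ xr; rewrite -E (diff_delta _ dfxx).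
    apply: le_trans (ler_norm_sum _ _ _) _.
    apply: (@le_trans _ _ (\sum_(i < n) K * `|v|)).
      apply: ler_sum => i _; rewrite normrZ mulrC; apply: ler_pM => //.
        by have [_ ->] := dfx _ xr; exact: DK.
      exact: norm_coord.
    by rewrite sumr_const card_ord -[leLHS]mulr_natl mulrA; apply: ler_wpM2r.
  move=> Hv; apply/eqP; rewrite -normr_le0; lra.
Qed.

End LocalInverse.

(** * Scalar product, conformal fields and Cholesky factorization *)

Section VectorIdentities.
Context {R : realType}.

Lemma coordD n (a b : 'cV[R]_n) i : (a + b) i 0 = a i 0 + b i 0. Proof. by rewrite mxE. Qed.
Lemma coordN n (a : 'cV[R]_n) i : (- a) i 0 = - a i 0. Proof. by rewrite mxE. Qed.
Lemma coordZ n c (a : 'cV[R]_n) i : (c *: a) i 0 = c * a i 0. Proof. by rewrite mxE. Qed.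
Lemma coord0 n i : (0 : 'cV[R]_n) i 0 = 0. Proof. by rewrite mxE. Qed.
Definition coordE := (coordD, coordN, coordZ, coord0).

Definition dot n (x y : 'cV[R]_n) : R := \sum_i x i 0 * y i 0.

Lemma dotC n (x y : 'cV[R]_n) : dot x y = dot y x.
Proof. by apply: eq_bigr => i _; rewrite mulrC. Qed.

Lemma dotDl n c (x y z : 'cV[R]_n) : dot (c *: x + y) z = c * dot x z + dot y z.
Proof.
by rewrite /dot mulr_sumr -big_split; apply: eq_bigr => i _; rewrite !coordE mulrDl mulrA.
Qed.

Lemma dotDr n c (x y z : 'cV[R]_n) : dot z (c *: x + y) = c * dot z x + dot z y.
Proof. by rewrite dotC dotDl !(dotC z). Qed.

Lemma dotNr n (x z : 'cV[R]_n) : dot z (- x) = - dot z x.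
Proof. by rewrite /dot -sumrN; apply: eq_bigr => i _; rewrite coordN mulrN. Qed.

Lemma dotBr n (x y z : 'cV[R]_n) : dot z (x - y) = dot z x - dot z y.
Proof. by rewrite -[x in LHS]scale1r dotDr dotNr mul1r. Qed.

Lemma sqnorm_dot n (x : 'cV[R]_n) : sqnorm x = dot x x.
Proof. by apply: eq_bigr => i _; rewrite expr2. Qed.

Lemma dot_le n (x y : 'cV[R]_n) : `|dot x y| <= n%:R * (`|x| * `|y|).
Proof.
apply: le_trans (ler_norm_sum _ _ _) _.
apply: (@le_trans _ _ (\sum_(i < n) `|x| * `|y|)).
  by apply: ler_sum => i _; rewrite normrM; apply: ler_pM => //; exact: norm_coord.
by rewrite sumr_const card_ord -[leLHS]mulr_natl.
Qed.

Lemma norm2_le_dot n (x : 'cV[R]_n) : `|x| ^+ 2 <= dot x x.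
Proof.
have d0 : 0 <= dot x x by apply: sumr_ge0 => i _; rewrite -expr2 sqr_ge0.
have : `|x| <= Num.sqrt (dot x x).
  apply: norm_le_coord => [|i]; first exact: sqrtr_ge0.
  rewrite -sqrtr_sqr; apply: ler_wsqrtr.
  rewrite /dot (bigD1 i) //= -expr2 lerDl; apply: sumr_ge0 => j _.
  by rewrite -expr2 sqr_ge0.
by move=> H; rewrite -(sqr_sqrtr d0); apply: lerXn2r; rewrite ?nnegrE ?sqrtr_ge0.
Qed.

(* The polarization of the quadratic field induced by the translation along [v], seen from infinity. *)
Definition inv_field n (v x y : 'cV[R]_n) : 'cV[R]_n :=
  dot x y *: v - dot x v *: y - dot y v *: x.

Lemma inv_field_le n (v x y : 'cV[R]_n) :
  `|inv_field v x y| <= 3 * n%:R * (`|v| * (`|x| * `|y|)).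
Proof.
rewrite /inv_field; apply: le_trans (ler_normB _ _) _.
apply: le_trans (lerD (ler_normB _ _) (lexx _)) _; rewrite !normrZ.
have := dot_le x y; have := dot_le x v; have := dot_le y v => H1 H2 H3.
have := ler_wpM2r (normr_ge0 v) H3; have := ler_wpM2r (normr_ge0 y) H2.
have := ler_wpM2r (normr_ge0 x) H1.
lra.
Qed.

Lemma dot_delta n (x : 'cV[R]_n) i : dot x (delta_mx i 0) = x i 0.
Proof.
rewrite /dot (bigD1 i) //= mxE !eqxx mulr1 big1 ?addr0 // => j /negPf ji.
by rewrite mxE ji mulr0.
Qed.

(** Induction by Schur complement: [E] is what remains after eliminating the first coordinate, and
    it is again symmetric and positive definite. *)
Lemma cholesky n (P : 'M[R]_n) : P^T = P -> (forall x : 'cV[R]_n, x != 0 -> 0 < dot x (P *m x)) ->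
  exists2 N : 'M[R]_n, N \in unitmx & P = N^T *m N.
Proof.
elim: n P => [|n IH] P sP pP.
  exists 1%:M; first exact: unitmx1.
  by apply/matrixP => -[].
pose Q : 'M[R]_(1 + n) := P.
pose a := Q 0 0; pose b : 'rV[R]_n := ursubmx Q; pose D : 'M[R]_n := drsubmx Q.
have QE : Q = block_mx a%:M b b^T D.
  rewrite -[LHS]submxK; congr block_mx.
    by apply/matrixP => i j; rewrite !ord1 !mxE /a; congr (Q _ _); apply: val_inj.
  by rewrite /b trmx_ursub -[Q^T]/(P^T) sP.
have sD : D^T = D by rewrite /D trmx_drsub -[Q^T]/(P^T) sP.
have dotE m (x y : 'cV[R]_m) : dot x y = (x^T *m y) 0 0.
  by rewrite mxE; apply: eq_bigr => i _; rewrite mxE.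
have a0 : 0 < a.
  have := pP (delta_mx 0 0).
  have -> : P *m delta_mx 0 0 = col 0 P by rewrite colE.
  rewrite dotC dot_delta mxE; apply; apply/eqP => /colP /(_ 0); rewrite !mxE !eqxx.
  by move/eqP; rewrite oner_eq0.
pose E := D - a^-1 *: (b^T *m b).
have sE : E^T = E by rewrite /E linearB linearZ /= trmx_mul trmxK sD.
have pE (y : 'cV[R]_n) : y != 0 -> 0 < dot y (E *m y).
  (* The first coordinate is chosen so that [Q x] has first coordinate zero; the form of [Q] at [x]
     is then that of [E] at [y]. *)
  move=> y0; pose x : 'cV[R]_(1 + n) := col_mx (- a^-1 *: (b *m y)) y.
  have x0 : x != 0.
    apply: contra_neq y0 => /(congr1 dsubmx); rewrite col_mxKd => ->.
    by apply/colP => i; rewrite !mxE.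
  suff Px : Q *m x = col_mx 0 (E *m y).
    have := pP _ x0; suff -> : dot x (P *m x) = dot y (E *m y) by [].
    transitivity (@dot (1 + n) x (Q *m x)) => //.
    by rewrite Px !dotE /x tr_col_mx mul_row_col mulmx0 add0r.
  rewrite QE /x mul_block_col; congr col_mx.
    by rewrite mul_scalar_mx scalerA mulrN mulfV ?gt_eqF // scaleN1r addNr.
  by rewrite /E mulmxBl -scalemxAr -scalemxAl -mulmxA scaleNr addrC.
have [N' uN' EN'] := IH _ sE pE.
pose c := Num.sqrt a; have c0 : 0 < c by rewrite sqrtr_gt0.
have cc : c * c = a by rewrite -expr2 sqr_sqrtr // ltW.
pose N : 'M[R]_(1 + n) := block_mx c%:M (c^-1 *: b) 0 N'.
have uN : N \in unitmx.
  rewrite /N unitmxE det_ublock unitrM -[\det N' \is a _]/(N' \in unitmx) uN' andbT.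
  by rewrite det_scalar1 unitfE gt_eqF.
exists N => //; suff : Q = N^T *m N by [].
rewrite QE /N tr_block_mx mulmx_block !linearZ /= tr_scalar_mx trmx0.
rewrite !mul0mx !mulmx0 !addr0 -EN'; congr block_mx.
- by rewrite -scalar_mxM cc.
- by rewrite mul_scalar_mx scalerA mulVf ?scale1r // gt_eqF.
- by rewrite mul_mx_scalar scalerA mulfV ?scale1r // gt_eqF.
- rewrite -?scalemxAl -?scalemxAr scalerA -invfM cc /E addrC subrK.
  by [].
Qed.
End VectorIdentities.

(** * Linear maps between column spaces *)

Section LinearMaps.
Context {R : realType}.

(** A predicate, meant for partial applications of multilinear expressions such as [Q v x], which
    carry no canonical linear structure. *)
Definition is_lin n m (F : 'cV[R]_n -> 'cV[R]_m) := forall c v w, F (c *: v + w) = c *: F v + F w.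

Variables (n m : nat) (F : 'cV[R]_n -> 'cV[R]_m).
Hypothesis lF : is_lin F.

Lemma lin0 : F 0 = 0.
Proof. by have := lF (-1) 0 0; rewrite scaler0 add0r scaleN1r addNr. Qed.

Lemma linZ c v : F (c *: v) = c *: F v.
Proof. by have := lF c v 0; rewrite lin0 !addr0. Qed.

Lemma linD v w : F (v + w) = F v + F w.
Proof. by have := lF 1 v w; rewrite !scale1r. Qed.

Lemma linN v : F (- v) = - F v.
Proof. by rewrite -scaleN1r linZ scaleN1r. Qed.

Lemma lin_sum (I : finType) (P : pred I) (c : I -> R) (v : I -> 'cV[R]_n) :
  F (\sum_(i | P i) c i *: v i) = \sum_(i | P i) c i *: F (v i).
Proof.
elim/big_rec2: _ => [|i x y _ <-]; first exact: lin0.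
by rewrite linD linZ.
Qed.

Lemma lin_delta v : F v = \sum_i v i 0 *: F (delta_mx i 0).
Proof. by rewrite {1}(cV_delta v) lin_sum. Qed.

Lemma lin_mulmx : exists M : 'M[R]_(m, n), forall v, M *m v = F v.
Proof.
exists (\matrix_(a, b) (F (delta_mx b 0)) a 0) => v; rewrite (lin_delta v).
by apply/colP => i; rewrite summxE mxE; apply: eq_bigr => j _; rewrite !mxE mulrC.
Qed.
End LinearMaps.

(** * Real inequalities for the self-improving bound *)

Section RealEstimates.
Context {R : realType}.

Lemma abs32 (x X : R) : 32 * `|x| <= X -> - X <= 32 * x <= X.
Proof. by rewrite -ler_norml normrM (ger0_norm (ler0n _ 32)). Qed.

(* The hypotheses are coordinates of [eta_cube] below; [y] and [hj] are the entries of [eta] to be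
   bounded, and the other unknown terms are quadratically small. *)
Lemma off_diagonal_estimate (X gaa y gch gah gac z gay c1 c2 c3 : R) (b : bool) :
  2 * gaa * y + 3 * gch * 0 - gah * b%:R - 2 * gac * z - 2 * gay * 0 = 3 * c1 - c2 - 2 * c3 ->
  32 * `|c1| <= X -> 32 * `|c2| <= X -> 32 * `|c3| <= X -> 32 * `|(gaa - 1) * y| <= X ->
  32 * `|gac * z| <= X -> 32 * `|gah| <= X -> `|y| <= X / 4.
Proof.
move=> H /abs32/andP[? ?] /abs32/andP[? ?] /abs32/andP[? ?] /abs32/andP[? ?] /abs32/andP[? ?] /abs32/andP[? ?].
by case: b H => /=; rewrite ler_norml => H; apply/andP; split; lra.
Qed.

Lemma diagonal_estimate (X gaa y gch gah gac z gay c1 c2 c3 hj : R) :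
  2 * gaa * y + 3 * gch * 1 - gah * 0 - 2 * gac * z - 2 * gay * 1 = 3 * c1 - c2 - 2 * c3 ->
  32 * `|c1| <= X -> 32 * `|c2| <= X -> 32 * `|c3| <= X -> 32 * `|(gaa - 1) * y| <= X ->
  32 * `|gac * z| <= X -> 32 * `|gch - hj| <= X -> 32 * `|gay - y| <= X -> `|hj| <= X / 4.
Proof.
move=> H /abs32/andP[? ?] /abs32/andP[? ?] /abs32/andP[? ?] /abs32/andP[? ?] /abs32/andP[? ?] /abs32/andP[? ?] /abs32/andP[? ?].
by rewrite ler_norml; apply/andP; split; lra.
Qed.
End RealEstimates.

(** * Rigidity of commuting families of quadratic fields *)

Section CommutingQuadraticFields.
Context {R : realType}.
Variable n : nat.
Local Notation V := 'cV[R]_n.+1.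
Local Notation p := (n.+1%:R : R).
Implicit Types a b v w x y T S : V.
Variables (Q : V -> V -> V -> V) (eps : R).
Hypothesis Qlin1 : forall x y, is_lin (fun v => Q v x y).
Hypothesis Qlin2 : forall v y, is_lin (fun x => Q v x y).
Hypothesis Qsym : forall v x y, Q v x y = Q v y x.
Hypothesis Qcomm : forall v w x, Q v x (Q w x x) = Q w x (Q v x x).
Hypothesis eps0 : 0 <= eps.
Hypothesis Qclose : forall v x y, `|Q v x y - inv_field v x y| <= eps * (`|v| * (`|x| * `|y|)).
(** [e1] bounds the deviation of [tri] from its conformal model, and [kap], as [3 e1 + 6 e1], the
    initial size of [eta] on the [f j]. The factor [p ^+ 4] in [small] pays for two nested
    applications of [eta], each expanded over pairs of basis vectors. *)
Let e1 := 8 * p * eps.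
Let kap := 9 * e1.
Hypothesis small : 32 * p ^+ 4 * kap <= 1.

Let p1 : 1 <= p. Proof. by rewrite ler1n. Qed.
Let p0 : 0 < p. Proof. exact: lt_le_trans ltr01 p1. Qed.
Let e10 : 0 <= e1. Proof. by rewrite !mulr_ge0. Qed.
Let kap0 : 0 <= kap. Proof. by rewrite mulr_ge0. Qed.

Let pkap : 32 * (p * kap) <= 1.
Proof.
apply: le_trans small; rewrite mulrA; apply: ler_wpM2r => //; apply: ler_wpM2l => //.
by rewrite exprS ler_peMr ?exprn_ege1 // ltW.
Qed.

Let kap_small : 32 * kap <= 1.
Proof. by apply: le_trans pkap; apply: ler_wpM2l => //; rewrite ler_peMl. Qed.

Let e1_small : 288 * e1 <= 1.
Proof. by move: kap_small; rewrite /kap mulrA -natrM. Qed.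

Let eps_small : 288 * eps <= 1.
Proof.
apply: le_trans e1_small; apply: ler_wpM2l => //; rewrite /e1 -[leLHS]mul1r.
apply: ler_wpM2r => //; have := p1; lra.
Qed.

Local Notation e := (delta_mx 0 0 : V).

Let normE : `|e| <= 1. Proof. exact: norm_delta_le. Qed.

Let Qlin3 v x : is_lin (Q v x).
Proof. by move=> c y z; rewrite !(Qsym _ x) Qlin2. Qed.

Definition base_mx : 'M[R]_n.+1 := \matrix_(a, b) (Q (delta_mx b 0) e e) a 0.

Lemma base_mxE v : base_mx *m v = Q v e e.
Proof.
rewrite (lin_delta (Qlin1 e e)); apply/colP => i; rewrite summxE mxE.
by apply: eq_bigr => j _; rewrite !mxE mulrC.
Qed.

(** Value at [e] of the conformal fields: the reflection in the hyperplane orthogonal to [e]. It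
    preserves the sup norm, so [base_mx], being close to it, is invertible. *)
Definition reflect (v : V) : V := v - (2 * v 0 0) *: e.

Lemma reflectE v : inv_field v e e = reflect v.
Proof.
rewrite /inv_field !(dotC e) !dot_delta !mxE !eqxx scale1r /reflect.
by rewrite -addrA -opprD -scalerDl; congr (_ - _ *: _); ring.
Qed.

Lemma reflect_coord v i : (reflect v) i 0 = if i == 0 then - v 0 0 else v i 0.
Proof.
rewrite /reflect !coordE mxE eqxx andbT; case: eqP => [->|_]; rewrite ?mulr1 ?mulr0; ring.
Qed.

Lemma reflectK v : reflect (reflect v) = v.
Proof.
by apply/colP => i; rewrite !reflect_coord; case: eqP => [->|//]; rewrite opprK.
Qed.

Lemma norm_reflect_le v : `|reflect v| <= `|v|.
Proof.
apply: norm_le_coord => // i; rewrite reflect_coord; case: ifP => _; rewrite ?normrN; exact: norm_coord.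
Qed.

Lemma norm_reflect v : `|reflect v| = `|v|.
Proof. by apply/eqP; rewrite eq_le norm_reflect_le -{1}[v]reflectK norm_reflect_le. Qed.

Lemma reflectB v w : reflect (v - w) = reflect v - reflect w.
Proof. by apply/colP => i; rewrite /reflect !coordE; ring. Qed.

Lemma base_close v : `|Q v e e - reflect v| <= eps * `|v|.
Proof.
rewrite -reflectE; apply: le_trans (Qclose v e e) _; apply: ler_wpM2l => //.
by rewrite ler_piMr // mulr_ile1.
Qed.

Lemma base_mx_unit : base_mx \in unitmx.
Proof.
apply: unitmx_inj => v; rewrite base_mxE => v0; have := base_close v.
rewrite v0 sub0r normrN norm_reflect => H; apply/eqP; rewrite -normr_le0.
have := normr_ge0 v; have := eps_small; nra.
Qed.

Let P T := invmx base_mx *m T.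

Lemma base_inv T : Q (P T) e e = T.
Proof. by rewrite -base_mxE /P mulKVmx // base_mx_unit. Qed.

Lemma norm_base_inv T : `|P T| <= 2 * `|T|.
Proof.
have := base_close (P T); rewrite base_inv => H.
have : `|P T| <= `|T| + eps * `|P T|.
  by rewrite -{1}norm_reflect -[reflect _](subKr T); apply: normB_le.
have := normr_ge0 (P T); have := eps_small; nra.
Qed.

Lemma base_inv_close T : `|P T - reflect T| <= 2 * eps * `|T|.
Proof.
have -> : P T - reflect T = reflect (reflect (P T) - T) by rewrite reflectB reflectK.
rewrite norm_reflect distrC -{1}(base_inv T); apply: le_trans (base_close _) _.
have := norm_base_inv T; move: eps0; nra.
Qed.

(** The family indexed by its value [T] at the base point [e] instead of by [v]; [P T] is the index
    that has this value. *)
Definition tri a T b := Q (P T) a b.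

Lemma tri_lin1 T b : is_lin (fun a => tri a T b). Proof. exact: Qlin2. Qed.
Lemma tri_lin3 a T : is_lin (tri a T). Proof. exact: Qlin3. Qed.
Lemma triC a T b : tri a T b = tri b T a. Proof. exact: Qsym. Qed.

Lemma tri_close a T b :
  `|tri a T b - inv_field (reflect T) a b| <= e1 * (`|T| * (`|a| * `|b|)).
Proof.
have ifB v w : inv_field (v - w) a b = inv_field v a b - inv_field w a b.
  rewrite /inv_field !dotBr; apply/colP => i; rewrite !coordE; ring.
have -> : tri a T b - inv_field (reflect T) a b =
    (tri a T b - inv_field (P T) a b) + inv_field (P T - reflect T) a b.
  by rewrite (ifB (P T)) subrKA.
have H1 := Qclose (P T) a b; have H2 := inv_field_le (P T - reflect T) a b.
apply: le_trans (normD_le H1 H2) _.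
set ab := `|a| * `|b|; have ab0 : 0 <= ab by rewrite mulr_ge0.
have H3 := norm_base_inv T; have H4 := base_inv_close T.
have K1 : eps * (`|P T| * ab) <= eps * (2 * `|T| * ab).
  by apply: ler_wpM2l => //; apply: ler_wpM2r.
have K2 : 3 * p * (`|P T - reflect T| * ab) <= 3 * p * (2 * eps * `|T| * ab).
  by apply: ler_wpM2l; [rewrite mulr_ge0 // ltW|exact: ler_wpM2r].
have K3 : 1 * (eps * (`|T| * ab)) <= p * (eps * (`|T| * ab)).
  by apply: ler_wpM2r => //; rewrite !mulr_ge0.
rewrite /e1; nra.
Qed.

Definition op a b := tri a e b.

Lemma op_lin1 b : is_lin (op^~ b). Proof. exact: tri_lin1. Qed.
Lemma op_lin2 a : is_lin (op a). Proof. exact: tri_lin3. Qed.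
Lemma opC a b : op a b = op b a. Proof. exact: triC. Qed.

(** For the conformal fields [op] is the product of a spin factor with unit [e], in which the
    orthogonal complement of [e] carries the negative of the scalar product. *)
Lemma op_close a b :
  `|op a b - (a 0 0 *: b + b 0 0 *: a - dot a b *: e)| <= e1 * (`|a| * `|b|).
Proof.
have := tri_close a e b.
have -> : inv_field (reflect e) a b = a 0 0 *: b + b 0 0 *: a - dot a b *: e.
  have -> : reflect e = - e.
    apply/colP => i; rewrite reflect_coord !coordE !mxE !eqxx andbT.
    by case: (i == 0); rewrite ?oppr0.
  rewrite /inv_field !dotNr !dot_delta; apply/colP => i; rewrite !coordE; ring.
move/le_trans; apply; apply: ler_wpM2l => //.
by rewrite ler_piMl // mulr_ge0.
Qed.

(* Polarization of the commutation relation at the base point [e]: it makes [op] a commutative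
   product with unit [e], in terms of which [tri] is the quadratic representation [triE] of
   Jordan theory. *)
Lemma tri_base T : tri e T e = T. Proof. exact: base_inv. Qed.

Lemma tri_comm x S T : tri x S (tri x T x) = tri x T (tri x S x).
Proof. exact: Qcomm. Qed.

Lemma tri_expand s a S T :
  tri (s *: a + e) S (tri (s *: a + e) T (s *: a + e)) =
  s ^+ 3 *: tri a S (tri a T a)
  + s ^+ 2 *: (2 *: tri a S (tri e T a) + tri e S (tri a T a))
  + s *: (tri a S T + 2 *: tri e S (tri e T a)) + tri e S T.
Proof.
have -> : tri (s *: a + e) T (s *: a + e) = s ^+ 2 *: tri a T a + ((2 * s) *: tri e T a + T).
  rewrite tri_lin1 !tri_lin3 tri_base (triC a T e).
  by apply/colP => i; rewrite !coordE; ring.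
rewrite tri_lin1 !tri_lin3; apply/colP => i; rewrite !coordE; ring.
Qed.

Lemma tri_comm1 a S T :
  tri a S T + 2 *: tri e S (tri e T a) = tri a T S + 2 *: tri e T (tri e S a).
Proof.
(* The values 1 and -1 of [s] separate the powers of [s] by parity. In the odd part the cubic
   coefficient is symmetric by [tri_comm] at [a], which leaves the coefficient of [s]. *)
have A1 := tri_comm (1 *: a + e) S T; rewrite !tri_expand in A1.
have A2 := tri_comm (-1 *: a + e) S T; rewrite !tri_expand in A2.
have A3 := tri_comm a S T.
apply/colP => i; move: A1 A2 A3 => /colP /(_ i) A1 /colP /(_ i) A2 /colP /(_ i) A3.
by rewrite !coordE in A1 A2 A3 *; lra.
Qed.

Lemma tri_comm0 S T : tri e S T = tri e T S.
Proof. by have := tri_comm e S T; rewrite !tri_base. Qed.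

Lemma tri_comm2 a S T :
  2 *: tri a S (tri e T a) + tri e S (tri a T a) = 2 *: tri a T (tri e S a) + tri e T (tri a S a).
Proof.
(* Even part of the same expansion; its constant coefficient is symmetric by [tri_comm0]. *)
have A1 := tri_comm (1 *: a + e) S T; rewrite !tri_expand in A1.
have A2 := tri_comm (-1 *: a + e) S T; rewrite !tri_expand in A2.
have A3 := tri_comm0 S T.
apply/colP => i; move: A1 A2 A3 => /colP /(_ i) A1 /colP /(_ i) A2 /colP /(_ i) A3.
by rewrite !coordE in A1 A2 A3 *; lra.
Qed.

Lemma op_unit S : op e S = S.
Proof. by rewrite /op tri_comm0 tri_base. Qed.

Lemma tri_op S a : tri e S a = op S a.
Proof.
have := tri_comm1 a S e; rewrite -/(op e a) op_unit -/(op a S) -/(op e (tri e S a)) op_unit.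
rewrite (triC a S e) (opC a S) => /colP H; apply/colP => i; have := H i.
by rewrite !coordE; lra.
Qed.

Lemma tri_diag a S : tri a S a = 2 *: op a (op S a) - op S (op a a).
Proof.
have := tri_comm2 a S e; rewrite -!/(op _ _) !op_unit !tri_op => /colP H.
by apply/colP => i; have := H i; rewrite !coordE; lra.
Qed.

Lemma triE a S b : tri a S b = op a (op S b) + op b (op S a) - op S (op a b).
Proof.
have := tri_diag (1 *: a + b) S; rewrite tri_lin1 !tri_lin3 !(op_lin1, op_lin2).
rewrite !tri_diag (triC b S a) (opC b a) => /colP H.
by apply/colP => i; have := H i; rewrite !coordE; lra.
Qed.

(** In terms of multiplication operators, [L_(a^3) = 3 L_a L_(a^2) - 2 L_a^3], an identity valid in
    Jordan algebras. The vanishing of [eta] is drawn from it. *)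
Lemma op_cube a c : 3 *: op a (op c (op a a)) - op c (op a (op a a)) = 2 *: op a (op a (op c a)).
Proof.
have := tri_comm2 a c a; rewrite !tri_op !tri_diag !triE !(op_lin1, op_lin2).
rewrite !(linN (op_lin2 _)) (opC (op c a) (op a a)) => /colP H.
by apply/colP => i; have := H i; rewrite !coordE; lra.
Qed.

(* [f j] is [delta_mx j 0] shifted along the unit so that [op (f j) (f j)] has no component along
   [f j], and [tau] is the linear form with [tau e = 1] that vanishes on all the [f j]. *)
Let s (j : 'I_n.+1) : R := (op (delta_mx j 0) (delta_mx j 0)) j 0 / 2.
Let f (j : 'I_n.+1) : V := delta_mx j 0 - s j *: e.
Let tau (w : V) : R := w 0 0 + \sum_(k | k != 0) s k * w k 0.

Let coord_e (k : 'I_n.+1) : k != 0 -> e k 0 = 0.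
Proof. by move=> k0; rewrite mxE (negPf k0). Qed.

Let coord_e0 : e 0 0 = 1. Proof. by rewrite mxE !eqxx. Qed.

Let op_delta (i j : 'I_n.+1) : i != 0 -> j != 0 ->
  `|op (delta_mx i 0) (delta_mx j 0) + (i == j)%:R *: e| <= e1.
Proof.
move=> i0 j0; have := op_close (delta_mx i 0) (delta_mx j 0).
have -> : (delta_mx i 0 : V) 0 0 = 0 by rewrite mxE eq_sym (negPf i0).
have -> : (delta_mx j 0 : V) 0 0 = 0 by rewrite mxE eq_sym (negPf j0).
rewrite !scale0r addr0 sub0r opprK dot_delta mxE eqxx andbT eq_sym => /le_trans; apply.
rewrite -[leRHS]mulr1; apply: ler_wpM2l => //.
by apply: mulr_ile1 => //; exact: norm_delta_le.
Qed.

Let s_le j : j != 0 -> `|s j| <= e1 / 2.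
Proof.
move=> j0; rewrite /s normrM [`|2^-1|]gtr0_norm ?invr_gt0 // ler_wpM2r ?invr_ge0 //.
apply: le_trans (op_delta j0 j0); rewrite eqxx scale1r.
by have := norm_coord (op (delta_mx j 0) (delta_mx j 0) + e) j; rewrite coordD coord_e ?addr0.
Qed.

Let tau_lin c v w : tau (c *: v + w) = c * tau v + tau w.
Proof.
rewrite /tau !coordE mulrDr addrACA mulr_sumr -big_split; congr (_ + _).
by apply: eq_bigr => k _ /=; rewrite !coordE; ring.
Qed.

Let tau0 : tau 0 = 0.
Proof. by have := tau_lin (-1) 0 0; rewrite scaler0 addr0; lra. Qed.

Let tauZ c v : tau (c *: v) = c * tau v.
Proof. by have := tau_lin c v 0; rewrite addr0 tau0 addr0. Qed.

Let tauD v w : tau (v + w) = tau v + tau w.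
Proof. by have := tau_lin 1 v w; rewrite scale1r mul1r. Qed.

Let tauN v : tau (- v) = - tau v.
Proof. by rewrite -scaleN1r tauZ mulN1r. Qed.

Let tau_e : tau e = 1.
Proof. by rewrite /tau coord_e0 big1 ?addr0 // => k k0; rewrite coord_e // mulr0. Qed.

Let tau_f j : j != 0 -> tau (f j) = 0.
Proof.
move=> j0; rewrite /f tauD tauN tauZ tau_e mulr1 /tau mxE eq_sym (negPf j0) add0r (bigD1 j) //=.
rewrite mxE !eqxx mulr1 big1 ?addr0 ?subrr // => k /andP[_ /negPf kj].
by rewrite mxE kj mulr0.
Qed.

Let tau_close w : `|tau w - w 0 0| <= p * e1 * `|w|.
Proof.
rewrite /tau addrC addKr; apply: le_trans (ler_norm_sum _ _ _) _.
have -> : p * e1 * `|w| = \sum_(k < n.+1) e1 * `|w|.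
  by rewrite sumr_const card_ord -[RHS]mulr_natl mulrA.
rewrite [leRHS](bigID (fun k => k != 0)) /= -[leLHS]addr0; apply: lerD.
  apply: ler_sum => k k0; rewrite normrM; apply: ler_pM => //; last exact: norm_coord.
  by apply: le_trans (s_le k0) _; move: e10; lra.
by apply: sumr_ge0 => k _; rewrite mulr_ge0.
Qed.

Let pe1 : 288 * (p * e1) <= 1.
Proof. by move: pkap; rewrite /kap; lra. Qed.

Let tau_le w : `|tau w| <= 2 * `|w|.
Proof.
have := tau_close w; have := norm_coord w 0; have := pe1; have := normr_ge0 w => H0 H1 H2 H3.
have H4 : 288 * (p * e1) * `|w| <= 1 * `|w| by apply: ler_wpM2r.
by rewrite -(subrK (w 0 0) (tau w)); apply: le_trans (ler_normD _ _) _; lra.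
Qed.

Let decomp a : a = tau a *: e + \sum_(k | k != 0) a k 0 *: f k.
Proof.
have -> : \sum_(k | k != 0) a k 0 *: f k =
   \sum_(k | k != 0) a k 0 *: delta_mx k 0 - (\sum_(k | k != 0) s k * a k 0) *: e.
  rewrite scaler_suml -sumrB; apply: eq_bigr => k _.
  by rewrite /f scalerBr scalerA mulrC.
have Ha : a = a 0 0 *: e + \sum_(k | k != 0) a k 0 *: delta_mx k 0.
  by rewrite {1}(cV_delta a) (bigD1 0).
rewrite {1}Ha /tau; move: (\sum_(k | k != 0) a k 0 *: _) (\sum_(k | k != 0) s k * _) => u x.
by apply/colP => i; rewrite !coordE; ring.
Qed.

(** [eta] is the component of [op] in the kernel of [tau] and [- g] its component along [e]. For the
    conformal fields, on vectors orthogonal to [e], [g] is the scalar product and [eta] is zero. *)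
Let g a b := - tau (op a b).
Let eta a b := op a b + g a b *: e.

Let tau_eta a b : tau (eta a b) = 0.
Proof. by rewrite /eta tauD tauZ tau_e mulr1 /g subrr. Qed.

Let opE a b : op a b = eta a b - g a b *: e.
Proof. by rewrite /eta addrK. Qed.

Let gC a b : g a b = g b a. Proof. by rewrite /g opC. Qed.
Let etaC a b : eta a b = eta b a. Proof. by rewrite /eta opC gC. Qed.

Let g_lin a c v w : g a (c *: v + w) = c * g a v + g a w.
Proof. by rewrite /g op_lin2 tau_lin; ring. Qed.

Let eta_lin a : is_lin (eta a).
Proof.
move=> c v w; rewrite /eta op_lin2 g_lin; apply/colP => i; rewrite !coordE; ring.
Qed.

Let g_sum a (c : 'I_n.+1 -> R) (v : 'I_n.+1 -> V) :
  g a (\sum_(k | k != 0) c k *: v k) = \sum_(k | k != 0) c k * g a (v k).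
Proof.
elim/big_rec2: _ => [|i x y _ <-]; first by rewrite /g (lin0 (op_lin2 a)) tau0 oppr0.
by rewrite g_lin.
Qed.

Let norm_f j : j != 0 -> `|f j| <= 1.
Proof.
move=> j0; apply: norm_le_coord => // i; rewrite /f !coordE !mxE eqxx !andbT.
have := s_le j0; have := e1_small; have [->|ij] := eqVneq i j.
  by rewrite (negPf j0) mulr0 subr0 normr1.
rewrite sub0r normrN; case: (i == 0); rewrite ?mulr1 ?mulr0 ?normr0 //; move: e10; lra.
Qed.

Let op_f i j : i != 0 -> j != 0 -> op (f i) (f j) =
  op (delta_mx i 0) (delta_mx j 0) - s i *: delta_mx j 0 - s j *: delta_mx i 0 + (s i * s j) *: e.
Proof.
move=> i0 j0; have fE k : f k = (- s k) *: e + delta_mx k 0 by rewrite /f scaleNr addrC.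
rewrite !fE op_lin1 !op_lin2 op_unit [op (delta_mx i 0) e]opC !op_unit.
by apply/colP => k; rewrite !coordE; ring.
Qed.

Let op_f_close i j : i != 0 -> j != 0 -> `|op (f i) (f j) + (i == j)%:R *: e| <= 3 * e1.
Proof.
move=> i0 j0; rewrite op_f //.
have -> : op (delta_mx i 0) (delta_mx j 0) - s i *: delta_mx j 0 - s j *: delta_mx i 0
     + (s i * s j) *: e + (i == j)%:R *: e =
   (op (delta_mx i 0) (delta_mx j 0) + (i == j)%:R *: e) - s i *: delta_mx j 0
     - s j *: delta_mx i 0 + (s i * s j) *: e.
  by apply/colP => k; rewrite !coordE; ring.
have si := s_le i0; have sj := s_le j0.
have sij : `|s i * s j| <= e1 / 2 * 1.
  rewrite normrM; apply: ler_pM => //; apply: le_trans sj _.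
  by move: e1_small e10; lra.
have := normD_le (normB_le (normB_le (op_delta i0 j0) (normZ_le si (norm_delta_le j)))
   (normZ_le sj (norm_delta_le i))) (normZ_le sij normE).
by move/le_trans; apply; move: e10; lra.
Qed.

Let g_f i j : i != 0 -> j != 0 -> `|g (f i) (f j) - (i == j)%:R| <= kap.
Proof.
move=> i0 j0; have := tau_le (op (f i) (f j) + (i == j)%:R *: e).
rewrite tauD tauZ tau_e mulr1 /g -opprD normrN => /le_trans; apply.
by have := op_f_close i0 j0; rewrite /kap; move: e10; lra.
Qed.

Let eta_f_init i j : i != 0 -> j != 0 -> `|eta (f i) (f j)| <= kap.
Proof.
move=> i0 j0; set u := op (f i) (f j) + (i == j)%:R *: e.
have -> : eta (f i) (f j) = u - tau u *: e.
  rewrite /u tauD tauZ tau_e mulr1 /eta /g; apply/colP => k; rewrite !coordE; ring.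
have H := op_f_close i0 j0; have T := tau_le u.
have T' : `|tau u| <= 6 * e1 by apply: le_trans T _; move: H; rewrite -/u; lra.
by apply: le_trans (normB_le H (normZ_le T' normE)) _; rewrite /kap; lra.
Qed.

Let eta_f_diag j : j != 0 -> (eta (f j) (f j)) j 0 = 0.
Proof.
move=> j0; have sE : (op (delta_mx j 0) (delta_mx j 0)) j 0 = 2 * s j by rewrite /s; field.
have dE : (delta_mx j 0 : V) j 0 = 1 by rewrite mxE !eqxx.
by rewrite /eta op_f // !coordE coord_e // dE sE; ring.
Qed.

(** By [decomp] the [f k] with [k != 0] span the kernel of [tau]; expanding each of the two
    arguments costs a factor [p]. *)
Let eta_bound X : 0 <= X -> (forall i j, i != 0 -> j != 0 -> `|eta (f i) (f j)| <= X) ->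
  forall a b, tau a = 0 -> tau b = 0 -> `|eta a b| <= p ^+ 2 * X * (`|a| * `|b|).
Proof.
move=> X0 HX a b ta tb.
have sumle (c : R) (F : 'I_n.+1 -> V) : 0 <= c -> (forall k, k != 0 -> `|F k| <= c) ->
    `|\sum_(k | k != 0) F k| <= p * c.
  move=> c0 HF; apply: le_trans (ler_norm_sum _ _ _) _.
  have -> : p * c = \sum_(k < n.+1) c by rewrite sumr_const card_ord mulr_natl.
  rewrite [leRHS](bigID (fun k => k != 0)) /= -[leLHS]addr0; apply: lerD; first exact: ler_sum.
  exact: sumr_ge0.
have fb i : i != 0 -> `|eta (f i) b| <= p * (`|b| * X).
  move=> i0; rewrite [b in leLHS]decomp tb scale0r add0r (lin_sum (eta_lin _)).
  apply: sumle => [|k k0]; first exact: mulr_ge0.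
  by apply: normZ_le; [exact: norm_coord|exact: HX].
rewrite [a in leLHS]decomp ta scale0r add0r etaC (lin_sum (eta_lin _)).
have -> : p ^+ 2 * X * (`|a| * `|b|) = p * (`|a| * (p * (`|b| * X))) by ring.
apply: sumle => [|k k0]; first by rewrite !mulr_ge0 // ltW.
by apply: normZ_le; [exact: norm_coord|rewrite etaC; exact: fb].
Qed.

Let g_f_close i w : i != 0 -> tau w = 0 -> `|g (f i) w - w i 0| <= p * kap * `|w|.
Proof.
move=> i0 tw.
have -> : g (f i) w - w i 0 = \sum_(k | k != 0) w k 0 * (g (f i) (f k) - (i == k)%:R).
  rewrite [w in LHS]decomp tw scale0r add0r g_sum.
  under [RHS]eq_bigr do rewrite mulrBr.
  rewrite sumrB; congr (_ - _).
  rewrite summxE; apply: eq_bigr => k k0.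
  by rewrite /f !coordE coord_e // mulr0 subr0 mxE eqxx andbT.
apply: le_trans (ler_norm_sum _ _ _) _.
have -> : p * kap * `|w| = \sum_(k < n.+1) `|w| * kap.
  by rewrite sumr_const card_ord -[RHS]mulr_natl; ring.
rewrite [leRHS](bigID (fun k => k != 0)) /= -[leLHS]addr0; apply: lerD.
  apply: ler_sum => k k0; rewrite normrM; apply: ler_pM => //; first exact: norm_coord.
  exact: g_f.
by apply: sumr_ge0 => k _; rewrite mulr_ge0.
Qed.

Let op_sub a b (t : R) : op a (b - t *: e) = op a b - t *: a.
Proof. by rewrite (linD (op_lin2 a)) (linN (op_lin2 a)) (linZ (op_lin2 a)) [op a e]opC op_unit. Qed.

Let eta_cube a c (h := eta a a) (h' := eta a c) (k : 'I_n.+1) : k != 0 ->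
  2 * g a a * h' k 0 + 3 * g c h * a k 0 - g a h * c k 0 - 2 * g a c * h k 0 - 2 * g a h' * a k 0
  = 3 * (eta a (eta c h)) k 0 - (eta c (eta a h)) k 0 - 2 * (eta a (eta a h')) k 0.
Proof.
move=> k0.
(* The [e]-component of each inner product is split off, and [op] acts on it as on a unit; terms
   along [e] disappear in the coordinates [k != 0]. *)
have X1 : op a (op c (op a a)) = eta a (eta c h) - g c h *: a - g a a *: h'
    + (g a a * g a c - g a (eta c h)) *: e.
  rewrite (opE a a) op_sub (opE c h) -addrA -opprD addrC.
  have -> : - (g c h *: e + g a a *: c) + eta c h = - (g a a *: c) + eta c h - g c h *: e.
    by apply/colP => i; rewrite !coordE; ring.
  rewrite op_sub (linD (op_lin2 a)) (linN (op_lin2 a)) (linZ (op_lin2 a)).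
  rewrite (opE a c) (opE a (eta c h)) -/h'.
  by apply/colP => i; rewrite !coordE; ring.
have X2 : op c (op a (op a a)) = eta c (eta a h) - g a h *: c - g a a *: h'
    + (g a a * g a c - g c (eta a h)) *: e.
  rewrite (opE a a) op_sub (opE a h).
  have -> : eta a h - g a h *: e - g a a *: a = - (g a a *: a) + eta a h - g a h *: e.
    by apply/colP => i; rewrite !coordE; ring.
  rewrite op_sub (linD (op_lin2 c)) (linN (op_lin2 c)) (linZ (op_lin2 c)).
  rewrite (opC c a) (opE a c) (opE c (eta a h)) -/h'.
  by apply/colP => i; rewrite !coordE; ring.
have X3 : op a (op a (op c a)) = eta a (eta a h') - g a h' *: a - g a c *: h
    + (g a c * g a a - g a (eta a h')) *: e.
  rewrite (opC c a) (opE a c) op_sub (opE a h') -/h'.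
  have -> : eta a h' - g a h' *: e - g a c *: a = - (g a c *: a) + eta a h' - g a h' *: e.
    by apply/colP => i; rewrite !coordE; ring.
  rewrite op_sub (linD (op_lin2 a)) (linN (op_lin2 a)) (linZ (op_lin2 a)).
  rewrite (opE a a) (opE a (eta a h')) -/h.
  by apply/colP => i; rewrite !coordE; ring.
have := op_cube a c; rewrite X1 X2 X3 => /colP /(_ k).
rewrite !coordE coord_e //; lra.
Qed.

(* [eta], the obstruction to [op] being a spin factor, satisfies [eta_cube], whose right-hand side is
   of higher order in [eta]; hence a bound on [eta] improves itself, and [eta] vanishes. *)
Let eta_f_contract X : 0 <= X -> X <= kap ->
  (forall i j, i != 0 -> j != 0 -> `|eta (f i) (f j)| <= X) ->
  (forall i j, i != 0 -> j != 0 -> `|eta (f i) (f j)| <= X / 2).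
Proof.
move=> X0 Xk HX.
have X32 : 32 * (p * kap * X) <= X by rewrite mulrA -[leRHS]mul1r; apply: ler_wpM2r.
have kX32 : 32 * (kap * X) <= X by rewrite mulrA -[leRHS]mul1r; apply: ler_wpM2r.
have X1 : X <= 1 by move: kap_small kap0; lra.
have q0 : 0 <= p ^+ 2 by rewrite exprn_ge0 // ltW.
have eb1 a b : tau a = 0 -> tau b = 0 -> `|a| <= 1 -> `|eta a b| <= p ^+ 2 * X * `|b|.
  move=> ta tb a1; apply: le_trans (eta_bound X0 HX ta tb) _.
  by apply: ler_wpM2l; [exact: mulr_ge0|rewrite ler_piMl].
have cub a c d : tau a = 0 -> tau c = 0 -> `|a| <= 1 -> `|c| <= 1 -> tau d = 0 -> `|d| <= X ->
    32 * `|eta a (eta c d)| <= X.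
  move=> ta tc a1 c1 td dX.
  have H1 : `|eta c d| <= p ^+ 2 * X * X.
    by apply: le_trans (eb1 _ _ tc td c1) _; apply: ler_wpM2l => //; exact: mulr_ge0.
  have H2 : `|eta a (eta c d)| <= p ^+ 2 * X * (p ^+ 2 * X * X).
    by apply: le_trans (eb1 _ _ ta (tau_eta _ _) a1) _; apply: ler_wpM2l => //; exact: mulr_ge0.
  have H3 : p ^+ 2 * X * (p ^+ 2 * X * X) <= p ^+ 4 * kap * X.
    have -> : p ^+ 2 * X * (p ^+ 2 * X * X) = p ^+ 4 * (X * X) * X by ring.
    apply: ler_wpM2r => //; apply: ler_wpM2l; first by rewrite exprn_ge0 // ltW.
    by rewrite -[leRHS]mulr1; apply: ler_pM.
  have : 32 * (p ^+ 4 * kap * X) <= X.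
    have -> : 32 * (p ^+ 4 * kap * X) = 32 * p ^+ 4 * kap * X by ring.
    by rewrite -[leRHS]mul1r; apply: ler_wpM2r.
  lra.
(* [eta_cube] with [a = f i] and [c = f j], where [g] is nearly the scalar product. In a coordinate
   [k != i] the left side is about [2 h' k], the term in [g a h] being small because [h i = 0]; in
   the coordinate [i] the two contributions of [h' i] cancel and about [3 h j] remains. *)
have key i j k : i != 0 -> j != 0 -> i != j -> k != 0 ->
    (k != i -> `|(eta (f i) (f j)) k 0| <= X / 4) /\ `|(eta (f i) (f i)) j 0| <= X / 4.
  move=> i0 j0 ij k0; have := @eta_cube (f i) (f j).
  set a := f i; set c := f j; set h := eta a a; set h' := eta a c => H.
  have [ta tc] : tau a = 0 /\ tau c = 0 by split; exact: tau_f.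
  have [na nc] : `|a| <= 1 /\ `|c| <= 1 by split; exact: norm_f.
  have th : tau h = 0 by exact: tau_eta.
  have th' : tau h' = 0 by exact: tau_eta.
  have nh : `|h| <= X by exact: HX.
  have nh' : `|h'| <= X by exact: HX.
  have hi : h i 0 = 0 by exact: eta_f_diag.
  have coordf l m : m != 0 -> (f l) m 0 = (m == l)%:R.
    by move=> m0; rewrite /f !coordE coord_e // mulr0 subr0 mxE eqxx andbT.
  have gsmall l w : l != 0 -> tau w = 0 -> `|w| <= X -> 32 * `|g (f l) w - w l 0| <= X.
    move=> l0 tw wX; have := g_f_close l0 tw.
    have : p * kap * `|w| <= p * kap * X by apply: ler_wpM2l => //; rewrite mulr_ge0 // ltW.
    lra.
  have prod (x y : R) : `|x| <= kap -> `|y| <= X -> 32 * `|x * y| <= X.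
    move=> xk yX; have : `|x * y| <= kap * X by rewrite normrM; apply: ler_pM.
    lra.
  have g1 : `|g a a - 1| <= kap by have := g_f i0 i0; rewrite eqxx.
  have g2 : `|g a c| <= kap by have := g_f i0 j0; rewrite (negPf ij) subr0.
  have g3 := gsmall i h i0 th nh; rewrite -/a hi subr0 in g3.
  have g4 := gsmall j h j0 th nh; rewrite -/c in g4.
  have g5 := gsmall i h' i0 th' nh'; rewrite -/a in g5.
  have cb (u : V) (m : 'I_n.+1) : 32 * `|u| <= X -> 32 * `|u m 0| <= X.
    by apply: le_trans; apply: ler_wpM2l => //; exact: norm_coord.
  have c1 m := cb _ m (cub _ _ _ ta tc na nc th nh).
  have c2 m := cb _ m (cub _ _ _ tc ta nc na th nh).
  have c3 m := cb _ m (cub _ _ _ ta ta na na th' nh').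
  have p1' m : 32 * `|(g a a - 1) * h' m 0| <= X.
    by apply: prod => //; apply: le_trans nh'; exact: norm_coord.
  have p2 m : 32 * `|g a c * h m 0| <= X.
    by apply: prod => //; apply: le_trans nh; exact: norm_coord.
  split.
    move=> ki; have := H _ k0; rewrite /a /c !coordf // (negPf ki) -/a -/c => E.
    exact: off_diagonal_estimate E (c1 k) (c2 k) (c3 k) (p1' k) (p2 k) g3.
  have := H _ i0; rewrite /a /c !coordf // eqxx (negPf ij) -/a -/c => E.
  exact: diagonal_estimate E (c1 i) (c2 i) (c3 i) (p1' i) (p2 i) g4 g5.
move=> i j i0 j0.
have main k : k != 0 -> `|(eta (f i) (f j)) k 0| <= X / 4.
  move=> k0; have [ij|ij] := eqVneq i j.
    rewrite -ij; have [->|ki] := eqVneq k i.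
      by rewrite eta_f_diag // normr0 divr_ge0.
    by have [] := key i k k i0 k0 _ k0; rewrite // eq_sym.
  (* The coordinate [i] of [eta (f i) (f j)] is reached by exchanging [i] and [j]. *)
  have [ki|ki] := eqVneq k i.
    rewrite etaC ki; have [] := key j i i j0 i0 _ i0; first by rewrite eq_sym.
    by move=> H _; exact: H.
  by have [H _] := key i j k i0 j0 ij k0; exact: H.
apply: norm_le_coord => [|k]; first by rewrite divr_ge0.
have [->|k0] := eqVneq k 0; last by apply: le_trans (main k k0) _; move: X0; lra.
(* [eta_cube] says nothing about the coordinate 0; it is recovered from the vanishing of [tau] on
   [eta], whose coefficients [s] are small. *)
have := tau_eta (f i) (f j); rewrite {1}/tau => /eqP; rewrite addr_eq0 => /eqP ->.
rewrite normrN; apply: le_trans (ler_norm_sum _ _ _) _.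
apply: (@le_trans _ _ (\sum_(m < n.+1) e1 * (X / 4))).
  rewrite [leRHS](bigID (fun m => m != 0)) /= -[leLHS]addr0; apply: lerD.
    apply: ler_sum => m m0; rewrite normrM; apply: ler_pM => //; last exact: main.
    by apply: le_trans (s_le m0) _; move: e10; lra.
  by apply: sumr_ge0 => m _; rewrite mulr_ge0 // divr_ge0.
rewrite sumr_const card_ord -[leLHS]mulr_natl.
have : 288 * (p * e1) * (X / 4) <= 1 * (X / 4) by apply: ler_wpM2r; rewrite ?divr_ge0.
by move: X0; lra.
Qed.

Let eta_f0 i j : i != 0 -> j != 0 -> eta (f i) (f j) = 0.
Proof.
have all m : forall i j, i != 0 -> j != 0 -> `|eta (f i) (f j)| <= kap / 2 ^+ m.
  elim: m => [|m IH] a b a0 b0; first by rewrite expr0 divr1; exact: eta_f_init.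
  have -> : kap / 2 ^+ m.+1 = (kap / 2 ^+ m) / 2 by rewrite exprSr invfM mulrA.
  apply: eta_f_contract => //; first by rewrite divr_ge0 // exprn_ge0.
  by rewrite ler_pdivrMr ?exprn_gt0 // ler_peMr // exprn_ege1 // ler1n.
move=> i0 j0; apply/eqP; rewrite -normr_le0; apply: (@theta_limit _ _ _ kap) => m.
rewrite add0r; apply: le_trans (all m _ _ i0 j0) _; apply: ler_wpM2l => //.
rewrite -exprVn; apply: lerXn2r; rewrite ?nnegrE ?invr_ge0 // ?(ltW (theta_gt0)) //.
by rewrite /theta; lra.
Qed.

Let eta0 a b : tau a = 0 -> tau b = 0 -> eta a b = 0.
Proof.
move=> ta tb; have H := @eta_bound 0 (lexx _) _ a b ta tb.
apply/eqP; rewrite -normr_le0; apply: le_trans (H _) _; last by rewrite mulr0 mul0r.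
by move=> i j i0 j0; rewrite eta_f0 // normr0.
Qed.

(** The symmetric form of the spin factor, forced by applying [tau] to both sides of
    [spin_factor]. *)
Let G a b : R := 2 * tau a * tau b - tau (op a b).

Let spin_factor a b : op a b = tau a *: b + tau b *: a - G a b *: e.
Proof.
pose a' := a - tau a *: e; pose b' := b - tau b *: e.
have ta : tau a' = 0 by rewrite /a' tauD tauN tauZ tau_e mulr1 subrr.
have tb : tau b' = 0 by rewrite /b' tauD tauN tauZ tau_e mulr1 subrr.
have E : op a' b' = op a b - tau b *: a - tau a *: b + (tau a * tau b) *: e.
  rewrite /b' op_sub opC op_sub.
  by rewrite [op b a]opC /a'; apply/colP => i; rewrite !coordE; ring.
have := opE a' b'; rewrite eta0 // sub0r E => /colP H.
have : tau (op a' b') = - g a' b' by rewrite /g opprK.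
rewrite E !tauD !tauN !tauZ tau_e => Ht.
by apply/colP => i; have := H i; rewrite !coordE /G; move: Ht => /=; nra.
Qed.

Let GC a b : G a b = G b a.
Proof. by rewrite /G opC; ring. Qed.

Let G_lin a c v w : G a (c *: v + w) = c * G a v + G a w.
Proof. by rewrite /G op_lin2 !tau_lin; ring. Qed.

Let G_sum a v : G a v = \sum_i v i 0 * G a (delta_mx i 0).
Proof.
rewrite {1}(cV_delta v); elim/big_rec2: _ => [|i x y _ <-]; last by rewrite G_lin.
by rewrite /G (lin0 (op_lin2 a)) tau0; ring.
Qed.

Let Ge x : G e x = tau x.
Proof. by rewrite /G op_unit tau_e; ring. Qed.

(** An error of half of [|x| ^ 2], which is at most [dot x x], lets [G] inherit positivity from
    [dot]. *)
Let G_close x : `|G x x - dot x x| <= 2^-1 * `|x| ^+ 2.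
Proof.
set w := op x x - (x 0 0 *: x + x 0 0 *: x - dot x x *: e).
have tw : tau (op x x) = tau w + 2 * x 0 0 * tau x - dot x x.
  by rewrite /w !(tauD, tauN, tauZ) tau_e; ring.
have -> : G x x - dot x x = 2 * tau x * (tau x - x 0 0) - tau w.
  by rewrite /G tw; ring.
have w1 : `|w| <= e1 * (`|x| * `|x|) by exact: op_close.
have t1 := tau_le w; have t2 := tau_le x; have t3 := tau_close x.
apply: le_trans (ler_normB _ _) _.
have H : `|2 * tau x * (tau x - x 0 0)| <= 2 * (2 * `|x|) * (p * e1 * `|x|).
  by rewrite normrM; apply: ler_pM => //; rewrite normrM ger0_norm //; apply: ler_wpM2l.
have X0 : 0 <= `|x| ^+ 2 by rewrite exprn_ge0.
have P1 : 288 * (p * e1) * `|x| ^+ 2 <= 1 * `|x| ^+ 2 by exact: ler_wpM2r.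
have P2 : 288 * e1 * `|x| ^+ 2 <= 1 * `|x| ^+ 2 by exact: ler_wpM2r.
apply: le_trans (lerD H t1) _; rewrite expr2 in X0 P1 P2 *; lra.
Qed.

Let G_pos x : x != 0 -> 0 < G x x.
Proof.
move=> x0; have := G_close x; have := norm2_le_dot x.
have : 0 < `|x| ^+ 2 by rewrite exprn_gt0 // normr_gt0.
rewrite ler_norml; move: (`|x| ^+ 2) (dot x x) => u d; lra.
Qed.

(** The right side is the conformal field, for the form [G], of the vector [T - 2 tau T e]. As
    [G e T = tau T], this vector is the [G]-reflection of [T] along [e]. *)
Let tri_spin x T : tri x T x =
  G x x *: (T - (2 * tau T) *: e) - (2 * G x (T - (2 * tau T) *: e)) *: x.
Proof.
have GT : G x (T - (2 * tau T) *: e) = G T x - 2 * tau T * tau x.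
  have -> : T - (2 * tau T) *: e = (- (2 * tau T)) *: e + T by rewrite scaleNr addrC.
  by rewrite G_lin (GC x e) Ge (GC x T); ring.
have E1 : op x (op T x) = tau T *: op x x + tau x *: op T x - G T x *: x.
  by rewrite {1}(spin_factor T x) op_sub op_lin2 (linZ (op_lin2 x)) [op x T]opC.
have E2 : op T (op x x) = tau x *: op T x + tau x *: op T x - G x x *: T.
  by rewrite {1}(spin_factor x x) op_sub op_lin2 (linZ (op_lin2 T)).
rewrite tri_diag GT E1 E2 (spin_factor T x) (spin_factor x x).
by apply/colP => i; rewrite !coordE; ring.
Qed.

Theorem commuting_fields_rigidity : exists N C : 'M[R]_n.+1,
  [/\ N \in unitmx, C \in unitmx &
    forall v x, N *m Q v x x = inv_field (C *m v) (N *m x) (N *m x)].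
Proof.
pose Pm : 'M[R]_n.+1 := \matrix_(i, j) G (delta_mx i 0) (delta_mx j 0).
have PmE x y : dot x (Pm *m y) = G x y.
  rewrite GC G_sum; apply: eq_bigr => i _; congr (_ * _).
  rewrite GC G_sum mxE; apply: eq_bigr => j _; by rewrite mxE mulrC.
(* A Cholesky factor of the Gram matrix of [G] is the linear change of variables that turns [G] into
   the standard scalar product. *)
have [N uN PN] : exists2 N : 'M[R]_n.+1, N \in unitmx & Pm = N^T *m N.
  apply: cholesky; first by apply/matrixP => i j; rewrite !mxE GC.
  by move=> x x0; rewrite PmE G_pos.
have GN x y : G x y = dot (N *m x) (N *m y).
  have dotE (u v : V) : dot u v = (u^T *m v) 0 0.
    by rewrite mxE; apply: eq_bigr => i _; rewrite mxE.
  by rewrite -PmE PN !dotE trmx_mul !mulmxA.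
pose F (v : V) : V := base_mx *m v - (2 * tau (base_mx *m v)) *: e.
have lF : is_lin (fun v => N *m F v).
  move=> c v w; have -> : F (c *: v + w) = c *: F v + F w.
    rewrite /F mulmxDr -scalemxAr tau_lin.
    by apply/colP => i; rewrite !coordE; ring.
  by rewrite mulmxDr -scalemxAr.
have [C CE] := lin_mulmx lF.
exists N, C; split=> //.
  apply: unitmx_inj => v; rewrite CE => Nv0.
  have /eqP Fv0 : F v = 0 by rewrite -(mulKmx uN (F v)) Nv0 mulmx0.
  move: Fv0; rewrite subr_eq0 => /eqP Bv.
  (* Applying [tau] to the equation [Bv] shows that this number equals its double. *)
  have tB : tau (base_mx *m v) = 0.
    by have := congr1 tau Bv; rewrite tauZ tau_e mulr1; lra.
  by rewrite -(mulKmx base_mx_unit v) Bv tB mulr0 scale0r mulmx0.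
move=> v x; have -> : Q v x x = tri x (base_mx *m v) x by rewrite /tri /P mulKmx // base_mx_unit.
rewrite tri_spin -/(F v) CE !GN /inv_field (mulmxBr N) -!scalemxAr.
by apply/colP => i; rewrite !coordE; ring.
Qed.

End CommutingQuadraticFields.

(** * Second-order jets of germs *)

Section BilinearJets.
Context {R : realType}.

Lemma bil_bound n m (c : 'I_n -> 'I_n -> 'cV[R]_m) :
  exists2 K, 0 <= K & forall x y, `|bil c x y| <= K * (`|x| * `|y|).
Proof.
exists (\sum_i \sum_j `|c i j|); first by do 2!apply: sumr_ge0 => ? _.
move=> x y; rewrite mulr_suml; apply: le_trans (ler_norm_sum _ _ _) _.
apply: ler_sum => i _; rewrite mulr_suml; apply: le_trans (ler_norm_sum _ _ _) _.
apply: ler_sum => j _; rewrite normrZ mulrC; apply: ler_wpM2l => //.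
by rewrite normrM; apply: ler_pM => //; exact: norm_coord.
Qed.

Lemma bil_lin1 n m (c : 'I_n -> 'I_n -> 'cV[R]_m) y : is_lin (fun x => bil c x y).
Proof.
move=> t v w; rewrite /bil scaler_sumr -big_split; apply: eq_bigr => i _.
rewrite scaler_sumr -big_split; apply: eq_bigr => j _ /=.
by rewrite scalerA -scalerDl !coordE; congr (_ *: _); ring.
Qed.

Lemma bil_lin2 n m (c : 'I_n -> 'I_n -> 'cV[R]_m) x : is_lin (bil c x).
Proof.
move=> t v w; rewrite /bil scaler_sumr -big_split; apply: eq_bigr => i _.
rewrite scaler_sumr -big_split; apply: eq_bigr => j _ /=.
by rewrite scalerA -scalerDl !coordE; congr (_ *: _); ring.
Qed.

Lemma bil_sym n m (c : 'I_n -> 'I_n -> 'cV[R]_m) x y : (forall i j, c i j = c j i) ->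
  bil c x y = bil c y x.
Proof.
move=> cs; rewrite /bil exchange_big; apply: eq_bigr => i _; apply: eq_bigr => j _.
by rewrite mulrC cs.
Qed.

Lemma bilP n m (F : 'cV[R]_n -> 'cV[R]_n -> 'cV[R]_m) :
  (forall y, is_lin (fun x => F x y)) -> (forall x, is_lin (F x)) ->
  forall x y, F x y = bil (fun i j => F (delta_mx i 0) (delta_mx j 0)) x y.
Proof.
move=> F1 F2 x y; rewrite (lin_delta (F1 y)); apply: eq_bigr => i _.
rewrite (lin_delta (F2 _)) scaler_sumr; apply: eq_bigr => j _.
by rewrite scalerA.
Qed.

Lemma bil_polar n m (F G : 'cV[R]_n -> 'cV[R]_n -> 'cV[R]_m) :
  (forall x, is_lin (F x)) -> (forall x, is_lin (G x)) ->
  (forall x y, F x y = F y x) -> (forall x y, G x y = G y x) ->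
  (forall x, F x x = G x x) -> forall x y, F x y = G x y.
Proof.
move=> F2 G2 Fs Gs E x y; have := E (1 *: x + y).
rewrite !(F2, G2) !(Fs (1 *: x + y)) !(Gs (1 *: x + y)) !(F2, G2) !E (Fs y x) (Gs y x).
by move=> /colP H; apply/colP => i; have := H i; rewrite !coordE; lra.
Qed.

Lemma isO_bil p q n m l (c : 'I_m -> 'I_m -> 'cV[R]_l) (u w : 'cV[R]_n -> 'cV[R]_m) :
  isO p u -> isO q w -> isO (p + q) (fun x => bil c (u x) (w x)).
Proof.
move=> [C C0 HC] [D D0 HD]; have [K K0 HK] := bil_bound c.
exists (K * (C * D)); first by rewrite !mulr_ge0.
apply: filterS2 HC HD => x Hu Hw; apply: le_trans (HK _ _) _.
rewrite -[leRHS]mulrA; apply: ler_wpM2l => //; rewrite exprD mulrACA.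
exact: ler_pM.
Qed.

Lemma bil_diff n m l (c : 'I_m -> 'I_m -> 'cV[R]_l) (u w : 'cV[R]_n -> 'cV[R]_m) :
  isO 1 u -> isO 1 w -> isO 2 (fun x => u x - w x) ->
  isO 3 (fun x => bil c (u x) (u x) - bil c (w x) (w x)).
Proof.
move=> u1 w1 uw2.
have := isOD (isO_bil (p := 2) (q := 1) c uw2 u1) (isO_bil (p := 1) (q := 2) c w1 uw2).
apply: isO_ext => x.
rewrite (linD (bil_lin1 c _)) (linN (bil_lin1 c _)) (linD (bil_lin2 c _)) (linN (bil_lin2 c _)).
by apply/colP => i; rewrite !coordE; ring.
Qed.

(** [c] includes the factor [1 / 2] of Taylor's formula, and [f] determines only the quadratic form
    [bil c x x]. *)
Definition jet2 n m (f : 'cV[R]_n -> 'cV[R]_m) (L : 'M[R]_(m, n)) (c : 'I_n -> 'I_n -> 'cV[R]_m) :=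
  isO 3 (fun x => f x - L *m x - bil c x x).

Lemma isO_mulmx_id n m (L : 'M[R]_(m, n)) : isO 1 (fun x : 'cV[R]_n => L *m x).
Proof. by apply: isO_mulmx; exact: isO_id. Qed.

Lemma isO_bil_id n m (c : 'I_n -> 'I_n -> 'cV[R]_m) : isO 2 (fun x => bil c x x).
Proof. exact: (isO_bil (p := 1) (q := 1) c (isO_id _) (isO_id _)). Qed.

Lemma jet2_isO2 n m (f : 'cV[R]_n -> 'cV[R]_m) L c : jet2 f L c -> isO 2 (fun x => f x - L *m x).
Proof.
move=> Hf; have := isOD (isO_le (p := 2) (leqnSn 2) Hf) (isO_bil_id c).
by apply: isO_ext => x; rewrite subrK.
Qed.

Lemma isO2_isO1 n m (f : 'cV[R]_n -> 'cV[R]_m) (L : 'M[R]_(m, n)) :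
  isO 2 (fun x => f x - L *m x) -> isO 1 f.
Proof.
move=> Hf; have := isOD (isO_le (p := 1) (leqnSn 1) Hf) (isO_mulmx_id L).
by apply: isO_ext => x; rewrite subrK.
Qed.

Lemma jet2_isO1 n m (f : 'cV[R]_n -> 'cV[R]_m) L c : jet2 f L c -> isO 1 f.
Proof. by move/jet2_isO2/isO2_isO1. Qed.

Lemma linear_isO2 n m (L : 'M[R]_(m, n)) : isO 2 (fun x : 'cV[R]_n => L *m x) -> L = 0.
Proof.
move=> H; have Z := @isO_homog _ 1 n _ (mulmx L : 'cV[R]_n -> 'cV[R]_m) _ H.
apply/matrixP => i j; have := Z _ (delta_mx j 0) => /(_ _)/colP/(_ i).
rewrite -colE !mxE; apply => t x; by rewrite -scalemxAr expr1.
Qed.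

Lemma jet1_comp n m l (f : 'cV[R]_m -> 'cV[R]_l) (g : 'cV[R]_n -> 'cV[R]_m) F G :
  isO 2 (fun x => f x - F *m x) -> isO 2 (fun x => g x - G *m x) ->
  isO 2 (fun x => f (g x) - F *m G *m x).
Proof.
move=> Hf Hg; have := isOD (isO_comp Hf (isO2_isO1 Hg)) (isO_mulmx F Hg).
by apply: isO_ext => x /=; rewrite mulmxBr mulmxA subrKA.
Qed.

Lemma jet1_iter n (f : 'cV[R]_n.+1 -> 'cV[R]_n.+1) F k :
  isO 2 (fun x => f x - F *m x) -> isO 2 (fun x => iter k f x - (F ^+ k) *m x).
Proof.
move=> Hf; elim: k => [|k IH].
  by apply: isO_ext (isO0 _ _ _) => x; rewrite expr0 mul1mx subrr.
by rewrite exprS; exact: jet1_comp Hf IH.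
Qed.

Lemma jet2_uniq n m (f : 'cV[R]_n -> 'cV[R]_m) L c L' c' :
  jet2 f L c -> jet2 f L' c' -> L = L' /\ forall x, bil c x x = bil c' x x.
Proof.
move=> H H'.
have LL : L = L'.
  apply/subr0_eq; apply: linear_isO2.
  have := isOB (jet2_isO2 H') (jet2_isO2 H); apply: isO_ext => x.
  by rewrite mulmxBl; apply/colP => i; rewrite !coordE; ring.
split=> // x; apply/subr0_eq; move: x.
apply: (@isO_homog _ 2 _ _ (fun x => bil c x x - bil c' x x)).
  move=> t x; rewrite !(linZ (bil_lin1 _ _)) !(linZ (bil_lin2 _ _)) !scalerA -expr2 scalerBr.
  by [].
have := isOB H' H; apply: isO_ext => x; rewrite LL.
by apply/colP => i; rewrite !coordE; ring.
Qed.

Lemma bilZ_homog n m (c : 'I_n -> 'I_n -> 'cV[R]_m) t x : bil c (t *: x) (t *: x) = t ^+ 2 *: bil c x x.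
Proof. by rewrite (linZ (bil_lin1 _ _)) (linZ (bil_lin2 _ _)) scalerA -expr2. Qed.

(* Quadratic part of [a b = b ^ k a] when [b] is tangent to the identity. *)
Lemma jet2_relation n (A b : 'cV[R]_n -> 'cV[R]_n) L q c k :
  jet2 A L q -> jet2 b 1%:M c ->
  (\forall x \near (0 : 'cV[R]_n), A (b x) = iter k b (A x)) ->
  forall x, L *m bil c x x = k%:R *: bil c (L *m x) (L *m x).
Proof.
move=> HA Hb rel.
have b1 := jet2_isO1 Hb; have A1 := jet2_isO1 HA.
have b2 : isO 2 (fun x => b x - x).
  by apply: isO_ext (jet2_isO2 Hb) => x; rewrite mul1mx.
(* Germs tangent to the identity add their quadratic parts under composition, so [b ^ j] has
   quadratic part [j c]. *)
have it j : isO 3 (fun x => iter j b x - x - j%:R *: bil c x x).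
  elim: j => [|j IH].
    by apply: isO_ext (isO0 _ _ _) => x; rewrite subrr scale0r subr0.
  have j2 : isO 2 (fun x => iter j b x - x).
    have := isOD (isO_le (p := 2) (leqnSn 2) IH) (isO_scale j%:R (isO_bil_id c)).
    by apply: isO_ext => x; rewrite subrK.
  have j1 : isO 1 (iter j b).
    have := isOD (isO_le (p := 1) (leqnSn 1) j2) (isO_id n).
    by apply: isO_ext => x; rewrite subrK.
  have := isOD IH (isOD (isO_comp Hb j1) (bil_diff c j1 (isO_id n) j2)).
  apply: isO_ext => x /=; rewrite mul1mx -natr1 scalerDl scale1r.
  by apply/colP => i; rewrite !coordE; ring.
move=> x; apply/subr0_eq; move: x.
apply: (@isO_homog _ 2 _ _ (fun x => L *m bil c x x - k%:R *: bil c (L *m x) (L *m x))).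
  by move=> t x; rewrite -scalemxAr !bilZ_homog -scalemxAr scalerBr !scalerA [t ^+ 2 * _]mulrC.
have T1 : isO 3 (fun x => L *m (b x - 1%:M *m x - bil c x x)) by exact: isO_mulmx.
have T2 := isO_comp HA b1.
have T3 := bil_diff q b1 (isO_id n) b2.
have T4 := isO_comp (it k) A1.
have T5 := isO_scale k%:R (bil_diff c A1 (isO_mulmx_id L) (jet2_isO2 HA)).
have := isOB (isOD T4 T5) (isOD (isOD T1 T2) (isOB T3 HA)).
apply: isO_near_eq; apply: filterS rel => x /= rx.
rewrite rx mul1mx !mulmxBr scalerBr.
by apply/colP => i; rewrite !coordE; ring.
Qed.

(* Cubic part of the commutation of two germs tangent to the identity. *)
Lemma jet3_commute n (f g : 'cV[R]_n -> 'cV[R]_n) c d :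
  (forall i j, c i j = c j i) -> (forall i j, d i j = d j i) ->
  f 0 = 0 -> g 0 = 0 ->
  isLip 2 (fun x => f x - x - bil c x x) -> isLip 2 (fun x => g x - x - bil d x x) ->
  (\forall x \near (0 : 'cV[R]_n), f (g x) = g (f x)) ->
  forall x, bil c x (bil d x x) = bil d x (bil c x x).
Proof.
(* The unknown cubic remainders of [u] and [v] enter [u o v] as a sum symmetric in the two maps;
   they cancel against those of [v o u], and only the mixed terms are left. *)
have half (u v : 'cV[R]_n -> 'cV[R]_n) a b : (forall i j, a i j = a j i) ->
    u 0 = 0 -> v 0 = 0 ->
    isLip 2 (fun x => u x - x - bil a x x) -> isLip 2 (fun x => v x - x - bil b x x) ->
    isO 4 (fun x => u (v x) - (x + bil b x x + (v x - x - bil b x x) + bil a x x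
       + (u x - x - bil a x x) + 2 *: bil a x (bil b x x))).
  move=> sa u0 v0 Lu Lv.
  have z0 (w : 'I_n -> 'I_n -> 'cV[R]_n) : bil w 0 0 = 0 by exact: lin0 (bil_lin2 w 0).
  have v3 : isO 3 (fun x => v x - x - bil b x x).
    by apply: isLip_isO Lv; rewrite v0 z0 !subr0.
  have v2 : isO 2 (fun x => v x - x).
    have := isOD (isO_le (p := 2) (leqnSn 2) v3) (isO_bil_id b).
    by apply: isO_ext => x; rewrite subrK.
  have v1 : isO 1 v.
    have := isOD (isO_le (p := 1) (leqnSn 1) v2) (isO_id n).
    by apply: isO_ext => x; rewrite subrK.
  (* A Lipschitz constant [O(x ^ 2)] of the remainder, times the distance [|v x - x| = O(x ^ 2)],
     gives order four. *)
  have T1 : isO 4 (fun x => (u (v x) - v x - bil a (v x) (v x)) - (u x - x - bil a x x)).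
    have [C C0 [e e0 HC]] := Lu; have [D D0 HD] := v2.
    have [E E0 HE] := v1.
    exists (C * (1 + E) ^+ 2 * D); first by rewrite !mulr_ge0 ?exprn_ge0 ?addr_ge0.
    have e1 : 0 < e / (1 + E) by rewrite divr_gt0 // ltr_wpDr.
    apply: filterS2 (filterI HD HE) (near0_lt _ e1) => x [Hx2 Hx1] xe.
    have r1 : `|x| <= (1 + E) * `|x| by rewrite mulrDl mul1r lerDl mulr_ge0.
    have r2 : `|v x| <= (1 + E) * `|x|.
      by apply: le_trans Hx1 _; rewrite expr1 mulrDl mul1r lerDr.
    have re : (1 + E) * `|x| <= e.
      by rewrite mulrC -ler_pdivlMr ?ltr_wpDr // ltW.
    apply: le_trans (HC _ re _ _ r2 r1) _.
    have -> : C * (1 + E) ^+ 2 * D * `|x| ^+ 4 = C * ((1 + E) * `|x|) ^+ 2 * (D * `|x| ^+ 2) by ring.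
    by apply: ler_wpM2l; rewrite ?mulr_ge0 ?exprn_ge0 ?mulr_ge0 ?addr_ge0.
  have T2 := isO_bil (p := 2) (q := 2) a v2 v2.
  have T3 := isO_scale 2 (isO_bil (p := 1) (q := 3) a (isO_id n) v3).
  have := isOD (isOD T1 T2) T3; apply: isO_ext => x.
  have -> : bil a (v x - x) (v x - x) = bil a (v x) (v x) - 2 *: bil a x (v x) + bil a x x.
    rewrite !(linD (bil_lin1 _ _)) !(linN (bil_lin1 _ _)) !(linD (bil_lin2 _ _)) !(linN (bil_lin2 _ _)).
    by rewrite (bil_sym (v x) x sa); apply/colP => i; rewrite !coordE; ring.
  rewrite !(linD (bil_lin2 _ _)) !(linN (bil_lin2 _ _)).
  by apply/colP => i; rewrite !coordE; ring.
move=> sc sd f0 g0 Lf Lg fg x; apply/subr0_eq; move: x.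
have H1 := half _ _ _ _ sc f0 g0 Lf Lg; have H2 := half _ _ _ _ sd g0 f0 Lg Lf.
apply: (@isO_homog _ 3 _ _ (fun x => bil c x (bil d x x) - bil d x (bil c x x))).
  move=> t x; rewrite !bilZ_homog !(linZ (bil_lin1 _ _)) !(linZ (bil_lin2 _ _)) scalerBr !scalerA.
  by congr (_ *: _ - _ *: _); ring.
have := isO_scale 2^-1 (isOB H2 H1); apply: isO_near_eq; apply: filterS fg => y ->.
by apply/colP => i; rewrite !coordE; field.
Qed.

End BilinearJets.

(** * Translations seen from infinity *)

Section Inversion.
Context {R : realType}.
Variable n : nat.
Implicit Types (x v z : 'cV[R]_n).

Lemma dotZl c x v : dot (c *: x) v = c * dot x v.
Proof. by rewrite -[c *: x]addr0 dotDl [dot 0 v]big1 ?addr0 // => i _; rewrite coord0 mul0r. Qed.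

Lemma dotZr c x v : dot x (c *: v) = c * dot x v.
Proof. by rewrite dotC dotZl dotC. Qed.

Lemma dot_addr x v z : dot z (x + v) = dot z x + dot z v.
Proof. by rewrite -[x in LHS]scale1r dotDr mul1r. Qed.

Lemma dot_gt0 x : x != 0 -> 0 < dot x x.
Proof. by move=> x0; apply: lt_le_trans (norm2_le_dot x); rewrite exprn_gt0 // normr_gt0. Qed.

Lemma phibarE x : phibar x = (dot x x)^-1 *: x.
Proof. by rewrite /phibar sqnorm_dot. Qed.

Lemma phibar0 : phibar (0 : 'cV[R]_n) = 0.
Proof. by rewrite phibarE scaler0. Qed.

Lemma phibar_scale c x : c != 0 -> phibar (c *: x) = c^-1 *: phibar x.
Proof.
move=> c0; have [->|x0] := eqVneq x 0; first by rewrite scaler0 phibar0 scaler0.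
have d0 := dot_gt0 x0.
rewrite !phibarE dotZl dotZr !scalerA; congr (_ *: _).
by field; rewrite c0 gt_eqF.
Qed.

Lemma phibarK x : phibar (phibar x) = x.
Proof.
have [->|x0] := eqVneq x 0; first by rewrite !phibar0.
have d0 := dot_gt0 x0.
by rewrite [phibar x]phibarE phibar_scale ?invr_eq0 ?gt_eqF // invrK phibarE scalerA mulfV ?scale1r // gt_eqF.
Qed.

Lemma phibar_eq0 x : (phibar x == 0) = (x == 0).
Proof.
apply/eqP/eqP => [H|->]; last exact: phibar0.
by rewrite -(phibarK x) H phibar0.
Qed.

Lemma PB_aE k x : (0 < k)%N -> PB_a k x = k%:R^-1 *: x.
Proof.
move=> k0; rewrite /PB_a /conj_inv; case: eqP => [->|_]; first by rewrite scaler0.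
by rewrite phibar_scale ?phibarK // pnatr_eq0 -lt0n.
Qed.

Definition inv_translation v := conj_inv (fun x => x + v).

Lemma inv_translation0 v : inv_translation v 0 = 0.
Proof. by rewrite /inv_translation /conj_inv eqxx. Qed.

(** A rational formula whose denominator is 1 at the origin: the singularity of [phibar] has
    cancelled, so smoothness and jets can be read off. *)
Lemma inv_translationE v x :
  inv_translation v x = (1 + 2 * dot x v + dot x x * dot v v)^-1 *: (x + dot x x *: v).
Proof.
rewrite /inv_translation /conj_inv; case: eqP => [->|/eqP x0].
  have -> : dot (0 : 'cV[R]_n) 0 = 0 by apply: big1 => i _; rewrite coord0 mul0r.
  by rewrite scale0r addr0 scaler0.
have d0 := dot_gt0 x0.
have -> : phibar x + v = (dot x x)^-1 *: (x + dot x x *: v).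
  by rewrite phibarE scalerDr scalerA mulVf ?scale1r // gt_eqF.
rewrite phibar_scale ?invr_eq0 ?gt_eqF // invrK phibarE scalerA; congr (_ *: _).
have -> : dot (x + dot x x *: v) (x + dot x x *: v) = dot x x * (1 + 2 * dot x v + dot x x * dot v v).
  rewrite dot_addr dotZr !(dotC (_ + _)) !dot_addr !dotZr (dotC v x); ring.
by rewrite invfM mulrA mulfV ?mul1r // gt_eqF.
Qed.

(** [phibar 0 = 0], although the inversion sends the origin to infinity; the formula is therefore
    claimed for orbits of the translation that avoid the origin. *)
Lemma iter_inv_translation v k z : z != 0 ->
  (forall l, (0 < l <= k)%N -> phibar z + l%:R *: v != 0) ->
  iter k (inv_translation v) z = phibar (phibar z + k%:R *: v).
Proof.
move=> z0; elim: k => [|k IH] H; first by rewrite scale0r addr0 phibarK.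
rewrite iterS IH => [|l /andP[l0 lk]]; last by apply: H; rewrite l0 leqW.
have w0 : phibar z + k%:R *: v != 0.
  case: (posnP k) => [->|k0]; first by rewrite scale0r addr0 phibar_eq0.
  by apply: H; rewrite k0 leqnSn.
by rewrite /inv_translation /conj_inv phibar_eq0 (negPf w0) phibarK -addrA -natr1 scalerDl scale1r.
Qed.

Lemma isO_dot p q m (f g : 'cV[R]_m -> 'cV[R]_n) : isO p f -> isO q g ->
  isO (p + q) (fun w : 'cV[R]_m => dot (f w) (g w)).
Proof.
move=> Hf Hg; apply: isO_sum => i.
have cf r (u : 'cV[R]_m -> 'cV[R]_n) : isO r u -> isO r (fun w => u w i 0).
  by move=> [C C0 H]; exists C => //; apply: filterS H => y; apply: le_trans; exact: norm_coord.
exact: isOZ (cf _ _ Hf) (cf _ _ Hg).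
Qed.

(** The dilation by [k] conjugates the translation by [v] to that by [k v], here seen from infinity.
    The work is to show that for small [y] the orbit avoids the origin. *)
Lemma inv_translation_relation v k : (0 < k)%N ->
  \forall y \near (0 : 'cV[R]_n), inv_translation v y = k%:R *: iter k (inv_translation v) (k%:R^-1 *: y).
Proof.
move=> k0; have kR : 0 < k%:R :> R by rewrite ltr0n.
have [C C0 HC] := isO_dot (isO_id n) (isO_id n).
have D0 : 0 <= dot v v by apply: sumr_ge0 => i _; rewrite -expr2 sqr_ge0.
pose D := C * dot v v; have DD : 0 <= D by exact: mulr_ge0.
have D1 : 0 < D + 1 by rewrite ltr_wpDl.
pose d := Num.min 1 (1 / (D + 1)).
have d0 : 0 < d by rewrite lt_min ltr01 divr_gt0.
apply: filterS2 HC (near0_lt _ d0) => y Hy yd.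
have [->|y0] := eqVneq y 0.
  have it0 j : iter j (inv_translation v) 0 = 0.
    by elim: j => //= j ->; exact: inv_translation0.
  by rewrite scaler0 it0 inv_translation0 scaler0.
have z0 : k%:R^-1 *: y != 0 by rewrite scaler_eq0 invr_eq0 gt_eqF.
rewrite iter_inv_translation //; last first.
  move=> l /andP[l0 lk]; apply/eqP => /eqP; rewrite addr_eq0 => /eqP E.
  have : dot (phibar (k%:R^-1 *: y)) (phibar (k%:R^-1 *: y)) = l%:R ^+ 2 * dot v v.
    by rewrite E dotNr dotC dotNr dotZl dotZr; ring.
  have dy := dot_gt0 y0.
  rewrite phibar_scale ?invr_eq0 ?gt_eqF // invrK phibarE !scalerA dotZl dotZr => E2.
  (* An orbit meeting the origin after [l <= k] steps would force [dot v v * dot y y >= 1], which a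
     small [y] excludes. *)
  have E3 : k%:R ^+ 2 = l%:R ^+ 2 * dot v v * dot y y.
    by rewrite -E2; field; rewrite gt_eqF.
  have L : l%:R ^+ 2 <= k%:R ^+ 2 :> R by apply: lerXn2r; rewrite ?nnegrE ?ler_nat.
  have : dot v v * dot y y < 1.
    apply: (@le_lt_trans _ _ (D * `|y|)).
      rewrite /D [C * _]mulrC -mulrA; apply: ler_wpM2l => //.
      apply: le_trans (ler_norm _) _; apply: le_trans Hy _; apply: ler_wpM2l => //.
      rewrite expr2 ler_piMl //; apply: ltW; apply: lt_le_trans yd _; by rewrite ge_min lexx.
    apply: (@le_lt_trans _ _ ((D + 1) * `|y|)); first by apply: ler_wpM2r => //; rewrite lerDl.
    by rewrite -ltr_pdivlMl // mulr1 -[X in _ < X]mul1r; apply: lt_le_trans yd _; rewrite ge_min lexx orbT.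
  have k2 : 0 < k%:R ^+ 2 :> R by rewrite exprn_gt0.
  have vy : 0 <= dot v v * dot y y by rewrite mulr_ge0 // ltW.
  rewrite -mulrA in E3; move: E3 L k2 vy; move: (dot v v * dot y y) (k%:R ^+ 2) (l%:R ^+ 2) => a b c.
  nra.
rewrite phibar_scale ?invr_eq0 ?gt_eqF // invrK -scalerDr phibar_scale ?gt_eqF // scalerA.
rewrite mulfV ?gt_eqF // scale1r /inv_translation /conj_inv (negPf y0).
by [].
Qed.

Lemma inv_translation_near v : \forall x \near (0 : 'cV[R]_n),
  2^-1 <= 1 + 2 * dot x v + dot x x * dot v v.
Proof.
have [C C0 HC] := isO_dot (isO_id n) (isO_cst n v).
have c1 : 0 < 4 * C + 1 by rewrite ltr_wpDl // mulr_ge0.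
have d0 : 0 < 1 / (4 * C + 1) by rewrite divr_gt0.
apply: filterS2 HC (near0_lt _ d0) => x Hx xd.
have dp (u : 'cV[R]_n) : 0 <= dot u u by apply: sumr_ge0 => i _; rewrite -expr2 sqr_ge0.
have := mulr_ge0 (dp x) (dp v).
have : 4 * `|dot x v| <= 1.
  apply: le_trans (ler_wpM2l _ Hx) _ => //; rewrite expr1 mulrA.
  apply: (@le_trans _ _ ((4 * C + 1) * `|x|)); first by apply: ler_wpM2r => //; rewrite lerDl.
  by rewrite mulrC -ler_pdivlMr // ltW.
have := ler_norm (- dot x v); rewrite normrN; lra.
Qed.

Lemma vCr_inv_translation r v : \forall x \near (0 : 'cV[R]_n), vCr r (inv_translation v) x.
Proof.
apply: filterS (inv_translation_near v) => x Hx.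
have -> : inv_translation v = fun x => (1 + 2 * dot x v + dot x x * dot v v)^-1 *: (x + dot x x *: v).
  by apply/funext => y; exact: inv_translationE.
have Cd : Cr r (fun y : 'cV[R]_n => dot y y) x.
  by apply: Cr_sum => i _; apply: CrM; exact: Cr_coord.
have Cv : Cr r (fun y : 'cV[R]_n => dot y v) x.
  by apply: Cr_sum => i _; apply: CrM; [exact: Cr_coord|exact: Cr_cst].
apply: vCrZ.
  apply: CrV; first by rewrite gt_eqF //; apply: lt_le_trans Hx.
  apply: CrD; last by apply: CrM => //; exact: Cr_cst.
  by apply: CrD; [exact: Cr_cst|apply: CrM => //; exact: Cr_cst].
apply: vCrD; first exact: vCr_id.
by apply: vCrZ => //; exact: vCr_cst.
Qed.

Lemma inv_field_lin1 v x : is_lin (fun w : 'cV[R]_n => inv_field w x v).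
Proof.
move=> c y z; rewrite /inv_field !dotDr; apply/colP => i; rewrite !coordE; ring.
Qed.

Lemma inv_field_lin2 v x : is_lin (inv_field v x).
Proof.
move=> c y z; rewrite /inv_field !dotDr !dotDl; apply/colP => i; rewrite !coordE; ring.
Qed.

Lemma inv_field_sym v x z : inv_field v x z = inv_field v z x.
Proof. by rewrite /inv_field (dotC x z); apply/colP => i; rewrite !coordE; ring. Qed.

Definition inv_coef v (i j : 'I_n) := inv_field v (delta_mx i 0) (delta_mx j 0).

Lemma inv_fieldE v x z : inv_field v x z = bil (inv_coef v) x z.
Proof.
apply: (bilP (F := inv_field v)); last exact: inv_field_lin2.
by move=> y c u w; rewrite !(inv_field_sym _ _ y) inv_field_lin2.
Qed.

Lemma jet2_inv_translation v : jet2 (inv_translation v) 1%:M (inv_coef v).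
Proof.
pose D x := 1 + 2 * dot x v + dot x x * dot v v.
pose d x := 2 * dot x v + dot x x * dot v v.
have Oxv : isO 1 (fun x => dot x v) by exact: (isO_dot (p := 1) (q := 0) (isO_id n) (isO_cst n v)).
have Oxx : isO 2 (fun x => dot x x) by exact: (isO_dot (p := 1) (q := 1) (isO_id n) (isO_id n)).
have Od : isO 1 d.
  apply: isOD; first exact: (isO_scale (W := R) 2 Oxv).
  have := isO_scale (W := R) (dot v v) (isO_le (p := 1) (leqnSn 1) Oxx).
  by apply: isO_ext => x; rewrite mulrC.
(* The remainder multiplied by the denominator [D x = 1 + d x]; the terms of degree below three have
   cancelled. *)
have N : isO 3 (fun x => (- (dot x x * dot v v)) *: x - (d x * dot x x) *: v + (2 * d x * dot x v) *: x).
  apply: isOD; [apply: isOB|].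
  - apply: (isOZ (p := 2) (q := 1)); last exact: isO_id.
    have := isO_scale (W := R) (- dot v v) Oxx.
    by apply: isO_ext => x; rewrite /GRing.scale /=; ring.
  - apply: (isOZ (p := 3) (q := 0)); last exact: isO_cst.
    exact: (isOZ (p := 1) (q := 2) (W := R) Od Oxx).
  - apply: (isOZ (p := 2) (q := 1)); last exact: isO_id.
    have := isO_scale (W := R) 2 (isOZ (p := 1) (q := 1) (W := R) Od Oxv).
    by apply: isO_ext => x; rewrite /GRing.scale /= mulrA.
have DV : isO 0 (fun x => (D x)^-1).
  exists 2 => //; apply: filterS (inv_translation_near v) => x Hx; rewrite expr0 mulr1.
  have D0 : 0 < D x by apply: lt_le_trans Hx.
  by rewrite gtr0_norm ?invr_gt0 // -[leRHS]invrK lef_pV2 ?posrE ?invr_gt0.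
have := isOZ DV N; rewrite add0n; apply: isO_near_eq.
apply: filterS (inv_translation_near v) => x Hx.
have D0 : D x != 0 by rewrite gt_eqF //; apply: lt_le_trans Hx.
rewrite -inv_fieldE mul1mx inv_translationE -/(D x).
apply: (@scalerI _ _ (D x)) => //; rewrite scalerA mulfV // scale1r !scalerBr scalerA mulfV // scale1r.
rewrite /inv_field /D /d; apply/colP => i; rewrite !coordE; ring.
Qed.

End Inversion.

(** * Conjugacy from agreement of second-order jets *)

Section ContractionUniqueness.
Context {R : realType}.

Lemma pow_close m : exists2 s : R, 0 < s & (1 + s) ^+ m <= 3 / 2.
Proof.
pose s : R := 1 / (3 * (m%:R + 1)).
have m1 : 0 < m%:R + 1 :> R by rewrite ltr_wpDl.
have s0 : 0 < s by rewrite divr_gt0 // mulr_gt0.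
exists s => //.
(* A reversed Bernoulli inequality; with [m s <= 1 / 3] it gives the bound [3 / 2]. *)
have H j : (1 + s) ^+ j * (1 - j%:R * s) <= 1.
  elim: j => [|j IH]; first by rewrite expr0 mul0r subr0 mul1r.
  apply: le_trans IH; rewrite exprSr -mulrA; apply: ler_wpM2l.
    by rewrite exprn_ge0 // addr_ge0 // ltW.
  rewrite -natr1; have : 0 <= j%:R * s by rewrite mulr_ge0 // ltW.
  nra.
have ms : m%:R * s <= 1 / 3.
  rewrite /s mulrA mulr1 ler_pdivrMr ?mulr_gt0 //; have := ltW m1; lra.
have := H m; have : 0 <= (1 + s) ^+ m by rewrite exprn_ge0 // addr_ge0 // ltW.
nra.
Qed.

Lemma isO2_close n (f : 'cV[R]_n -> 'cV[R]_n) c s : 0 < s -> isO 2 (fun x => f x - c *: x) ->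
  \forall x \near (0 : 'cV[R]_n), `|f x| <= (`|c| + s) * `|x|.
Proof.
move=> s0 [C C0 HC]; have d0 : 0 < s / (C + 1) by rewrite divr_gt0 // ltr_wpDl.
apply: filterS2 HC (near0_lt _ d0) => x Hx xd.
rewrite -(subrK (c *: x) (f x)); apply: le_trans (ler_normD _ _) _.
rewrite normrZ mulrDl addrC; apply: lerD => //; apply: le_trans Hx _.
rewrite expr2 mulrA; apply: ler_wpM2r => //.
apply: (@le_trans _ _ ((C + 1) * `|x|)); first by apply: ler_wpM2r => //; rewrite lerDl.
by rewrite mulrC -ler_pdivlMr ?ltr_wpDl // ltW.
Qed.

(* The defect [delta x = H (b x) - tau (H x)] satisfies [delta = O(x ^ 3)], and the relations
   bound it at [x] by [k] times its sum over the [k] points [b ^ j (A x)] of size about [x / k];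
   hence the best constant in [delta <= M x ^ 3] is at most [3 / 4] of itself. *)
Lemma conjugacy_of_jet n k (A b H tau : 'cV[R]_n -> 'cV[R]_n) : (2 <= k)%N ->
  isO 2 (fun x => b x - x) -> isO 2 (fun x => A x - k%:R^-1 *: x) -> isO 1 H ->
  (\forall x \near (0 : 'cV[R]_n), H (A x) = k%:R^-1 *: H x) ->
  (\forall x \near (0 : 'cV[R]_n), A (b x) = iter k b (A x)) ->
  (\forall y \near (0 : 'cV[R]_n), tau y = k%:R *: iter k tau (k%:R^-1 *: y)) ->
  tau 0 = 0 -> isLip 1 (fun x => tau x - x) ->
  isO 3 (fun x => H (b x) - tau (H x)) ->
  \forall x \near (0 : 'cV[R]_n), H (b x) = tau (H x).
Proof.
move=> k2 Ob OA OH HA Ab Rtau tau0 Ltau [M M0 HM].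
have K2 : 2 <= k%:R :> R by rewrite ler_nat.
have K0 : 0 < k%:R :> R by apply: lt_le_trans K2.
(* The exponent collects the distortions of one round: [3 k] along the [k] iterates, where sizes are
   cubed, and 3 from the cube of the size of [A x]. *)
have [s s0 hs] := pow_close (3 * k + 3).
pose l := 1 + s; have l1 : 1 <= l by rewrite lerDl ltW.
have l0 : 0 <= l by apply: le_trans l1.
have lj j : (j <= 3 * k + 3)%N -> l ^+ j <= 3 / 2.
  by move=> jk; apply: le_trans hs; apply: ler_weXn2l.
have k3 i : (i <= k)%N -> (i.+1 <= 3 * k + 3)%N.
  by move=> ik; rewrite addnS ltnS (leq_trans ik) // mulSn -addnA leq_addr.
have lj1 j : 1 <= l ^+ j by exact: exprn_ege1.
have [C C0 [d d0 HC]] := Ltau.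
pose t := Num.min d (s / (C + 1)).
have t0 : 0 < t by rewrite lt_min d0 divr_gt0 // ltr_wpDl.
have lip z w : `|z| <= t -> `|w| <= t -> `|tau z - tau w| <= l * `|z - w|.
  move=> zt wt; have td : t <= d by rewrite ge_min lexx.
  have := HC t td z w zt wt; rewrite expr1.
  have Ct : C * t <= s.
    apply: (@le_trans _ _ ((C + 1) * t)); first by apply: ler_wpM2r; [exact: ltW|rewrite lerDl].
    by rewrite mulrC -ler_pdivlMr ?ltr_wpDl // ge_min lexx orbT.
  have -> : tau z - tau w = (tau z - z - (tau w - w)) + (z - w).
    by apply/colP => i; rewrite !coordE; ring.
  move=> H1; apply: le_trans (ler_normD _ _) _; rewrite mulrDl mul1r addrC; apply: lerD => //.
  by apply: le_trans H1 _; apply: ler_wpM2r.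
have lip0 z : `|z| <= t -> `|tau z| <= l * `|z|.
  by move=> zt; have := lip z 0 zt; rewrite normr0 tau0 !subr0; apply; exact: ltW.
have [E E0 HE] := OH.
have Ob' : isO 2 (fun x => b x - 1 *: x) by apply: isO_ext Ob => x; rewrite scale1r.
have nb := isO2_close s0 Ob'; rewrite normr1 -/l in nb.
have sk : 0 < s / k%:R by rewrite divr_gt0.
have nA := isO2_close sk OA.
have nA' : \forall x \near (0 : 'cV[R]_n), `|A x| <= l / k%:R * `|x|.
  have -> : l / k%:R = k%:R^-1 + s / k%:R by rewrite /l mulrDl mul1r.
  by apply: filterS nA => x; rewrite ger0_norm ?invr_ge0 ?(ltW K0).
have Rtau' : \forall x \near (0 : 'cV[R]_n), tau (H x) = k%:R *: iter k tau (k%:R^-1 *: H x).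
  exact: isO_cvg0 OH Rtau.
have [r r0 Hr] := near0_ex (filterI (filterI (filterI HA Ab) (filterI Rtau' HM)) (filterI (filterI nb nA') HE)).
(* Half of [r], because [b x] may leave the ball of radius [rho] but stays in that of radius
   [2 rho]; the second bound keeps [H x] where [tau] is Lipschitz. *)
pose rho := Num.min (r / 2) (t / (2 * (E + 1))).
have E1 : 0 < E + 1 by rewrite ltr_wpDl.
have rho0 : 0 < rho by rewrite lt_min !divr_gt0 // mulr_gt0.
have rr (x : 'cV[R]_n) : `|x| < 2 * rho -> `|x| < r.
  have : rho <= r / 2 by rewrite ge_min lexx.
  by move=> h1 h2; apply: lt_le_trans h2 _; lra.
have rr1 (x : 'cV[R]_n) : `|x| < rho -> `|x| < r by move=> h; apply: rr; lra.
have rt (x : 'cV[R]_n) : `|x| < rho -> 2 * `|H x| <= t.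
  move=> xr; have [_ [_ Hx]] := Hr _ (rr1 x xr).
  have : rho <= t / (2 * (E + 1)) by rewrite ge_min lexx orbT.
  rewrite ler_pdivlMr ?mulr_gt0 // => h.
  apply: le_trans h; rewrite expr1 in Hx.
  have h2 : E * `|x| <= (E + 1) * rho.
    by apply: ler_pM => //; [rewrite lerDl|exact: ltW].
  lra.
have step N : 0 <= N -> (forall x, `|x| < rho -> `|H (b x) - tau (H x)| <= N * `|x| ^+ 3) ->
    forall x, `|x| < rho -> `|H (b x) - tau (H x)| <= (N * (3 / 4)) * `|x| ^+ 3.
  move=> N0 HN x xr.
  have [[[HAx Abx] [Rx _]] [[nbx nAx] _]] := Hr x (rr1 x xr).
  have bx2 : `|b x| < 2 * rho.
    apply: le_lt_trans nbx _; have := lj 1%N; rewrite expr1 => /(_ _) h.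
    have : l <= 3 / 2 by apply: h; rewrite addn3.
    have := normr_ge0 x; nra.
  have [[[HAbx _] _] _] := Hr _ (rr _ bx2).
  set y := A x in nAx Abx HAx.
  have yb j : (j <= k)%N -> `|iter j b y| <= l ^+ j * `|y| /\ `|iter j b y| < rho.
    have fin i : (i <= k)%N -> l ^+ i * `|y| < rho.
      move=> ik; apply: le_lt_trans xr.
      apply: (@le_trans _ _ (l ^+ i * (l / k%:R * `|x|))).
        by apply: ler_wpM2l => //; rewrite exprn_ge0.
      have h : l ^+ i * l <= 3 / 2 by rewrite -exprSr; apply: lj; exact: k3.
      have -> : l ^+ i * (l / k%:R * `|x|) = (l ^+ i * l / k%:R) * `|x| by ring.
      rewrite -[leRHS]mul1r; apply: ler_wpM2r => //; rewrite ler_pdivrMr // mul1r; lra.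
    elim: j => [|j IH] jk.
      by rewrite expr0 mul1r; split => //; have := fin 0%N isT; rewrite expr0 mul1r.
    have [i1 i2] := IH (ltnW jk).
    have [_ [[nbj _] _]] := Hr _ (rr1 _ i2).
    have h : `|iter j.+1 b y| <= l ^+ j.+1 * `|y|.
      by rewrite iterS; apply: le_trans nbj _; rewrite exprS -mulrA; apply: ler_wpM2l.
    by split => //; apply: le_lt_trans h _; exact: fin.
  have ty j : (j <= k)%N -> `|iter j tau (H y)| <= l ^+ j * `|H y| /\ `|iter j tau (H y)| <= t.
    have [_ yr] := yb 0%N isT.
    have fin i : (i <= k)%N -> l ^+ i * `|H y| <= t.
      move=> ik; apply: le_trans (rt y yr).
      apply: ler_wpM2r => //; have : l ^+ i <= 3 / 2 by apply: lj; exact: ltnW (k3 _ ik).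
      lra.
    elim: j => [|j IH] jk.
      by rewrite expr0 mul1r; split => //; have := fin 0%N isT; rewrite expr0 mul1r.
    have [i1 i2] := IH (ltnW jk).
    have h : `|iter j.+1 tau (H y)| <= l ^+ j.+1 * `|H y|.
      by rewrite iterS; apply: le_trans (lip0 _ i2) _; rewrite exprS -mulrA; apply: ler_wpM2l.
    by split => //; apply: le_trans h _; exact: fin.
  (* Telescoping along the orbit: each step adds the defect at [b ^ j y], while [tau] stretches the
     accumulated difference by at most [l]. *)
  have ind j : (j <= k)%N ->
      `|H (iter j b y) - iter j tau (H y)| <= j%:R * l ^+ (3 * j) * (N * `|y| ^+ 3).
    elim: j => [|j IH] jk; first by rewrite subrr normr0 !mul0r.
    have [i1 i2] := yb j (ltnW jk).
    have [_ i4] := ty j (ltnW jk).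
    have i5 : `|H (iter j b y)| <= t by have := rt _ i2; have := normr_ge0 (H (iter j b y)); lra.
    rewrite !iterS -(subrKA (tau (H (iter j b y)))); apply: le_trans (ler_normD _ _) _.
    have h1 : `|H (b (iter j b y)) - tau (H (iter j b y))| <= l ^+ (3 * j) * (N * `|y| ^+ 3).
      apply: le_trans (HN _ i2) _.
      have -> : l ^+ (3 * j) * (N * `|y| ^+ 3) = N * (l ^+ j * `|y|) ^+ 3.
        by rewrite exprMn -exprM mulnC; ring.
      by apply: ler_wpM2l => //; apply: lerXn2r; rewrite ?nnegrE ?mulr_ge0 ?exprn_ge0.
    have h2 : `|tau (H (iter j b y)) - tau (iter j tau (H y))|
        <= l * (j%:R * l ^+ (3 * j) * (N * `|y| ^+ 3)).
      by apply: le_trans (lip _ _ i5 i4) _; apply: ler_wpM2l => //; exact: IH (ltnW jk).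
    apply: le_trans (lerD h1 h2) _.
    set Y := N * `|y| ^+ 3; have Y0 : 0 <= Y by rewrite mulr_ge0 ?exprn_ge0.
    have -> : l ^+ (3 * j) * Y + l * (j%:R * l ^+ (3 * j) * Y) = (1 + l * j%:R) * (l ^+ (3 * j) * Y) by ring.
    have -> : j.+1%:R * l ^+ (3 * j.+1) * Y = ((1 + j%:R) * l ^+ 3) * (l ^+ (3 * j) * Y).
      by rewrite mulnS exprD -natr1; ring.
    apply: ler_wpM2r; first by rewrite mulr_ge0 ?exprn_ge0.
    have h3 : l <= l ^+ 3 by rewrite -[leLHS]expr1; apply: ler_weXn2l.
    have h4 : l * j%:R <= l ^+ 3 * j%:R by apply: ler_wpM2r.
    have := lj1 3; lra.
  have Ek := ind k (leqnn k).
  have E1' : H (b x) = k%:R *: H (iter k b y).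
    by rewrite -Abx HAbx scalerA mulfV ?scale1r // gt_eqF.
  have E2' : tau (H x) = k%:R *: iter k tau (H y) by rewrite Rx HAx.
  rewrite E1' E2' -scalerBr normrZ ger0_norm ?(ltW K0) //.
  apply: le_trans (ler_wpM2l (ltW K0) Ek) _.
  have y3 : `|y| ^+ 3 <= (l / k%:R * `|x|) ^+ 3.
    by apply: lerXn2r; rewrite ?nnegrE // mulr_ge0 // divr_ge0 // ltW.
  apply: (@le_trans _ _ (k%:R * (k%:R * l ^+ (3 * k) * (N * (l / k%:R * `|x|) ^+ 3)))).
    apply: ler_wpM2l; first exact: ltW.
    apply: ler_wpM2l; first by rewrite mulr_ge0 ?exprn_ge0 // ltW.
    exact: ler_wpM2l.
  (* The prefactor [k], the [k] summands and [1 / k ^ 3] from the cubic order leave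
     [1 / k <= 1 / 2], times a distortion of at most [3 / 2]. *)
  have -> : k%:R * (k%:R * l ^+ (3 * k) * (N * (l / k%:R * `|x|) ^+ 3))
     = (l ^+ (3 * k + 3) / k%:R) * (N * `|x| ^+ 3).
    by rewrite exprD; field; rewrite gt_eqF.
  have -> : N * (3 / 4) * `|x| ^+ 3 = (3 / 4) * (N * `|x| ^+ 3) by ring.
  apply: ler_wpM2r; first by rewrite mulr_ge0 ?exprn_ge0.
  rewrite ler_pdivrMr //; have := lj _ (leqnn _); lra.
have all p : forall x, `|x| < rho -> `|H (b x) - tau (H x)| <= (M * (3 / 4) ^+ p) * `|x| ^+ 3.
  elim: p => [|p IH] x xr.
    by rewrite expr0 mulr1; have [[_ [_ Hx]] _] := Hr x (rr1 x xr); exact: Hx.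
  have -> : M * (3 / 4) ^+ p.+1 = M * (3 / 4) ^+ p * (3 / 4) by rewrite exprSr; ring.
  by apply: step => //; rewrite mulr_ge0 // exprn_ge0 // divr_ge0.
apply: filterS (near0_lt _ rho0) => x xr; apply/subr0_eq/eqP; rewrite -normr_le0.
apply: (@theta_limit _ _ _ (M * `|x| ^+ 3)) => p; rewrite add0r.
apply: le_trans (all p x xr) _; rewrite mulrAC; apply: ler_wpM2l.
  by rewrite mulr_ge0 ?exprn_ge0.
apply: lerXn2r; rewrite ?nnegrE ?(ltW theta_gt0) ?divr_ge0 // /theta; lra.
Qed.

End ContractionUniqueness.

(** * The distance between second-order jets *)

Section JetDistance.
Context {R : realType}.

Lemma germ_smooth n (f : 'cV[R]_n -> 'cV[R]_n) : is_local_diffeo_germ f -> f 0 = 0 /\ smooth_near f.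
Proof.
move=> [f0 [U [W [g [[oU _] [U0 _] _ _ [sf _]]]]]]; split=> //.
have : \forall x \near (0 : 'cV[R]_n), U x by exact: open_nbhs_nbhs.
by apply: filterS => x Ux r; exact: smooth_on_vCr oU sf Ux.
Qed.

Definition second_coef n (f : 'cV[R]_n -> 'cV[R]_n) i j := 2^-1 *: 'D_(delta_mx i 0) ('D_(delta_mx j 0) f) 0.

Lemma derive2_bil n (f : 'cV[R]_n -> 'cV[R]_n) u v : vCr 3 f 0 ->
  'D_u ('D_v f) 0 = bil (fun i j => 'D_(delta_mx i 0) ('D_(delta_mx j 0) f) 0) u v.
Proof.
move=> Hf; have dD j : differentiable ('D_(delta_mx j 0) f) 0.
  by apply: vCr_differentiable_derive; exact: (vCr_le (leqnSn 2) Hf).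
have -> : 'D_u ('D_v f) 0 = 'D_u (\sum_j (v j 0 \*: 'D_(delta_mx j 0) f)) 0.
  apply: near_eq_derive; apply: filterS (vCr_diff_near Hf) => y dy.
  by rewrite diff_delta // fct_sumE.
rewrite derive_sum; last by move=> j; apply: derivableZ; exact: diff_derivable.
rewrite /bil exchange_big; apply: eq_bigr => j _ /=.
rewrite deriveZ; last exact: diff_derivable.
rewrite (diff_delta u (dD j)) scaler_sumr; apply: eq_bigr => i _.
by rewrite scalerA mulrC.
Qed.

Lemma norm_le_enorm n (w : 'cV[R]_n) : `|w| <= enorm w.
Proof.
rewrite /enorm sqnorm_dot -[leLHS]ger0_norm // -sqrtr_sqr; apply: ler_wsqrtr.
exact: norm2_le_dot.
Qed.

Lemma enorm_le n (w : 'cV[R]_n) : enorm w <= n%:R * `|w|.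
Proof.
rewrite /enorm sqnorm_dot -[leRHS]ger0_norm ?mulr_ge0 // -sqrtr_sqr; apply: ler_wsqrtr.
apply: le_trans (ler_norm _) _; apply: le_trans (dot_le w w) _.
rewrite exprMn -[`|w| * _]expr2; apply: ler_wpM2r; first exact: exprn_ge0.
by rewrite -natrX ler_nat; case: (n) => // m; rewrite expnS expn1 leq_pmulr.
Qed.

Lemma enorm_delta n (i : 'I_n) : enorm (delta_mx i 0 : 'cV[R]_n) = 1.
Proof. by rewrite /enorm sqnorm_dot dot_delta mxE !eqxx sqrtr1. Qed.

Lemma image_le_sup T (F : T -> R) (P : set T) (C : R) x :
  (forall y, P y -> F y <= C) -> P x -> F x <= sup [set F y | y in P].
Proof.
move=> HC Px; apply: ub_le_sup; last by exists x.
by exists C => _ [y Py <-]; exact: HC.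
Qed.

(** A real supremum is known to dominate the elements of a set only once the set is bounded, so
    bounds for both sets come before the comparison; nonnegativity of the two summands of [dC2] then
    separates them. *)
Lemma dC2_lt n (f g : 'cV[R]_n -> 'cV[R]_n) e : vCr 3 f 0 -> vCr 3 g 0 -> dC2 f g < e ->
  (forall i, `|'D_(delta_mx i 0) f 0 - 'D_(delta_mx i 0) g 0| <= e) /\
  (forall i j, `|second_coef f i j - second_coef g i j| <= e).
Proof.
move=> Hf Hg; have df : differentiable f 0 by exact: vCr_diff Hf.
have dg : differentiable g 0 by exact: vCr_diff Hg.
pose F (xi : 'cV[R]_n) := enorm ('D_xi f 0 - 'D_xi g 0).
pose F2 (xi : 'cV[R]_n * 'cV[R]_n) := enorm ('D_(xi.1) ('D_(xi.2) f) 0 - 'D_(xi.1) ('D_(xi.2) g) 0).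
have [C C0 HC] : exists2 C, 0 <= C & forall xi : 'cV[R]_n, enorm xi <= 1 -> F xi <= C.
  have [K K0 HK] := mulmx_norm (jac f 0 - jac g 0).
  exists (n%:R * K); first exact: mulr_ge0.
  move=> xi x1; apply: le_trans (enorm_le _) _; apply: ler_wpM2l => //.
  rewrite -!jacE // -mulmxBl; apply: le_trans (HK _) _; rewrite -[leRHS]mulr1.
  by apply: ler_wpM2l => //; apply: le_trans (norm_le_enorm _) x1.
have [D D0 HD] : exists2 D, 0 <= D & forall xi : 'cV[R]_n * 'cV[R]_n, enorm xi.1 <= 1 /\ enorm xi.2 <= 1 -> F2 xi <= D.
  have [K K0 HK] := bil_bound (fun i j => 'D_(delta_mx i 0) ('D_(delta_mx j 0) f) 0).
  have [L L0 HL] := bil_bound (fun i j => 'D_(delta_mx i 0) ('D_(delta_mx j 0) g) 0).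
  exists (n%:R * (K + L)); first by rewrite mulr_ge0 // addr_ge0.
  move=> xi [x1 x2]; apply: le_trans (enorm_le _) _; apply: ler_wpM2l => //.
  rewrite !derive2_bil //.
  have h : `|xi.1| * `|xi.2| <= 1.
    by apply: mulr_ile1 => //; apply: le_trans (norm_le_enorm _) _.
  apply: normB_le.
    by apply: le_trans (HK _ _) _; rewrite -[leRHS]mulr1; apply: ler_wpM2l.
  by apply: le_trans (HL _ _) _; rewrite -[leRHS]mulr1; apply: ler_wpM2l.
have e0 : enorm (0 : 'cV[R]_n) = 0.
  by rewrite /enorm sqnorm_dot [dot _ _]big1 ?sqrtr0 // => i _; rewrite coord0 mul0r.
have S1 xi : enorm xi <= 1 -> F xi <= dist1 f g.
  by move=> x1; apply: (image_le_sup (F := F) (P := [set xi | enorm xi <= 1])) HC x1.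
have S2 xi : enorm xi.1 <= 1 /\ enorm xi.2 <= 1 -> F2 xi <= dist2 f g.
  by move=> x1; apply: (image_le_sup (F := F2) (P := [set xi | enorm xi.1 <= 1 /\ enorm xi.2 <= 1])) HD x1.
have P1 : 0 <= dist1 f g.
  by apply: le_trans (S1 0 _); rewrite ?e0 //; exact: sqrtr_ge0.
have P2 : 0 <= dist2 f g.
  by apply: le_trans (S2 (0, 0) _); rewrite ?e0 //; exact: sqrtr_ge0.
rewrite /dC2 => lt_e; split=> [i|i j].
  apply: le_trans (norm_le_enorm _) _; have := S1 (delta_mx i 0); rewrite enorm_delta => /(_ (lexx _)).
  rewrite /F; lra.
rewrite /second_coef -scalerBr normrZ gtr0_norm ?invr_gt0 //.
have h : enorm ('D_(delta_mx i 0) ('D_(delta_mx j 0) f) 0 - 'D_(delta_mx i 0) ('D_(delta_mx j 0) g) 0) <= e.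
  have := S2 (delta_mx i 0, delta_mx j 0); rewrite /= !enorm_delta => /(_ (conj (lexx _) (lexx _))).
  rewrite /F2 /=; lra.
have h2 := le_trans (norm_le_enorm _) h.
apply: le_trans (ler_wpM2l _ h2) _; rewrite ?invr_ge0 //.
have : 0 <= e by apply: le_trans h; exact: sqrtr_ge0.
lra.
Qed.

Lemma vCr_jet2 n (f : 'cV[R]_n -> 'cV[R]_n) : vCr 3 f 0 -> f 0 = 0 ->
  (forall i j, second_coef f i j = second_coef f j i) /\
  isLip 2 (fun x => f x - jac f 0 *m x - bil (second_coef f) x x) /\
  jet2 f (jac f 0) (second_coef f).
Proof.
move=> Hf f0; have [sym L] := taylor2 Hf.
have df : differentiable f 0 by exact: vCr_diff Hf.
have {}L : isLip 2 (fun x => f x - jac f 0 *m x - bil (second_coef f) x x).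
  have -> // : (fun x => f x - jac f 0 *m x - bil (second_coef f) x x) =
    (fun x => f x - f 0 - 'D_x f 0 - bil (fun i j => 2^-1 *: 'D_(delta_mx i 0) ('D_(delta_mx j 0) f) 0) x x).
  by apply/funext => x; rewrite jacE // f0 subr0.
split; first by move=> i j; rewrite /second_coef sym.
split=> //; apply: isLip_isO L.
by rewrite f0 mulmx0 (lin0 (bil_lin2 _ 0)) !subr0.
Qed.

Lemma bil_delta n m (c : 'I_n -> 'I_n -> 'cV[R]_m) i j : bil c (delta_mx i 0) (delta_mx j 0) = c i j.
Proof.
rewrite /bil (bigD1 i) //= [X in _ + X]big1 ?addr0 => [|l /negPf li].
  rewrite (bigD1 j) //= big1 ?addr0 => [|l /negPf lj]; first by rewrite !mxE !eqxx mulr1 scale1r.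
  by rewrite !mxE lj mulr0 scale0r.
by apply: big1 => l' _; rewrite !mxE li mul0r scale0r.
Qed.

(** Reads derivatives off an explicit jet: uniqueness gives the linear part and the quadratic form,
    and polarization gives the coefficients. *)
Lemma second_coef_jet n (f : 'cV[R]_n -> 'cV[R]_n) L (F : 'cV[R]_n -> 'cV[R]_n -> 'cV[R]_n) :
  vCr 3 f 0 -> f 0 = 0 -> (forall x, is_lin (F x)) -> (forall x y, F x y = F y x) ->
  jet2 f L (fun i j => F (delta_mx i 0) (delta_mx j 0)) ->
  jac f 0 = L /\ forall i j, second_coef f i j = F (delta_mx i 0) (delta_mx j 0).
Proof.
move=> Hf f0 F2 Fs HF; have [sym [_ HJ]] := vCr_jet2 Hf f0.
have [-> E] := jet2_uniq HJ HF; split=> // i j.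
have F1 y : is_lin (fun x => F x y) by move=> c v w; rewrite !(Fs _ y) F2.
have H x y : bil (second_coef f) x y = F x y.
  apply: bil_polar => // [|x' y'|x']; first exact: bil_lin2.
    exact: bil_sym.
  by rewrite E -bilP.
by rewrite -H bil_delta.
Qed.

Lemma bil_le n (c : 'I_n -> 'I_n -> 'cV[R]_n) d : 0 <= d -> (forall i j, `|c i j| <= d) ->
  forall x y, `|bil c x y| <= n%:R ^+ 2 * d * (`|x| * `|y|).
Proof.
move=> d0 Hc x y; apply: le_trans (ler_norm_sum _ _ _) _.
have -> : n%:R ^+ 2 * d * (`|x| * `|y|) = \sum_(i < n) \sum_(j < n) (`|x| * `|y|) * d.
  rewrite !sumr_const !card_ord -[RHS]mulr_natl -[X in _ = _ * X]mulr_natl; ring.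
apply: ler_sum => i _; apply: le_trans (ler_norm_sum _ _ _) _; apply: ler_sum => j _.
apply: normZ_le => //; rewrite normrM; apply: ler_pM => //; exact: norm_coord.
Qed.
End JetDistance.

(** * Triviality of the linear parts *)

Section LinearPart.
Context {R : realType}.
Variable n : nat.
Local Notation M := 'M[R]_n.+1.
Local Notation p := (n.+1%:R : R).
Implicit Types (t N X Y : M).

Lemma mx_coord_le X i j : `|X i j| <= `|X|.
Proof.
rewrite [leRHS]/Num.Def.normr/= mx_normrE.
exact: (le_bigmax _ (fun ij : 'I_n.+1 * 'I_n.+1 => `|X ij.1 ij.2|) (i, j)).
Qed.

Lemma mx_norm_le X c : 0 <= c -> (forall i j, `|X i j| <= c) -> `|X| <= c.
Proof.
move=> c0 Xc; rewrite [leLHS]/Num.Def.normr/= mx_normrE.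
by apply: bigmax_le => // -[i j] _ /=.
Qed.

Lemma mulmx_col_le X (v : 'cV[R]_n.+1) : `|X *m v| <= p * (`|X| * `|v|).
Proof.
apply: norm_le_coord => [|i]; first by rewrite !mulr_ge0.
rewrite mxE; apply: le_trans (ler_norm_sum _ _ _) _.
apply: (@le_trans _ _ (\sum_(k < n.+1) `|X| * `|v|)).
  by apply: ler_sum => k _; rewrite normrM; apply: ler_pM => //; [exact: mx_coord_le|exact: norm_coord].
by rewrite sumr_const card_ord -[leLHS]mulr_natl.
Qed.

Lemma mulmx_le X Y : `|X * Y| <= p * (`|X| * `|Y|).
Proof.
apply: mx_norm_le => [|i j]; first by rewrite !mulr_ge0.
rewrite mxE; apply: le_trans (ler_norm_sum _ _ _) _.
apply: (@le_trans _ _ (\sum_(k < n.+1) `|X| * `|Y|)).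
  by apply: ler_sum => k _; rewrite normrM; apply: ler_pM => //; exact: mx_coord_le.
by rewrite sumr_const card_ord -[leLHS]mulr_natl.
Qed.

Lemma add_sub_split X a b : X = a + b + (X - a - b).
Proof. by rewrite -[X - a - b]addrA -opprD [RHS]addrC subrK. Qed.

Lemma pow_expansion k : exists2 C, 0 <= C & forall N, `|N| <= 1 ->
  `|(1 + N) ^+ k - 1 - k%:R *: N| <= C * `|N| ^+ 2.
Proof.
elim: k => [|k [C C0 IH]].
  by exists 0 => // N _; rewrite expr0 subrr scale0r subr0 normr0 mul0r.
exists (C + p * C + p * k%:R); first by rewrite !addr_ge0 // !mulr_ge0.
move=> N N1; set E := (1 + N) ^+ k - 1 - k%:R *: N.
have -> : (1 + N) ^+ k.+1 - 1 - k.+1%:R *: N = E + N * E + k%:R *: (N * N).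
  have -> : (1 + N) ^+ k.+1 = (1 + N) * (1 + k%:R *: N + E).
    by rewrite exprS /E -add_sub_split.
  rewrite mulrDl mul1r !mulrDr mulr1 -scalerAr -natr1 scalerDl scale1r.
  rewrite [1 + _ + _]addrC; move: (k%:R *: N) (N * E) (k%:R *: (N * N)) => u v w.
  by rewrite !opprD !addrA; apply/matrixP => i j; rewrite !mxE; ring.
have h1 := IH N N1; rewrite -/E in h1.
have h2 : `|N * E| <= p * C * `|N| ^+ 2.
  apply: le_trans (mulmx_le _ _) _; rewrite -mulrA; apply: ler_wpM2l => //.
  by rewrite -[leRHS]mul1r; apply: ler_pM.
have h3 : `|k%:R *: (N * N)| <= p * k%:R * `|N| ^+ 2.
  rewrite normrZ ger0_norm // [p * _]mulrC -mulrA; apply: ler_wpM2l => //.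
  by rewrite expr2; exact: mulmx_le.
apply: le_trans (ler_normD _ _) _; rewrite !mulrDl; apply: lerD => //.
by apply: le_trans (ler_normD _ _) _; exact: lerD.
Qed.

(* A solution near [(1/k, 1)] of the linear part of [a b = b ^ k a]: here [1 + t = k L]. *)
Lemma linear_part_trivial k : (2 <= k)%N -> exists2 K, 0 < K & forall t N e, 0 <= e -> e <= 1 ->
  K * e <= 2^-1 -> `|t| <= k%:R * e -> `|N| <= e -> (1 + t) * (1 + N) = (1 + N) ^+ k * (1 + t) -> N = 0.
Proof.
move=> k2; have [C C0 HC] := pow_expansion k.
have K2 : 2 <= k%:R :> R by rewrite ler_nat.
have p0 : 0 < p by rewrite ltr0n.
exists (p * k%:R + k%:R * (p * k%:R) + C + p * (C * k%:R) + 1).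
  by rewrite ltr_wpDl // !addr_ge0 // !mulr_ge0 // ltW.
move=> t N e e0 e1 Ke te Ne rel.
set E := (1 + N) ^+ k - 1 - k%:R *: N.
have E2 : `|E| <= C * `|N| ^+ 2 by apply: HC; exact: le_trans Ne e1.
have PE : (1 + N) ^+ k = 1 + k%:R *: N + E by exact: add_sub_split.
(* Every term on the right is [O(e) |N|], while the left side has norm at least [|N|] because
   [k >= 2]. *)
have eqN : (k%:R - 1) *: N = t * N - k%:R *: (N * t) - E - E * t.
  move: rel; rewrite PE !(mulrDl, mulrDr) !mul1r !mulr1 -scalerAl scalerBl scale1r.
  move: (t * N) (N * t) (E * t) => u v w /matrixP H; apply/matrixP => i j.
  have := H i j; rewrite !mxE; lra.
have E1 : `|E| <= C * e * `|N|.
  apply: le_trans E2 _; rewrite expr2 mulrA; apply: ler_wpM2r => //; exact: ler_wpM2l.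
have N0 := normr_ge0 N.
have h1 : `|t * N| <= p * k%:R * e * `|N|.
  have -> : p * k%:R * e * `|N| = p * ((k%:R * e) * `|N|) by ring.
  apply: le_trans (mulmx_le _ _) _; apply: ler_wpM2l; first exact: ltW.
  exact: ler_wpM2r.
have h2 : `|k%:R *: (N * t)| <= k%:R * (p * k%:R) * e * `|N|.
  rewrite normrZ ger0_norm //.
  have -> : k%:R * (p * k%:R) * e * `|N| = k%:R * (p * (`|N| * (k%:R * e))) by ring.
  apply: ler_wpM2l => //; apply: le_trans (mulmx_le _ _) _; apply: ler_wpM2l; first exact: ltW.
  exact: ler_wpM2l.
have h3 : `|E * t| <= p * (C * k%:R) * e * `|N|.
  have -> : p * (C * k%:R) * e * `|N| = p * (C * `|N| * (k%:R * e)) by ring.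
  apply: le_trans (mulmx_le _ _) _; apply: ler_wpM2l; first exact: ltW.
  apply: ler_pM => //; apply: le_trans E1 _; rewrite -mulrA; apply: ler_wpM2l => //.
  by rewrite -[leRHS]mul1r; apply: ler_wpM2r.
have h : `|(k%:R - 1) *: N| <= p * k%:R * e * `|N| + k%:R * (p * k%:R) * e * `|N| + C * e * `|N|
     + p * (C * k%:R) * e * `|N|.
  by rewrite eqN; do 3!(apply: le_trans (ler_normB _ _) _; apply: lerD => //).
have Ke' := ler_wpM2r N0 Ke.
have h' : `|N| <= `|(k%:R - 1) *: N|.
  rewrite normrZ -[leLHS]mul1r; apply: ler_wpM2r => //.
  by rewrite ger0_norm; lra.
have eN : 0 <= e * `|N| by exact: mulr_ge0.
by apply/eqP; rewrite -normr_le0; lra.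
Qed.

(* [1 + t] preserves each of the fields [Q v], which are close to the [inv_field v]. *)
Lemma symmetry_trivial (Q : 'cV[R]_n.+1 -> 'cV[R]_n.+1 -> 'cV[R]_n.+1 -> 'cV[R]_n.+1) (eps : R) t :
  (forall v x, is_lin (Q v x)) -> (forall v x y, Q v x y = Q v y x) ->
  0 <= eps -> eps <= 1 ->
  (forall v x y, `|Q v x y - inv_field v x y| <= eps * (`|v| * (`|x| * `|y|))) ->
  (forall v x, Q v x x + t *m Q v x x = Q v (x + t *m x) (x + t *m x)) ->
  (2 + p) * eps + (3 * p + 1) * `|t| <= 2^-1 -> t = 0.
Proof.
move=> Q2 Qs eps0 eps1 Qc Qt small.
suff H : `|t| <= 2^-1 * `|t| by apply/eqP; rewrite -normr_le0; have := normr_ge0 t; lra.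
apply: mx_norm_le => [|a j]; first by rewrite mulr_ge0.
pose ej : 'cV[R]_n.+1 := delta_mx j 0; pose w := t *m ej.
have wc : t a j = w a 0 by rewrite /w -colE mxE.
rewrite wc; apply: le_trans (norm_coord w a) _.
have wt : `|w| <= `|t|.
  by apply: norm_le_coord => // i; rewrite /w -colE mxE mx_coord_le.
have ne : `|ej| <= 1 by exact: norm_delta_le.
have inve y : inv_field ej ej y = - y.
  have d1 : dot ej ej = 1 by rewrite /ej dot_delta mxE !eqxx.
  by rewrite /inv_field (dotC ej y) d1; apply/colP => i; rewrite !coordE; ring.
pose u := Q ej ej ej + ej; pose b := Q ej ej w + w.
have hu : `|u| <= eps.
  have -> : u = Q ej ej ej - inv_field ej ej ej by rewrite inve opprK.
  apply: le_trans (Qc _ _ _) _.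
  by rewrite -[leRHS]mulr1; apply: ler_wpM2l => //; rewrite !mulr_ile1 // mulr_ile1.
have hb : `|b| <= eps * `|t|.
  have -> : b = Q ej ej w - inv_field ej ej w by rewrite inve opprK.
  apply: le_trans (Qc _ _ _) _.
  apply: ler_wpM2l => //; apply: le_trans wt.
  by rewrite mulrA ler_piMl // mulr_ile1.
have hw : `|Q ej w w| <= (3 * p + 1) * (`|t| * `|t|).
  rewrite -(subrK (inv_field ej w w) (Q ej w w)).
  apply: le_trans (normD_le (Qc _ _ _) (inv_field_le _ _ _)) _.
  have ww : `|ej| * (`|w| * `|w|) <= `|t| * `|t|.
    apply: (@le_trans _ _ (`|w| * `|w|)); first by rewrite ler_piMl ?mulr_ge0.
    exact: ler_pM.
  have ww0 : 0 <= `|ej| * (`|w| * `|w|) by rewrite !mulr_ge0.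
  have h1 : eps * (`|ej| * (`|w| * `|w|)) <= 1 * (`|t| * `|t|) by apply: ler_pM.
  have h2 : 3 * p * (`|ej| * (`|w| * `|w|)) <= 3 * p * (`|t| * `|t|).
    by apply: ler_wpM2l => //; rewrite mulr_ge0.
  lra.
(* The symmetry condition at [ej]; [u] and [b] are the deviations from the values [- ej] and [- w]
   of the conformal field, so each term on the right is at most a small multiple of [|t|]. *)
have E : w = 2 *: b + Q ej w w - t *m u.
  have := Qt ej ej; rewrite -/w !(linD (Q2 _ _)) !(Qs _ (ej + w)) !(linD (Q2 _ _)) (Qs _ w ej).
  rewrite /u /b mulmxDr -/w; move: (t *m Q ej ej ej) (Q ej ej ej) (Q ej ej w) (Q ej w w) => x y z s.
  by move=> /colP H; apply/colP => i; have := H i; rewrite !coordE; lra.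
have htu : `|t *m u| <= p * (`|t| * eps).
  by apply: le_trans (mulmx_col_le _ _) _; apply: ler_wpM2l => //; apply: ler_wpM2l.
have h2b : `|2 *: b| <= 2 * (eps * `|t|) by apply: normZ_le => //; rewrite ger0_norm.
rewrite E; apply: le_trans (normB_le (normD_le h2b hw) htu) _.
have := ler_wpM2r (normr_ge0 t) small; lra.
Qed.
End LinearPart.

(** * From the jets of the action to the conjugacy *)

Section Assembly.
Context {R : realType}.

Lemma PB_b_jets n (B : 'M[R]_n) i :
  vCr 3 (PB_b B i) 0 /\ jac (PB_b B i) 0 = 1%:M /\
  forall a b, second_coef (PB_b B i) a b = inv_coef (col i B) a b.
Proof.
have Hs : vCr 3 (PB_b B i) 0 by exact: nbhs_singleton (vCr_inv_translation 3 (col i B)).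
split=> //; apply: (second_coef_jet (F := inv_field (col i B))) => //.
- exact: inv_translation0.
- exact: inv_field_lin2.
- exact: inv_field_sym.
- exact: jet2_inv_translation.
Qed.

Lemma PB_a_derive n k i : (0 < k)%N ->
  vCr 3 (@PB_a R n k) 0 /\ 'D_(delta_mx i 0) (@PB_a R n k) 0 = k%:R^-1 *: delta_mx i 0.
Proof.
move=> k0; have E : @PB_a R n k = mulmx (k%:R^-1%:M).
  by apply/funext => x; rewrite PB_aE // mul_scalar_mx.
rewrite E; split; first exact: vCr_mulmx.
by rewrite (derive_mulmx _ 0).2 mul_scalar_mx.
Qed.

Lemma jac_col n (f : 'cV[R]_n -> 'cV[R]_n) x i j : jac f x i j = ('D_(delta_mx j 0) f x) i 0.
Proof. by rewrite mxE. Qed.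

Lemma sub_mxE m n (X Y : 'M[R]_(m, n)) i j : (X - Y) i j = X i j - Y i j.
Proof. by rewrite !mxE. Qed.

Lemma scale_mxE m n s (X : 'M[R]_(m, n)) i j : (s *: X) i j = s * X i j.
Proof. by rewrite mxE. Qed.

Lemma bil_family_comp n (d : 'I_n -> 'I_n -> 'I_n -> 'cV[R]_n) (a b x : 'cV[R]_n) :
  \sum_i a i 0 *: bil (d i) x (\sum_j b j 0 *: bil (d j) x x) =
  \sum_i \sum_j (a i 0 * b j 0) *: bil (d i) x (bil (d j) x x).
Proof.
apply: eq_bigr => i _; rewrite (lin_sum (bil_lin2 (d i) x)) scaler_sumr.
by apply: eq_bigr => j _; rewrite scalerA.
Qed.

Lemma bil_family_comm n (d : 'I_n -> 'I_n -> 'I_n -> 'cV[R]_n) (a b x : 'cV[R]_n) :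
  (forall i j, bil (d i) x (bil (d j) x x) = bil (d j) x (bil (d i) x x)) ->
  \sum_i a i 0 *: bil (d i) x (\sum_j b j 0 *: bil (d j) x x) =
  \sum_i b i 0 *: bil (d i) x (\sum_j a j 0 *: bil (d j) x x).
Proof.
move=> dC; rewrite !bil_family_comp exchange_big; apply: eq_bigr => i _; apply: eq_bigr => j _.
by rewrite dC [a j 0 * b i 0]mulrC.
Qed.

Lemma one_mulmx n m (y : 'M[R]_(n.+1, m)) : (1 : 'M[R]_n.+1) *m y = y.
Proof. exact: mul1mx. Qed.

Lemma add1_mulmx n m (X : 'M[R]_n.+1) (y : 'M[R]_(n.+1, m)) : (1 + X) *m y = y + X *m y.
Proof. by rewrite mulmxDl one_mulmx. Qed.

(** Linear algebra of the final jet comparison: the quadratic part [q] of the target and the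
    contributions of the linearization cancel, given the relation [N w = g] between the quadratic
    fields. *)
Lemma telescope_jets n m (N : 'M[R]_(m, n)) (hb hx b x qb qx w : 'cV[R]_n) (u q g : 'cV[R]_m) :
  N *m w = g ->
  N *m ((hb - b - qb) + (b - x - w) + (qb - qx) - (hx - x - qx)) - (u - N *m hx - q + (q - g)) =
  N *m hb - u.
Proof.
move=> <-; rewrite !(mulmxDr, mulmxN).
move: (N *m hb) (N *m b) (N *m qb) (N *m x) (N *m w) (N *m qx) (N *m hx) => c1 c2 c3 c4 c5 c6 c7.
by apply/colP => a; rewrite !coordE; ring.
Qed.

Section Action.
Variables (n k : nat) (B : 'M[R]_n.+1).
Hypothesis k2 : (2 <= k)%N.
Hypothesis uB : B \in unitmx.
Variables (A : 'cV[R]_n.+1 -> 'cV[R]_n.+1) (Bs : 'I_n.+1 -> 'cV[R]_n.+1 -> 'cV[R]_n.+1) (e : R).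
Hypothesis act : local_action k A Bs.
Hypothesis closeA : dC2 A (@PB_a R n.+1 k) < e.
Hypothesis closeB : forall i, dC2 (Bs i) (PB_b B i) < e.
Hypothesis e0 : 0 <= e.

Let A0 : A 0 = 0. Proof. by have [/germ_smooth[]] := act. Qed.
Let sA : smooth_near A. Proof. by have [/germ_smooth[]] := act. Qed.
Let B0 i : Bs i 0 = 0. Proof. by have [_ /(_ i)/germ_smooth[]] := act. Qed.
Let sB i : smooth_near (Bs i). Proof. by have [_ /(_ i)/germ_smooth[]] := act. Qed.
Let CA : vCr 3 A 0. Proof. exact: nbhs_singleton sA 3%N. Qed.
Let CB i : vCr 3 (Bs i) 0. Proof. exact: (nbhs_singleton (sB i)) 3%N. Qed.
Let K2 : 2 <= k%:R :> R. Proof. by rewrite ler_nat. Qed.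
Let K0 : 0 < k%:R :> R. Proof. by apply: lt_le_trans K2. Qed.

Let L := jac A 0.
Let c i := second_coef (Bs i).
Let t : 'M[R]_n.+1 := k%:R *: L - 1.

Let LE : L = k%:R^-1 *: (1 + t).
Proof. by rewrite /t addrC subrK scalerA mulVf ?scale1r // gt_eqF. Qed.

Lemma norm_linear_part_a : `|t| <= k%:R * e.
Proof.
apply: mx_norm_le => [|i j]; first by rewrite mulr_ge0.
have [Pa Da] := @PB_a_derive n.+1 k j (ltnW k2).
have [/(_ j) H _] := dC2_lt CA Pa closeA.
have {}H : `|('D_(delta_mx j 0) A 0) i 0 - (k%:R^-1 *: (delta_mx j 0 : 'cV[R]_n.+1)) i 0| <= e.
  by rewrite -Da; apply: le_trans H; have := norm_coord ('D_(delta_mx j 0) A 0 - 'D_(delta_mx j 0) (@PB_a R n.+1 k) 0) i; rewrite coordD coordN.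
have -> : t i j = k%:R * (('D_(delta_mx j 0) A 0) i 0 - (k%:R^-1 *: (delta_mx j 0 : 'cV[R]_n.+1)) i 0).
  have I1 : (1 : 'M[R]_n.+1) i j = (i == j)%:R by rewrite mxE.
  have I2 : (delta_mx j 0 : 'cV[R]_n.+1) i 0 = (i == j)%:R by rewrite mxE eqxx andbT.
  rewrite /t sub_mxE scale_mxE jac_col coordZ I1 I2.
  by rewrite mulrBr mulrA mulfV ?mul1r // gt_eqF.
by rewrite normrM ger0_norm //; apply: ler_wpM2l.
Qed.

Lemma norm_linear_part_b i : `|jac (Bs i) 0 - 1| <= e.
Proof.
apply: mx_norm_le => // a b.
have [Pb [Jb _]] := PB_b_jets B i.
have [/(_ b) H _] := dC2_lt (CB i) Pb (closeB i).
have := le_trans (norm_coord _ a) H; rewrite coordD coordN -!jac_col Jb.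
by rewrite sub_mxE.
Qed.

Lemma second_coef_close i a b : `|c i a b - inv_coef (col i B) a b| <= e.
Proof.
have [Pb [_ Sb]] := PB_b_jets B i.
by have [_ /(_ a b)] := dC2_lt (CB i) Pb (closeB i); rewrite Sb.
Qed.

Let jA : jet2 A L (second_coef A). Proof. exact: (vCr_jet2 CA A0).2.2. Qed.
Let jB i : jet2 (Bs i) (jac (Bs i) 0) (c i). Proof. exact: (vCr_jet2 (CB i) (B0 i)).2.2. Qed.
Let c_sym i a b : c i a b = c i b a. Proof. exact: (vCr_jet2 (CB i) (B0 i)).1 a b. Qed.

Let rel i : \forall x \near (0 : 'cV[R]_n.+1), A (Bs i x) = iter k (Bs i) (A x).
Proof. by have [_ _ /(_ i)] := act. Qed.

Lemma linear_relation i :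
  (1 + t) * (1 + (jac (Bs i) 0 - 1)) = (1 + (jac (Bs i) 0 - 1)) ^+ k * (1 + t).
Proof.
rewrite [1 + (jac _ _ - 1)]addrC subrK.
have -> : 1 + t = k%:R *: L by rewrite /t addrC subrK.
rewrite -scalerAl -scalerAr; congr (_ *: _).
apply/subr0_eq; apply: linear_isO2.
have H1 := jet1_comp (jet2_isO2 jA) (jet2_isO2 (jB i)).
have H2 := jet1_comp (jet1_iter k (jet2_isO2 (jB i))) (jet2_isO2 jA).
have := isOB H2 H1; apply: isO_near_eq; apply: filterS (rel i) => x ->.
rewrite mulmxBl -!mulmxE.
move: (iter k (Bs i) (A x)) (L *m _ *m x) (_ *m L *m x) => u v w.
by apply/colP => a; rewrite !coordE; ring.
Qed.

Hypothesis J1 : forall i, jac (Bs i) 0 = 1%:M.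

Let jB1 i : jet2 (Bs i) 1%:M (c i). Proof. by have H := jB i; rewrite J1 in H; exact: H. Qed.

(** The quadratic parts of the [Bs i], extended linearly so that [col i B] is the index of [Bs i];
    the family is then comparable with [inv_field v]. *)
Definition field_at (v x y : 'cV[R]_n.+1) : 'cV[R]_n.+1 :=
  \sum_i (invmx B *m v) i 0 *: bil (c i) x y.

Lemma field_at_lin1 x y : is_lin (fun v => field_at v x y).
Proof.
move=> s v w; rewrite /field_at scaler_sumr -big_split; apply: eq_bigr => i _ /=.
by rewrite mulmxDr -scalemxAr !coordE scalerDl scalerA.
Qed.

Lemma field_at_lin3 v x : is_lin (field_at v x).
Proof.
move=> s y z; rewrite /field_at scaler_sumr -big_split; apply: eq_bigr => i _ /=.
by rewrite bil_lin2 scalerDr !scalerA mulrC.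
Qed.

Lemma field_at_sym v x y : field_at v x y = field_at v y x.
Proof. by apply: eq_bigr => i _; rewrite bil_sym. Qed.

Lemma field_at_lin2 v y : is_lin (fun x => field_at v x y).
Proof. by move=> s x z; rewrite !(field_at_sym _ _ y) field_at_lin3. Qed.

Lemma field_at_col i x y : field_at (col i B) x y = bil (c i) x y.
Proof.
rewrite /field_at colE mulmxA mulVmx // mul1mx (bigD1 i) //= mxE !eqxx scale1r big1 ?addr0 //.
by move=> j /negPf ji; rewrite mxE ji scale0r.
Qed.

Lemma field_at_close KB v x y : 0 <= KB -> (forall v : 'cV[R]_n.+1, `|invmx B *m v| <= KB * `|v|) ->
  `|field_at v x y - inv_field v x y| <= n.+1%:R ^+ 3 * KB * e * (`|v| * (`|x| * `|y|)).
Proof.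
move=> KB0 HB; have -> : inv_field v x y = \sum_i (invmx B *m v) i 0 *: inv_field (col i B) x y.
  rewrite -(lin_sum (inv_field_lin1 y x)); congr (inv_field _ x y).
  rewrite -{1}(mulKVmx uB v); apply/colP => a; rewrite mxE summxE.
  by apply: eq_bigr => j _; rewrite coordZ [col j B a 0]mxE mulrC.
rewrite -sumrB; apply: le_trans (ler_norm_sum _ _ _) _.
have -> : n.+1%:R ^+ 3 * KB * e * (`|v| * (`|x| * `|y|)) =
   \sum_(i < n.+1) (KB * `|v|) * (n.+1%:R ^+ 2 * e * (`|x| * `|y|)).
  by rewrite sumr_const card_ord -[RHS]mulr_natl; ring.
apply: ler_sum => i _; rewrite -scalerBr; apply: normZ_le.
  exact: le_trans (norm_coord _ _) (HB v).
have -> : bil (c i) x y - inv_field (col i B) x y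
    = bil (fun a b => c i a b - inv_coef (col i B) a b) x y.
  rewrite inv_fieldE /bil -sumrB; apply: eq_bigr => a _; rewrite -sumrB.
  by apply: eq_bigr => b _; rewrite -scalerBr.
by apply: bil_le => // a b; exact: second_coef_close.
Qed.

Lemma field_at_comm v w x : field_at v x (field_at w x x) = field_at w x (field_at v x x).
Proof.
have BC i j : bil (c i) x (bil (c j) x x) = bil (c j) x (bil (c i) x x).
  have isL l : isLip 2 (fun x => Bs l x - x - bil (c l) x x).
    have [_ [H _]] := vCr_jet2 (CB l) (B0 l).
    have -> // : (fun x => Bs l x - x - bil (c l) x x) =
      (fun x => Bs l x - jac (Bs l) 0 *m x - bil (second_coef (Bs l)) x x).
    by apply/funext => y; rewrite J1 mul1mx.
  apply: (jet3_commute (c_sym i) (c_sym j) (B0 i) (B0 j) (isL i) (isL j)).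
  by have [_ _ _ /(_ i j)] := act.
exact: (bil_family_comm (invmx B *m v) (invmx B *m w) BC).
Qed.

(** In [jet2_relation] with [L = (1 + t) / k], the factor [k] from [b ^ k] and the two factors
    [1 / k] in the arguments of the quadratic part balance the [1 / k] on the left. *)
Lemma field_at_symmetry v x :
  field_at v x x + t *m field_at v x x = field_at v (x + t *m x) (x + t *m x).
Proof.
rewrite -!add1_mulmx /field_at mulmx_sumr; apply: eq_bigr => i _; rewrite -scalemxAr; congr (_ *: _).
have := jet2_relation jA (jB1 i) (rel i) x; rewrite LE -!scalemxAl bilZ_homog.
move/(congr1 (fun z => k%:R *: z)); rewrite !scalerA mulfV ?gt_eqF // scale1r => ->.
have -> : k%:R * k%:R * k%:R^-1 ^+ 2 = 1 :> R by field; rewrite gt_eqF.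
by rewrite scale1r.
Qed.

Hypothesis t0 : t = 0.
Variables (N C : 'M[R]_n.+1).
Hypothesis uN : N \in unitmx.
Hypothesis uC : C \in unitmx.
Hypothesis NC : forall v x, N *m field_at v x x = inv_field (C *m v) (N *m x) (N *m x).

Lemma conjugacy_exists : exists (B' : 'M[R]_n.+1) (H : 'cV[R]_n.+1 -> 'cV[R]_n.+1),
        [/\ B' \in unitmx, is_local_diffeo_germ H,
            germ_eq (@PB_a R n.+1 k \o H) (H \o A)
          & forall i, germ_eq (PB_b B' i \o H) (H \o Bs i)].
Proof.
have A2 : isO 2 (fun x => A x - k%:R^-1 *: x).
  apply: isO_ext (jet2_isO2 jA) => x.
  by rewrite LE t0 addr0 -scalemxAl one_mulmx.
have [H0 [sH H00 H2 HA]] := sternberg k2 (And3 sA A0 A2).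
(* [N] turns the quadratic part of [Bs i] into the conformal field of [C] applied to [col i B],
   whence the new basis. It follows the linearization [H0], as it commutes with the homothety of
   ratio [1 / k]. *)
exists (C *m B), (fun x => N *m H0 x).
have CH : vCr 3 H0 0 by exact: (nbhs_singleton sH) 3%N.
have H2' : isO 2 (fun x => H0 x - 1 *: x) by apply: isO_ext H2 => x; rewrite scale1r.
have JH : jac H0 0 = 1%:M.
  apply/matrixP => i j; rewrite jac_col (isO2_derive H00 H2') scale1r !mxE eqxx andbT.
  by [].
have [_ [_ jH]] := vCr_jet2 CH H00; rewrite JH in jH.
set h := second_coef H0 in jH.
have OH0 := jet2_isO1 jH.
have OH : isO 1 (fun x => N *m H0 x) by exact: isO_mulmx.
have HNA : \forall x \near (0 : 'cV[R]_n.+1), N *m H0 (A x) = k%:R^-1 *: (N *m H0 x).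
  by apply: filterS HA => x ->; rewrite -scalemxAr.
split.
- by rewrite unitmx_mul uC.
- exact: local_diffeo_near_id.
- by apply: filterS HNA => x /= ->; rewrite PB_aE // (ltnW k2).
move=> i; set v := C *m col i B.
have colv : col i (C *m B) = v by rewrite /v !colE mulmxA.
have -> : PB_b (C *m B) i = inv_translation v by rewrite /PB_b colv.
pose tau := inv_translation v.
have Ct : vCr 2 tau 0 by exact: nbhs_singleton (vCr_inv_translation 2 v).
have jt : jet2 tau 1%:M (inv_coef v) by exact: jet2_inv_translation.
have tau2 : isO 2 (fun x => tau x - 1 *: x).
  by apply: isO_ext (jet2_isO2 jt) => x; rewrite scale1r mul1mx.
have Lt : isLip 1 (fun x => tau x - x).
  have := taylor1 Ct; have -> // : (fun x => tau x - tau 0 - 'D_x tau 0) = (fun x => tau x - x).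
  by apply/funext => x; rewrite (isO2_derive (inv_translation0 v) tau2) (inv_translation0 v : tau 0 = 0) subr0 scale1r.
have b1 := jet2_isO1 (jB1 i).
have b2 : isO 2 (fun x => Bs i x - x).
  by apply: isO_ext (jet2_isO2 (jB1 i)) => x; rewrite mul1mx.
suff : \forall x \near (0 : 'cV[R]_n.+1), N *m H0 (Bs i x) = tau (N *m H0 x).
  by apply: filterS => x /= ->.
apply: (@conjugacy_of_jet _ _ k A (Bs i) (fun x => N *m H0 x) tau) => //.
- exact: inv_translation_relation (ltnW k2).
- exact: inv_translation0.
(* Modulo order three, [N H0 (Bs i x)] and [tau (N H0 x)] exceed [N H0 x] by the same quadratic
   term: the second-order part of [H0] cancels because [Bs i] is tangent to the identity. *)
have T1 : isO 3 (fun x => N *m ((H0 (Bs i x) - 1%:M *m Bs i x - bil h (Bs i x) (Bs i x))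
     + (Bs i x - 1%:M *m x - bil (c i) x x)
     + (bil h (Bs i x) (Bs i x) - bil h x x)
     - (H0 x - 1%:M *m x - bil h x x))).
  apply: isO_mulmx.
  exact: (isOB (isOD (isOD (isO_comp jH b1) (jB1 i)) (bil_diff h b1 (isO_id _) b2)) jH).
have NH2 : isO 2 (fun x => N *m H0 x - N *m x).
  by apply: isO_ext (isO_mulmx N H2) => x; rewrite mulmxBr.
have T2 := isO_comp jt OH.
have T3 := bil_diff (inv_coef v) OH (isO_mulmx_id N) NH2.
have := isOB T1 (isOD T2 T3); apply: isO_ext => x /=.
have := NC (col i B) x; rewrite field_at_col inv_fieldE -/v => E.
by rewrite !mul1mx; exact: telescope_jets E.
Qed.

End Action.
End Assembly.

Theorem theorem2p1 (R : realType) (n k : nat) (B : 'M[R]_n) :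
  (1 <= n)%N -> (2 <= k)%N -> B \in unitmx ->
  exists eps : R, 0 < eps /\
    forall (A : 'cV[R]_n -> 'cV[R]_n) (Bs : 'I_n -> 'cV[R]_n -> 'cV[R]_n),
      local_action k A Bs ->
      dC2 A (@PB_a R n k) < eps ->
      (forall i, dC2 (Bs i) (PB_b B i) < eps) ->
      exists (B' : 'M[R]_n) (H : 'cV[R]_n -> 'cV[R]_n),
        [/\ B' \in unitmx, is_local_diffeo_germ H,
            germ_eq (@PB_a R n k \o H) (H \o A)
          & forall i, germ_eq (PB_b B' i \o H) (H \o Bs i)].
Proof.
case: n B => [//|n] B _ k2 uB.
pose p : R := n.+1%:R.
have p0 : 0 <= p by [].
have [K1 K10 HK1] := @linear_part_trivial R n k k2.
have [KB KB0 HKB] := mulmx_norm (invmx B).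
pose Kq := p ^+ 3 * KB.
have Kq0 : 0 <= Kq by rewrite mulr_ge0 // exprn_ge0.
(* [K2 e] and [K3 e] are the quantities required to be small by [symmetry_trivial] and
   [commuting_fields_rigidity] when the fields are [Kq e]-close to the conformal ones and
   [|t| <= k e]. *)
pose K2 := (2 + p) * Kq + (3 * p + 1) * k%:R.
have K20 : 0 <= K2 by rewrite addr_ge0 // !mulr_ge0 // !addr_ge0 // !mulr_ge0.
pose K3 := 32 * p ^+ 4 * (9 * (8 * p * Kq)).
have K30 : 0 <= K3 by rewrite !mulr_ge0 // exprn_ge0.
(* The sum dominates all the constants, so that [e = 1 / (2 D)] makes each of their products with
   [e] at most [1 / 2]; the summand 1 gives [e <= 1]. *)
pose D := K1 + K2 + K3 + Kq + 1.
have D0 : 0 < D by rewrite /D; move: K10 K20 K30 Kq0; lra.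
pose e := 1 / (2 * D).
have e0 : 0 < e by rewrite divr_gt0 // mulr_gt0.
have eD : D * e = 2^-1 by rewrite /e; field; rewrite gt_eqF.
have Ke K : 0 <= K -> K <= D -> K * e <= 2^-1.
  by move=> K0 KD; rewrite -eD; apply: ler_wpM2r => //; exact: ltW.
exists e; split=> // A Bs act cA cB.
have e1 : e <= 1.
  have : 1 * e <= 2^-1 by apply: Ke; rewrite // /D; move: K10 K20 K30 Kq0; lra.
  rewrite mul1r; lra.
have K1e : K1 * e <= 2^-1 by apply: Ke; rewrite /D; move: K10 K20 K30 Kq0; lra.
have K2e : K2 * e <= 2^-1 by apply: Ke => //; rewrite /D; move: K10 K20 K30 Kq0; lra.
have K3e : K3 * e <= 2^-1 by apply: Ke => //; rewrite /D; move: K10 K20 K30 Kq0; lra.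
have Kqe : Kq * e <= 2^-1 by apply: Ke => //; rewrite /D; move: K10 K20 K30 Kq0; lra.
have ne := ltW e0.
pose t : 'M[R]_n.+1 := k%:R *: jac A 0 - 1.
have te : `|t| <= k%:R * e by exact: (norm_linear_part_a k2 act cA ne).
have J1 i : jac (Bs i) 0 = 1%:M.
  apply/subr0_eq; apply: (HK1 t _ e ne e1 K1e te).
    exact: (norm_linear_part_b act cB ne i).
  exact: (linear_relation act i).
pose Q := field_at B Bs.
have Qc v x y : `|Q v x y - inv_field v x y| <= Kq * e * (`|v| * (`|x| * `|y|)).
  exact: (field_at_close uB act cB ne v x y KB0 HKB).
have Qe0 : 0 <= Kq * e by exact: mulr_ge0.
have t0 : t = 0.
  apply: (@symmetry_trivial _ _ Q (Kq * e)) => //.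
  - exact: field_at_lin3.
  - exact: (field_at_sym B act).
  - by move: Kqe; lra.
  - exact: (field_at_symmetry B k2 act J1).
  - have h : (3 * p + 1) * `|t| <= (3 * p + 1) * (k%:R * e).
      by apply: ler_wpM2l; rewrite // addr_ge0 // mulr_ge0.
    have K2E : K2 * e = (2 + p) * (Kq * e) + (3 * p + 1) * (k%:R * e) by rewrite /K2; ring.
    by apply: le_trans K2e; rewrite K2E; exact: (lerD (lexx _) h).
have small : 32 * p ^+ 4 * (9 * (8 * p * (Kq * e))) <= 1.
  have -> : 32 * p ^+ 4 * (9 * (8 * p * (Kq * e))) = K3 * e by rewrite /K3; ring.
  by move: K3e; lra.
have [N [C [uN uC NC]]] := commuting_fields_rigidity (field_at_lin1 B Bs)
  (field_at_lin2 B act) (field_at_sym B act) (field_at_comm B act J1) Qe0 Qc small.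
exact: (conjugacy_exists k2 uB act J1 t0 uN uC NC).
Qed.
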